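(* Let $\mathcal{P}=\langle\Sigma\mid\mathcal{R}\rangle$ be a semigroup presentation and $w\in\Sigma^+$ a base word. Suppose that the Squier complex $S(\mathcal{P},w)$ is finite-dimensional and that the diagram group $D(\mathcal{P},w)$ is finitely generated. If $D(\mathcal{P},w)$ satisfies Property B, then it quasi-isometrically embeds into a product of $\dim S(\mathcal{P},w)$ trees.
   Context: A semigroup presentation $\mathcal{P}=\langle\Sigma\mid\mathcal{R}\rangle$ consists of an alphabet $\Sigma$ and a set $\mathcal{R}$ of relations $u=v$ with $u,v\in\Sigma^+$. Here $\Sigma^+$ is the free semigroup of non-empty words and $\Sigma^*=\Sigma^+\cup\{1\}$ also contains the empty word $1$. Convention: if $u=v\in\mathcal{R}$ then $v=u\notin\mathcal{R}$ (in particular $u=u\notin\mathcal{R}$). The Squier complex $S(\mathcal{P})$ is the cube complex whose vertices are the words over $\Sigma$; whose oriented edges are $(a,u\to v,b)$ with $a,b\in\Sigma^*$ and $u=v$ or $v=u$ in $\mathcal{R}$, going from $aub$ to $avb$ (and $(a,v\to u,b)$ is the same edge with opposite orientation); and whose $n$-cubes are similarly $(a_1,u_1\to v_1,\dots,a_n,u_n\to v_n,a_{n+1})$, spanned by the vertices $a_1w_1\cdots a_nw_na_{n+1}$ with $w_i\in\{u_i,v_i\}$. $S(\mathcal{P},w)$ is the connected component containing $w$. A semigroup diagram over $\mathcal{P}$ is a finite connected planar graph $\Delta$ (considered up to isotopy) with edges oriented and labelled by $\Sigma$ such that: $\Delta$ has exactly one source vertex $\iota$ and exactly one sink vertex $\tau$;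 the boundary of each cell (bounded face) has the form $pq^{-1}$, where $p$ (top path of the cell) and $q$ (bottom path) are positive paths whose labels satisfy $p=q\in\mathcal{R}$ or $q=p\in\mathcal{R}$; every vertex lies on a positive path from $\iota$ to $\tau$; every positive path is simple. $\Delta$ is bounded by two positive paths from $\iota$ to $\tau$, its top and bottom paths; it is a $(u,v)$-diagram if these are labelled $u$ and $v$. A dipole is a $(u,v)$-cell (top label $u$, bottom label $v$) together with a $(v,u)$-cell such that the top path of the first is the bottom path of the second; it is reduced by removing the common path and identifying the top path of the second cell with the bottom path of the first. A diagram is reduced if it has no dipoles; every diagram has a unique reduced form. The diagram group $D(\mathcal{P},w)$ is the set of reduced $(w,w)$-diagrams with product $\Delta_1\cdot\Delta_2$ = reduced form of the diagram obtained by gluing the bottom path of $\Delta_1$ to the top path of $\Delta_2$. It is naturally isomorphic to $\pi_1(S(\mathcal{P},w),w)$ (each edge of a loop gives a cell). $\#(\Delta)$ denotes the number of cells of $\Delta$. Property B: for a finitely generated $D(\mathcal{P},w)$ with word length $|\cdot|$ with respect to a finite generating set, there exist $C_1,C_2>0$ such that $C_1\cdot\#(\Delta)\leq|\Delta|\leq C_2\cdot\#(\Delta)$ for all $\Delta\in D(\mathcal{P},w)$. The group is equipped with a word metric for a finite generating set, and a product of trees with the $\ell^1$ combinatorial metric. *)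

(* Defs.v *)
From mathcomp Require Import all_boot all_order all_algebra.
From mathcomp Require Import boolp classical_sets cardinality reals.
From Stdlib Require List.

Set Implicit Arguments.
Unset Strict Implicit.
Unset Printing Implicit Defensive.

(** * Graphs with an arbitrary vertex type, and metrics *)

Section Graphs.
Variables (T : Type) (adj : T -> T -> Prop).

Fixpoint walk (x : T) (p : seq T) : Prop :=
  if p is y :: q then adj x y /\ walk y q else True.

Definition joined (n : nat) (x y : T) : Prop :=
  exists p, [/\ walk x p, last x p = y & size p = n].

Definition joinable (x y : T) : Prop := exists n, joined n x y.

(* The length of a shortest walk (0, by convention, if there is no walk). *)
Definition graph_dist (x y : T) : nat :=
  xget 0 [set n | joined n x y /\ forall m, joined m x y -> n <= m]%classic.

Definition acyclic : Prop :=
  forall x p, walk x p -> List.NoDup (x :: p) -> 2 <= size p ->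
    ~ adj (last x p) x.
End Graphs.

Record tree := Tree {
  tvert :> Type;
  tadj : tvert -> tvert -> Prop;
  tadj_sym : forall x y, tadj x y -> tadj y x;
  tadj_irr : forall x, ~ tadj x x;
  tree_connected : forall x y, joinable tadj x y;
  tree_acyclic : acyclic tadj }.

Definition trees_dist (d : nat) (T : 'I_d -> tree) (x y : forall i, T i) : nat :=
  \sum_(i < d) graph_dist (@tadj (T i)) (x i) (y i).

Definition qi_embedding (R : realType) (X Y : Type)
    (dX : X -> X -> nat) (dY : Y -> Y -> nat) (f : X -> Y) : Prop :=
  (exists A B : R, [/\ 1 <= A, 0 <= B & forall x y,
     A^-1 * (dX x y)%:R - B <= (dY (f x) (f y))%:R <= A * (dX x y)%:R + B])%R.

(** * Semigroup presentations and Squier complexes *)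

Record presentation (Sigma : Type) := Presentation {
  rel_of :> seq Sigma -> seq Sigma -> Prop;
  rel_nonempty : forall u v, rel_of u v -> u <> [::] /\ v <> [::];
  rel_asym : forall u v, rel_of u v -> ~ rel_of v u }.

Section Squier.
Variables (Sigma : Type) (P : presentation Sigma).
Local Notation word := (seq Sigma).

Definition step (u v : word) : Prop := P u v \/ P v u.

Definition squier_edge (x y : word) : Prop :=
  exists a u v b, [/\ step u v, x = a ++ u ++ b & y = a ++ v ++ b].

(* The n-cube (a_1, u_1 -> v_1, ..., a_n, u_n -> v_n, a_(n+1)) is given by the
   list of the n triples (a_i, u_i, v_i) and the last word a_(n+1). *)
Definition is_cube (s : seq (word * word * word)) : Prop :=
  List.Forall (fun t => step t.1.2 t.2) s.

(* The booleans in [b] choose w_i = v_i (true) or w_i = u_i (false). *)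
Fixpoint cube_vertex (s : seq (word * word * word)) (a : word) (b : seq bool)
    : word :=
  if s is (c, u, v) :: s' then
    c ++ (if head false b then v else u) ++ cube_vertex s' a (behead b)
  else a.

Definition squier_cube (w : word) (n : nat) : Prop :=
  exists s a, [/\ is_cube s, size s = n &
    forall b, joinable squier_edge w (cube_vertex s a b)].

Definition squier_dim (w : word) (d : nat) : Prop :=
  squier_cube w d /\ forall n, squier_cube w n -> n <= d.
End Squier.

(** * Semigroup diagrams *)

(* A plane graph is a combinatorial map. Every edge [e] carries two darts,
   [(e, true)] at its source and [(e, false)] at its target, and [rot] sends a
   dart to the next one, counterclockwise, around the same vertex. The cells are
   the bounded faces. Top paths have their cell below them (on their right),
   bottom paths have it above them. Vertices, edges and cells are numbered, but
   diagrams are considered up to [diag_iso] below. *)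
Record plane_graph (Sigma : Type) := PlaneGraph {
  nvert : nat;
  nedge : nat;
  ncell : nat;
  src : 'I_nedge -> 'I_nvert;
  tgt : 'I_nedge -> 'I_nvert;
  lab : 'I_nedge -> Sigma;
  rot : 'I_nedge * bool -> 'I_nedge * bool;
  top : 'I_ncell -> seq 'I_nedge;
  bot : 'I_ncell -> seq 'I_nedge;
  ini : 'I_nvert;
  ter : 'I_nvert;
  dtop : seq 'I_nedge;
  dbot : seq 'I_nedge }.

Notation vert D := 'I_(nvert D).
Notation edge D := 'I_(nedge D).
Notation cell D := 'I_(ncell D).

Section PlaneGraphs.
Variables (Sigma : Type) (D : plane_graph Sigma).
Local Notation dart := (edge D * bool)%type.
Implicit Types (x y : vert D) (e : edge D) (d : dart) (p : seq (edge D)).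

Definition org d : vert D := if d.2 then src d.1 else tgt d.1.
Definition flip d : dart := (d.1, ~~ d.2).

(* The orbit of a dart [d] under [face] is the boundary of the face lying on the
   right of [d], traversed clockwise. *)
Definition face d : dart := rot (flip d).

Definition forth p : seq dart := [seq (e, true) | e <- p].
Definition back p : seq dart := rev [seq (e, false) | e <- p].

(* [None] stands for the unbounded face. *)
Definition boundary (f : option (cell D)) : seq dart :=
  if f is Some c then forth (top c) ++ back (bot c)
  else forth (dbot D) ++ back (dtop D).

Definition neighbour : rel (vert D) := fun x y =>
  [exists e, ((src e == x) && (tgt e == y)) || ((src e == y) && (tgt e == x))].

Fixpoint pos_path x p y : Prop :=
  if p is e :: q then src e = x /\ pos_path (tgt e) q y else x = y.

Definition dlabel p : seq Sigma := [seq lab e | e <- p].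

End PlaneGraphs.

Section Diagrams.
Variables (Sigma : Type) (P : presentation Sigma).

(* Connectedness, [rot_orbit], [faces] and Euler's formula say that the map is
   drawn on the sphere and that its faces are the unbounded one and the cells.
   Consecutive darts of a face cycle are adjacent, so that [face_cycle] makes
   the top and bottom paths of a cell positive paths with common ends. *)
Record is_diagram (D : plane_graph Sigma) : Prop := IsDiagram {
  rot_inj : injective (@rot _ D);
  rot_orbit : forall d d', fconnect (@rot _ D) d d' = (org d == org d');
  graph_connected : forall x y : vert D, connect (@neighbour _ D) x y;
  face_cycle : forall f, fcycle (@face _ D) (boundary f);
  face_uniq : forall f : option (cell D), uniq (boundary f);
  faces : forall d : edge D * bool, exists! f, d \in boundary f;
  euler : nvert D + (ncell D).+1 = nedge D + 2;
  source_unique : forall x, (forall e : edge D, tgt e <> x) <-> x = ini D;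
  sink_unique : forall x, (forall e : edge D, src e <> x) <-> x = ter D;
  cell_label : forall c : cell D, step P (dlabel (top c)) (dlabel (bot c));
  on_path : forall x, exists p q,
    pos_path (ini D) p x /\ pos_path x q (ter D);
  path_simple : forall (x y : vert D) p,
    pos_path x p y -> uniq (x :: [seq tgt e | e <- p]);
  dtop_path : pos_path (ini D) (dtop D) (ter D);
  dbot_path : pos_path (ini D) (dbot D) (ter D) }.

Record diagram := Diagram {
  graph_of :> plane_graph Sigma;
  diagramP : is_diagram graph_of }.

(* On the edges in [A], (fv, fe) is a morphism of labelled graphs. *)
Definition graph_morphism (D D' : diagram) (A : pred (edge D))
    (fv : vert D -> vert D') (fe : edge D -> edge D') : Prop :=
  forall e, A e -> [/\ src (fe e) = fv (src e), tgt (fe e) = fv (tgt e)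
                     & lab (fe e) = lab e].

(* Plane isotopy: an isomorphism preserving the rotation and the faces. *)
Definition diag_iso (D D' : diagram) : Prop :=
  exists (fv : vert D -> vert D') (fe : edge D -> edge D')
         (fc : cell D -> cell D'),
    [/\ [/\ bijective fv, bijective fe & bijective fc],
        graph_morphism predT fv fe,
        forall d : edge D * bool,
          rot (fe d.1, d.2) = (fe (rot d).1, (rot d).2),
        forall c, top (fc c) = map fe (top c) /\ bot (fc c) = map fe (bot c)
      & [/\ fv (ini D) = ini D', fv (ter D) = ter D',
            dtop D' = map fe (dtop D) & dbot D' = map fe (dbot D)]].

(* [D] is obtained by gluing the bottom path of [D1] to the top path of [D2].
   The face boundaries of [D] determine [face], hence [rot], hence the vertices;
   so it is enough to say what the edges and the cells of [D] are. *)
Definition concat (D1 D2 D : diagram) : Prop :=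
  exists (v1 : vert D1 -> vert D) (f1 : edge D1 -> edge D)
         (c1 : cell D1 -> cell D)
         (v2 : vert D2 -> vert D) (f2 : edge D2 -> edge D)
         (c2 : cell D2 -> cell D),
    [/\ [/\ graph_morphism predT v1 f1, graph_morphism predT v2 f2,
            injective f1 & injective f2],
        [/\ forall e, (exists e1, f1 e1 = e) \/ (exists e2, f2 e2 = e),
            map f1 (dbot D1) = map f2 (dtop D2) &
            forall e1 e2, f1 e1 = f2 e2 -> e1 \in dbot D1 /\ e2 \in dtop D2],
        bijective (fun c : cell D1 + cell D2 =>
                     match c with inl a => c1 a | inr a => c2 a end),
        (forall c, top (c1 c) = map f1 (top c) /\ bot (c1 c) = map f1 (bot c)) /\
        (forall c, top (c2 c) = map f2 (top c) /\ bot (c2 c) = map f2 (bot c))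
      & dtop D = map f1 (dtop D1) /\ dbot D = map f2 (dbot D2)].

Definition dipole (D : diagram) (c1 c2 : cell D) : Prop :=
  top c1 = bot c2 /\ dlabel (bot c1) = dlabel (top c2).

Definition reduced (D : diagram) : Prop :=
  forall c1 c2 : cell D, ~ dipole c1 c2.

(* [D'] is obtained from [D] by reducing one dipole (c1, c2): the common path
   [top c1] and both cells disappear, [top c2] and [bot c1] are identified edge
   by edge. The values of [fe] on [top c1] are irrelevant. As for [concat], the
   vertices of [D'] are determined by its edges and cells. *)
Definition reduction (D D' : diagram) : Prop :=
  exists c1 c2 : cell D, dipole c1 c2 /\
  exists (fv : vert D -> vert D') (fe : edge D -> edge D')
         (fc : cell D' -> cell D),
    [/\ [/\ graph_morphism [predC top c1] fv fe,
            fv (ini D) = ini D' & fv (ter D) = ter D'],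
        [/\ forall e', exists2 e, e \notin top c1 & fe e = e',
            map fe (top c2) = map fe (bot c1) &
            forall e1 e2, e1 \notin top c1 -> e2 \notin top c1 ->
              fe e1 = fe e2 ->
              [\/ e1 = e2, (e1, e2) \in zip (top c2) (bot c1)
                | (e2, e1) \in zip (top c2) (bot c1)]],
        injective fc /\
        (forall c, (exists c', fc c' = c) <-> c <> c1 /\ c <> c2),
        forall c', top c' = map fe (top (fc c')) /\
                   bot c' = map fe (bot (fc c'))
      & dtop D' = map fe (dtop D) /\ dbot D' = map fe (dbot D)].

Inductive reduces (D : diagram) : diagram -> Prop :=
| reduces_refl : reduces D D
| reduces_step D1 D2 : reduces D D1 -> reduction D1 D2 -> reduces D D2.

End Diagrams.

(** * Diagram groups *)

Section DiagramGroup.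
Local Open Scope classical_set_scope.
Variables (Sigma : Type) (P : presentation Sigma) (w : seq Sigma).

Definition reduced_ww (D : diagram P) : Prop :=
  [/\ dlabel (dtop D) = w, dlabel (dbot D) = w & reduced D].

(* An element of D(P, w) is the isotopy class of a reduced (w, w)-diagram. *)
Definition diagram_group : Type :=
  {A : set (diagram P) | exists2 D, reduced_ww D & A = [set D' | diag_iso D D']}.

Definition representative (g : diagram_group) : diagram P :=
  s2val (cid2 (svalP g)).

Definition number_of_cells (g : diagram_group) : nat := ncell (representative g).

(* k = g . h *)
Definition is_product (g h k : diagram_group) : Prop :=
  exists D1 D2 D D', [/\ sval g D1, sval h D2, concat D1 D2 D, reduces D D'
                       & sval k D'].

(* The identity is the only (w, w)-diagram without cells. *)
Definition is_identity (g : diagram_group) : Prop := number_of_cells g = 0.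

(* Adjacency in the Cayley graph: h = g . s or g = h . s with s in S. *)
Definition cayley (S : set diagram_group) (g h : diagram_group) : Prop :=
  exists2 s, S s & is_product g s h \/ is_product h s g.

Definition word_metric (S : set diagram_group) : diagram_group ->
  diagram_group -> nat := graph_dist (cayley S).

Definition generates (S : set diagram_group) : Prop :=
  exists2 e, is_identity e & forall g, joinable (cayley S) e g.

Definition property_B (R : realType) (S : set diagram_group) : Prop :=
  (exists2 e, is_identity e & exists C1 C2 : R, [/\ 0 < C1, 0 < C2 & forall g,
     C1 * (number_of_cells g)%:R <= (word_metric S e g)%:R <= C2 * (number_of_cells g)%:R])%R.

End DiagramGroup.

(* Main.v *)
Require Import Defs.
From mathcomp Require Import all_boot all_order all_algebra.
From mathcomp Require Import boolp classical_sets cardinality reals.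
From mathcomp Require Import zify.
Import Defs.

(** A diagram is peeled into cells, from top to bottom, and so gives a
derivation, that is, an edge path of the Squier complex, well defined up to
exchanging independent moves. Conversely each derivation comes from a diagram,
and removing dipoles is a confluent way of cancelling pairs of inverse moves.
Hence the diagram group is the group of derivations from [w] to [w] up to
homotopy, and the number of cells of a reduced diagram is the length of a
reduced derivation.

Give the move [(a, u -> v, b)] the color dim S(P, a). In a square of the
Squier complex the two moves have different colors, and opposite sides have the
same color; as [a] can be enlarged by the cell itself there are at most
dim S(P, w) colors. In the universal cover, collapsing the edges whose color is
not [i] yields a tree, since each hyperplane separates and corresponds to one
edge of the tree. A reduced derivation crosses each hyperplane at most once, so
its length is the sum over the colors of the distances in the trees. By
Property B this length is comparable with the word length. *)

Set Implicit Arguments.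
Unset Strict Implicit.
Unset Printing Implicit Defensive.

(** * Derivations *)

Section Derivations.
Variables (Sigma : Type) (P : presentation Sigma).
Local Notation word := (seq Sigma).

(** Planarity enters only through Euler's formula. Peeling requires that a cut other than the bottom
    path contain the whole top path of some cell. The reason is a count: passages from an incoming
    to an outgoing dart, in the rotation at a vertex, number at most [nvert - 2], and every interior
    vertex has one, so none has two. Top paths therefore cannot interleave at a vertex.

    Confluence is proved inside a diagram and not on sequences of moves: there two cancelling pairs
    are pairs of cells, which coincide, share a cell or are disjoint, whatever swaps hide them.
    Diagrams serve once more for hyperplanes. A homotopy may destroy an occurrence of a word that
    both its ends leave alone; in a diagram that occurrence consists of edges common to the top and
    bottom paths, and removing dipoles never touches these. This is why a reduced derivation does
    not cross a hyperplane twice.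

    The sum of the tree distances is exactly the number of cells of the quotient of the two
    elements. Property B speaks of distances from the identity only, so left invariance of the word
    metric completes the comparison. *)

Record move := Move { ml : word; mu : word; mv : word; mr : word }.

Definition msrc m := ml m ++ mu m ++ mr m.
Definition mtgt m := ml m ++ mv m ++ mr m.
Definition minv m := Move (ml m) (mv m) (mu m) (mr m).
Definition sinv (s : seq move) := rev (map minv s).

Fixpoint deriv (x : word) (s : seq move) (y : word) : Prop :=
  if s is m :: s' then
    [/\ step P (mu m) (mv m), msrc m = x & deriv (mtgt m) s' y]
  else x = y.

Inductive square : seq move -> seq move -> Prop :=
  Square a u v b u' v' c :
    square [:: Move a u v (b ++ u' ++ c); Move (a ++ v ++ b) u' v' c]
           [:: Move (a ++ u ++ b) u' v' c; Move a u v (b ++ v' ++ c)].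

Inductive swap : seq move -> seq move -> Prop :=
  Swap a b s t : square s t \/ square t s -> swap (a ++ s ++ b) (a ++ t ++ b).

Inductive comm : seq move -> seq move -> Prop :=
| comm_refl s : comm s s
| comm_step s t r : comm s t -> swap t r -> comm s r.

Inductive cancel : seq move -> seq move -> Prop :=
  Cancel a m b : cancel (a ++ [:: m; minv m] ++ b) (a ++ b).

Definition hstep s t := [\/ swap s t, cancel s t | cancel t s].

(** Each term of the chain is required to be a derivation: swaps and cancellations preserve
    derivations, but an inserted pair [m; minv m] might not be applicable. *)
Inductive htpy (x y : word) : seq move -> seq move -> Prop :=
| htpy_refl s : deriv x s y -> htpy x y s s
| htpy_step s t r : htpy x y s t -> hstep t r -> deriv x r y -> htpy x y s r.

Lemma step_sym u v : step P u v -> step P v u.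
Proof. by case; [right | left]. Qed.

Lemma step_nilL u v : step P u v -> u <> [::].
Proof. by case=> /rel_nonempty[]. Qed.

Lemma step_nilR u v : step P u v -> v <> [::].
Proof. by move/step_sym/step_nilL. Qed.

Lemma minvK : involutive minv.
Proof. by case. Qed.

Lemma sinvK : involutive sinv.
Proof. by move=> s; rewrite /sinv map_rev revK -map_comp (eq_map minvK) map_id. Qed.

Lemma deriv_cat x s t z :
  deriv x (s ++ t) z <-> exists2 y, deriv x s y & deriv y t z.
Proof.
elim: s x => [|m s IH] x /=; first by split=> [h|[y ->]]; first exists x.
split=> [[hm <- /IH[y h1 h2]]|[y [hm <- h1] h2]]; first by exists y.
by split=> //; apply/IH; exists y.
Qed.

Lemma deriv_fun x s y z : deriv x s y -> deriv x s z -> y = z.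
Proof.
by elim: s x => [|m s IH] x /= => [-> ->|[_ _ h1] [_ _ h2]] //; apply: IH h1 h2.
Qed.

Lemma deriv_sinv x s y : deriv x s y -> deriv y (sinv s) x.
Proof.
elim: s x => [|m s IH] x /= => [->//|[hm <- /IH h]].
rewrite /sinv /= rev_cons -cats1; apply/deriv_cat; exists (mtgt m) => //=.
by split=> //; apply: step_sym.
Qed.

Lemma square_deriv s t x y : square s t \/ square t s ->
  deriv x s y -> deriv x t y.
Proof.
case=> -[a u v b u' v' c] /=; rewrite /msrc /mtgt /= -!catA.
  by case=> h1 <- [h2 _ <-].
by case=> h1 <- [h2 _ <-].
Qed.

Lemma swap_deriv s t x y : swap s t -> deriv x s y -> deriv x t y.
Proof.
case=> a b {}s {}t h /deriv_cat[z h1 /deriv_cat[z' h2 h3]].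
by apply/deriv_cat; exists z => //; apply/deriv_cat; exists z' => //;
  apply: square_deriv h h2.
Qed.

Lemma swap_sym s t : swap s t -> swap t s.
Proof. by case=> a b {}s {}t [] h; apply: Swap; [right | left]. Qed.

Lemma swap_size s t : swap s t -> size s = size t.
Proof. by case=> a b {}s {}t h; rewrite !size_cat; congr (_ + (_ + _)); case: h => -[]. Qed.

Lemma swap_cat a b s t : swap s t -> swap (a ++ s ++ b) (a ++ t ++ b).
Proof.
case=> a' b' {}s {}t h.
have := Swap (a ++ a') (b' ++ b) h; by rewrite -!catA.
Qed.

Lemma comm_trans s t r : comm s t -> comm t r -> comm s r.
Proof. by move=> h1 h2; elim: h2 h1 => // t' r1 r2 _ IH h2 /IH h; apply: comm_step h h2. Qed.

Lemma comm_sym s t : comm s t -> comm t s.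
Proof.
elim=> [?|s' t' r _ IH h]; first exact: comm_refl.
by apply: comm_trans IH; apply: comm_step (swap_sym h); apply: comm_refl.
Qed.

Lemma comm_size s t : comm s t -> size s = size t.
Proof. by elim=> // s' t' r _ -> /swap_size. Qed.

Lemma comm_deriv s t x y : comm s t -> deriv x s y -> deriv x t y.
Proof. by elim=> // s' t' r _ IH h /IH; apply: swap_deriv. Qed.

Lemma comm_cat a b s t : comm s t -> comm (a ++ s ++ b) (a ++ t ++ b).
Proof.
elim=> [?|s' t' r _ IH h]; first exact: comm_refl.
by apply: comm_step IH _; apply: swap_cat.
Qed.

Lemma hstep_sym s t : hstep s t -> hstep t s.
Proof.
by case=> h; [apply: Or31; apply: swap_sym | apply: Or33 | apply: Or32].
Qed.

Lemma cancel_cat a b s t : cancel s t -> cancel (a ++ s ++ b) (a ++ t ++ b).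
Proof.
by case=> a' m b'; have := Cancel (a ++ a') m (b' ++ b); rewrite -!catA.
Qed.

Lemma hstep_cat a b s t : hstep s t -> hstep (a ++ s ++ b) (a ++ t ++ b).
Proof.
case=> h; [apply: Or31; exact: swap_cat | apply: Or32; exact: cancel_cat |].
by apply: Or33; exact: cancel_cat.
Qed.

Lemma cancel_deriv s t x y : cancel s t -> deriv x s y -> deriv x t y.
Proof.
case=> a m b /deriv_cat[z h1 /= [hm h2 [_ _ h3]]].
by apply/deriv_cat; exists z => //; rewrite -h2.
Qed.

Lemma htpy_derivL x y s t : htpy x y s t -> deriv x s y.
Proof. by move=> h; elim: h. Qed.

Lemma htpy_derivR x y s t : htpy x y s t -> deriv x t y.
Proof. by move=> h; elim: h. Qed.

Lemma htpy_trans x y s t r : htpy x y s t -> htpy x y t r -> htpy x y s r.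
Proof.
by move=> h1 h2; elim: h2 h1 => // t' r1 r2 _ IH h2 h3 /IH h; apply: htpy_step h h2 h3.
Qed.

Lemma htpy_sym x y s t : htpy x y s t -> htpy x y t s.
Proof.
elim=> [s' h|s' t' r h1 IH h h2]; first exact: htpy_refl.
apply: htpy_trans IH; apply: htpy_step (hstep_sym h) (htpy_derivR h1).
exact: htpy_refl.
Qed.

Lemma comm_htpy x y s t : deriv x s y -> comm s t -> htpy x y s t.
Proof.
move=> hs hst; elim: hst hs => [s' hs|s' t' r h IH h2 hs]; first exact: htpy_refl.
apply: htpy_step (IH hs) (Or31 _ _ h2) _.
by apply: swap_deriv h2 _; apply: comm_deriv h hs.
Qed.

Lemma htpy_cat x y z w s t a b : htpy x y s t -> deriv z a x -> deriv y b w ->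
  htpy z w (a ++ s ++ b) (a ++ t ++ b).
Proof.
move=> h ha hb.
have cat s' : deriv x s' y -> deriv z (a ++ s' ++ b) w.
  by move=> hs; apply/deriv_cat; exists x => //; apply/deriv_cat; exists y.
elim: h => [s' hs|s' t' r h1 IH h h2]; first exact/htpy_refl/cat.
by apply: htpy_step IH (hstep_cat _ _ h) (cat _ h2).
Qed.

Lemma htpy_cat2 x y z s s' t t' : htpy x y s s' -> htpy y z t t' ->
  htpy x z (s ++ t) (s' ++ t').
Proof.
move=> h1 h2; apply: htpy_trans (_ : htpy x z (s' ++ t) _).
  have := htpy_cat h1 (erefl : deriv x [::] x) (htpy_derivL h2); exact.
have := htpy_cat h2 (htpy_derivR h1) (erefl : deriv z [::] z); by rewrite !cats0.
Qed.

Lemma htpy_sinvR x y s : deriv x s y -> htpy x x (s ++ sinv s) [::].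
Proof.
elim: s x => [|m s IH] x /=; first by move=> _; apply: htpy_refl.
case=> hm hx hs.
have hm1 : deriv x [:: m] (mtgt m) by [].
have hm2 : deriv (mtgt m) [:: minv m] x by split=> //; apply: step_sym.
rewrite /sinv /= rev_cons -cats1 /=.
have := htpy_cat (IH _ hs) hm1 hm2; rewrite -catA /= => h.
apply: htpy_trans h _; apply: htpy_step (_ : hstep _ _) _ => //.
  by apply: htpy_refl; apply/(deriv_cat _ [:: m] [:: minv m]); exists (mtgt m).
by apply: Or32; apply: (Cancel [::] m [::]).
Qed.

Lemma htpy_sinvL x y s : deriv x s y -> htpy y y (sinv s ++ s) [::].
Proof. by move=> /deriv_sinv /htpy_sinvR; rewrite sinvK. Qed.

Lemma htpy_cancelL x y z s t t' : deriv x s y -> deriv y t z -> deriv y t' z ->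
  htpy x z (s ++ t) (s ++ t') -> htpy y z t t'.
Proof.
move=> hs ht ht' h; have hi := htpy_sinvL hs.
have e r : deriv y r z -> htpy y z r (sinv s ++ s ++ r).
  by move=> hr; have := htpy_sym (htpy_cat2 hi (htpy_refl hr)); rewrite -catA.
apply: htpy_trans (e _ ht) _; apply: htpy_trans (htpy_sym (e _ ht')).
exact: htpy_cat2 (htpy_refl (deriv_sinv hs)) h.
Qed.

(** Inverse moves may be separated by moves that commute with them, so cancelling pairs are excluded
    up to commutation. This is the counterpart of a reduced diagram; see [reduced_irred]. *)
Definition irred s := forall a m b, ~ comm s (a ++ [:: m; minv m] ++ b).

Lemma irred_comm s t : comm s t -> irred s -> irred t.
Proof. by move=> h hs a m b h'; apply: (hs a m b); apply: comm_trans h h'. Qed.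

Lemma irred_infix a s b : irred (a ++ s ++ b) -> irred s.
Proof.
move=> h a' m b' hs; apply: (h (a ++ a') m (b' ++ b)).
by have := comm_cat a b hs; rewrite -!catA.
Qed.

End Derivations.

(** * Decompositions of diagrams into cells *)

Lemma cat_size_inj (T : Type) (a b s t : seq T) :
  size a = size b -> a ++ s = b ++ t -> a = b /\ s = t.
Proof.
by elim: a b => [|x a IH] [|y b] //= [/IH h] [-> /h[-> ->]].
Qed.

Lemma map_eq_cat (T T' : Type) (f : T -> T') s a b : map f s = a ++ b ->
  exists s1 s2, [/\ s = s1 ++ s2, map f s1 = a & map f s2 = b].
Proof.
move=> E; exists (take (size a) s), (drop (size a) s).
by rewrite cat_take_drop map_take map_drop E take_size_cat // drop_size_cat.
Qed.

Lemma common_prefix (T : eqType) (s t : seq T) : exists z s' t',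
  [/\ s = z ++ s', t = z ++ t' &
    [\/ s' = [::], t' = [::] |
      exists x y s2 t2, [/\ x != y, s' = x :: s2 & t' = y :: t2]]].
Proof.
elim: s t => [|x s IH] [|y t].
- by exists [::], [::], [::]; split=> //; apply: Or31.
- by exists [::], [::], (y :: t); split=> //; apply: Or31.
- by exists [::], (x :: s), [::]; split=> //; apply: Or32.
have [<-|xy] := eqVneq x y.
  by have [z [s' [t' [-> -> h]]]] := IH t; exists (x :: z), s', t'.
by exists [::], (x :: s), (y :: t); split=> //; apply: Or33; exists x, y, s, t.
Qed.

Lemma uniq_segment (T : eqType) (a b a' b' s : seq T) : s <> [::] ->
  uniq (a ++ s ++ b) -> a ++ s ++ b = a' ++ s ++ b' -> a = a' /\ b = b'.
Proof.
case: s => // x s _ hu e.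
have ia : size a = size a'.
  have xa : x \notin a.
    by move: hu; rewrite cat_uniq /= => /and3P[_ /norP[]].
  have xa' : x \notin a'.
    by move: hu; rewrite e cat_uniq /= => /and3P[_ /norP[]].
  have := congr1 (index x) e.
  by rewrite !cat_cons !index_cat (negPf xa) (negPf xa') !index_head !addn0.
by have [-> /(@cat_size_inj _ (x :: s) (x :: s))[]] := cat_size_inj ia e.
Qed.

Lemma disjoint_segments (T : eqType) (a s b a' s' b' : seq T) :
  s <> [::] -> s' <> [::] -> (forall x, x \in s -> x \in s' -> False) ->
  a ++ s ++ b = a' ++ s' ++ b' ->
  (exists m, a' = a ++ s ++ m /\ b = m ++ s' ++ b') \/
  (exists m, a = a' ++ s' ++ m /\ b' = m ++ s ++ b).
Proof.
have aux (u1 t1 v1 u2 t2 v2 : seq T) : t1 <> [::] -> t2 <> [::] ->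
    (forall x, x \in t1 -> x \in t2 -> False) -> size u1 <= size u2 ->
    u1 ++ t1 ++ v1 = u2 ++ t2 ++ v2 ->
    exists m, u2 = u1 ++ t1 ++ m /\ v1 = m ++ t2 ++ v2.
  move=> t1n t2n dis le e.
  have e1 := congr1 (take (size u1)) e.
  have e2 := congr1 (drop (size u1)) e.
  rewrite take_size_cat // takel_cat // in e1.
  rewrite drop_size_cat // drop_cat ltn_neqAle le andbT in e2.
  have {e2} : t1 ++ v1 = drop (size u1) u2 ++ t2 ++ v2.
    move: e2; case: eqP => [E|_] //=; rewrite E subnn drop0 drop_size //.
  move=> e2; have {e1}Eu : u2 = u1 ++ drop (size u1) u2.
    by rewrite {1}e1 cat_take_drop.
  move: (drop _ _) => m in e2 Eu; subst u2.
  have [le2|lt2] := leqP (size t1) (size m).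
    have e3 := congr1 (take (size t1)) e2.
    have e4 := congr1 (drop (size t1)) e2.
    rewrite take_size_cat // takel_cat // in e3.
    rewrite drop_size_cat // drop_cat ltn_neqAle le2 andbT in e4.
    exists (drop (size t1) m); rewrite {1}e3 cat_take_drop; split=> //.
    move: e4; case: eqP => [E|_] //=; rewrite E subnn drop0 drop_size //.
  (* Here [t1] reaches beyond [m], so the first element [y] of [t2], at position [size m], also
     belongs to [t1]. *)
  clear e; case: t2 t2n dis e2 => // y t2 _ dis e2; case: (dis y); last exact: mem_head.
  have := congr1 (fun l => nth y l (size m)) e2.
  rewrite !nth_cat lt2 ltnn subnn /= => <-; exact: mem_nth.
move=> sn s'n dis e; have [le|/ltnW le] := leqP (size a) (size a').
  by left; apply: aux e.
by right; apply: aux (esym e) => // x h1 h2; apply: dis h2 h1.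
Qed.

Lemma cycle_consecutive (T : Type) (e : rel T) (a : seq T) x y b :
  cycle e (a ++ x :: y :: b) -> e x y.
Proof. by rewrite -(rot_cycle (size a)) rot_size_cat /= => /andP[]. Qed.

Lemma cycle_wrap (T : Type) (e : rel T) (a : seq T) x y :
  cycle e (x :: rcons a y) -> e y x.
Proof. by rewrite /= rcons_path last_rcons => /andP[]. Qed.

(** * Faces, cuts and peelings of a plane diagram *)

Section Planar.
Variables (Sigma : Type) (P : presentation Sigma) (D : plane_graph Sigma).
Local Notation dart := (edge D * bool)%type.
Implicit Types (x y : vert D) (e : edge D) (d : dart) (p q a b : seq (edge D))
  (f : option (cell D)) (c : cell D).

(** The unbounded face is treated as a cell with top path [dbot D] and bottom path [dtop D], so that
    all faces obey the same rules. *)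
Definition fwd f := if f is Some c then top c else dbot D.
Definition bwd f := if f is Some c then bot c else dtop D.

Lemma boundaryE f : boundary f = forth (fwd f) ++ back (bwd f).
Proof. by case: f. Qed.

Lemma mem_forth p d : (d \in forth p) = d.2 && (d.1 \in p).
Proof.
case: d => e [] /=; last by apply/mapP => -[].
by rewrite mem_map // => ? ? [].
Qed.

Lemma mem_back p d : (d \in back p) = ~~ d.2 && (d.1 \in p).
Proof.
case: d => e [] /=; rewrite mem_rev; first by apply/mapP => -[].
by rewrite mem_map // => ? ? [].
Qed.

Lemma mem_boundary f d : (d \in boundary f) = (d.1 \in if d.2 then fwd f else bwd f).
Proof.
by rewrite boundaryE mem_cat mem_forth mem_back; case: d => e [] /=; rewrite ?orbF.
Qed.

Lemma pos_path_cat x p q y :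
  pos_path x (p ++ q) y <-> exists2 z, pos_path x p z & pos_path z q y.
Proof.
elim: p x => [|e p IH] x /=; first by split=> [|[z ->]] //; exists x.
split=> [[-> /IH[z h1 h2]]|[z [-> h1] h2]]; first by exists z.
by split=> //; apply/IH; exists z.
Qed.

Lemma pos_path_last x p y : pos_path x p y -> y = last x [seq tgt e | e <- p].
Proof. by elim: p x => [|e p IH] x //= [_ /IH]. Qed.

Lemma pos_path_chain p e q : p = e :: q ->
  (forall a e1 e2 b, p = a ++ e1 :: e2 :: b -> tgt e1 = src e2) ->
  pos_path (src e) p (last (tgt e) [seq tgt e | e <- q]).
Proof.
move=> ->{p}; elim: q e => [|e' q IH] e h //=; split=> //.
rewrite (h [::] e e' q erefl); apply: IH => a e1 e2 b E.
by apply: (h (e :: a) e1 e2 b); rewrite E.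
Qed.

Definition ecell := (seq (edge D) * cell D * seq (edge D))%type.
Implicit Types (cs : seq ecell) (U : seq (cell D)).

Definition cells cs := [seq z.1.2 | z <- cs].

Definition emv (z : ecell) :=
  Move (dlabel z.1.1) (dlabel (top z.1.2)) (dlabel (bot z.1.2)) (dlabel z.2).

Fixpoint peel p cs q : Prop :=
  if cs is (a, c, b) :: cs' then
    p = a ++ top c ++ b /\ peel (a ++ bot c ++ b) cs' q
  else p = q.

Lemma peel_cat p cs cs' q :
  peel p (cs ++ cs') q <-> exists2 r, peel p cs r & peel r cs' q.
Proof.
elim: cs p => [|[[a c] b] cs IH] p /=; first by split=> [|[r ->]] //; exists p.
split=> [[-> /IH[r h1 h2]]|[r [-> h1] h2]]; first by exists r.
by split=> //; apply/IH; exists r.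
Qed.

Lemma dlabel_cat p q : dlabel (p ++ q) = dlabel p ++ dlabel q.
Proof. exact: map_cat. Qed.

Lemma size_dlabel p : size (dlabel p) = size p.
Proof. exact: size_map. Qed.

Section ValuePaths.
Variables (T : eqType) (val : dart -> T).

(* [pos_path] for an assignment of values to the ends of the edges; it is
   convertible to [pos_path] when [val] is [org]. *)
Fixpoint vpath (u : T) (p : seq (edge D)) (v : T) : Prop :=
  if p is e :: q then val (e, true) = u /\ vpath (val (e, false)) q v else u = v.

Definition next_at d d' := val d' == val (flip d).

Lemma path_forth p u v d : vpath u p v -> val (flip d) = u ->
  path next_at d (forth p) /\ val (flip (last d (forth p))) = v.
Proof.
elim: p u d => [|e p IH] u d /= => [-> //|[hu hp] hd].
by have [-> h2] := IH _ (e, true) hp erefl; rewrite /next_at hd -hu /= eqxx.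
Qed.

Lemma path_back q u v d : vpath u q v -> val (flip d) = v ->
  path next_at d (back q) /\ val (flip (last d (back q))) = u.
Proof.
elim: q u d => [|e q IH] u d /= => [-> //|[hu hp] hd].
rewrite /back /= rev_cons -/(back q); have [h1 h2] := IH _ d hp hd.
by rewrite rcons_path h1 last_rcons /next_at h2 /= eqxx.
Qed.

(** Only the two turning points need care, and there both sides share the values [u] and [v]. With
    [val] equal to [org] this controls the orbits of a rotation; with other values it produces maps
    defined on vertices. *)
Lemma boundary_cycle p q u v : q <> [::] -> vpath u p v -> vpath u q v ->
  cycle next_at (forth p ++ back q).
Proof.
case: q => // e q _ hp hq; rewrite (cycle_path (e, true)).
have -> : last (e, true) (forth p ++ back (e :: q)) = (e, false).
  by rewrite last_cat /back /= rev_cons last_rcons.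
have [hs _] := hq.
have [h1 h2] := path_forth (d := (e, false)) hp hs.
by rewrite cat_path h1; have [-> _] := path_back hq h2.
Qed.

End ValuePaths.

Section FaceCycles.
Hypothesis hcyc : forall f, fcycle (@face _ D) (boundary f).

Lemma flipK : involutive (@flip _ D).
Proof. by case=> e []. Qed.

Lemma faceE d d' : frel (@face _ D) d d' -> face d = d'.
Proof. by move=> /eqP. Qed.

Lemma cycle_forth f a e e' b :
  fwd f = a ++ e :: e' :: b -> face (e, true) = (e', true).
Proof.
move=> E; have := hcyc f; rewrite boundaryE E /forth map_cat -catA /=.
by move=> h; apply/faceE/(cycle_consecutive h).
Qed.

Lemma cycle_back f a e e' b :
  bwd f = a ++ e :: e' :: b -> face (e', false) = (e, false).
Proof.
move=> E; have := hcyc f; rewrite boundaryE E /back map_cat rev_cat /=.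
rewrite !rev_cons -!cats1 -!catA /= catA => h.
exact/faceE/(cycle_consecutive h).
Qed.

Lemma cycle_last f a e b e' :
  fwd f = rcons a e -> bwd f = rcons b e' -> face (e, true) = (e', false).
Proof.
move=> E E'; have := hcyc f; rewrite boundaryE E E' /forth /back.
rewrite !map_rcons rev_rcons -cats1 -catA /= => h.
exact/faceE/(cycle_consecutive h).
Qed.

Lemma cycle_head f e a e' b :
  fwd f = e :: a -> bwd f = e' :: b -> face (e', false) = (e, true).
Proof.
move=> E E'; have := hcyc f; rewrite boundaryE E E' /forth /back.
by rewrite !map_cons rev_cons cat_cons -rcons_cat => h; apply/faceE/(cycle_wrap h).
Qed.

End FaceCycles.

Section Diagram.
Hypothesis hD : is_diagram P D.
Let hcyc := face_cycle hD.

Lemma org_rot d : org (rot d) = org d.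
Proof. by apply/eqP; rewrite eq_sym -(rot_orbit hD) fconnect1. Qed.

Lemma org_face d : org (face d) = org (flip d).
Proof. exact: org_rot. Qed.

Lemma uniq_fwd f : uniq (fwd f).
Proof. by have := face_uniq hD f; rewrite boundaryE cat_uniq => /and3P[/map_uniq]. Qed.

Lemma uniq_bwd f : uniq (bwd f).
Proof.
have := face_uniq hD f; rewrite boundaryE cat_uniq rev_uniq => /and3P[_ _].
exact: map_uniq.
Qed.

Definition below e := odflt None [pick f | e \in fwd f].
Definition above e := odflt None [pick f | e \in bwd f].

Lemma belowE e f : (e \in fwd f) = (below e == f).
Proof.
have [g [h1 h2]] := faces hD (e, true).
have h f' : e \in fwd f' -> g = f' by move=> h; apply: h2; rewrite mem_boundary.
rewrite mem_boundary /= in h1.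
rewrite /below; case: pickP => [f' /h <-|/(_ g)]; last by rewrite h1.
by apply/idP/eqP => [/h//|<-].
Qed.

Lemma aboveE e f : (e \in bwd f) = (above e == f).
Proof.
have [g [h1 h2]] := faces hD (e, false).
have h f' : e \in bwd f' -> g = f' by move=> h; apply: h2; rewrite mem_boundary.
rewrite mem_boundary /= in h1.
rewrite /above; case: pickP => [f' /h <-|/(_ g)]; last by rewrite h1.
by apply/idP/eqP => [/h//|<-].
Qed.

Lemma mem_top e c : (e \in top c) = (below e == Some c).
Proof. exact: (belowE e (Some c)). Qed.
Lemma mem_dbot e : (e \in dbot D) = (below e == None).
Proof. exact: (belowE e None). Qed.
Lemma mem_bot e c : (e \in bot c) = (above e == Some c).
Proof. exact: (aboveE e (Some c)). Qed.
Lemma mem_dtop e : (e \in dtop D) = (above e == None).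
Proof. exact: (aboveE e None). Qed.

Lemma top_nonempty c : top c <> [::].
Proof. by move=> E; have /step_nilL := cell_label hD c; rewrite E. Qed.

Lemma bot_nonempty c : bot c <> [::].
Proof. by move=> E; have /step_nilR := cell_label hD c; rewrite E. Qed.

Lemma path_uniq x p y : pos_path x p y -> uniq p.
Proof. by move=> /(path_simple hD)/= /andP[_]; apply: map_uniq. Qed.

Lemma closed_path x p : pos_path x p x -> p = [::].
Proof.
case/lastP: p => // p e h; have := path_simple hD h.
rewrite {1}(pos_path_last h) map_rcons last_rcons /=.
by rewrite mem_rcons mem_head.
Qed.

Hypothesis hne : dtop D <> [::].

Lemma ini_ter : ini D <> ter D.
Proof. by move=> E; apply: hne; apply: (@closed_path (ini D)); rewrite {2}E; apply: dtop_path hD. Qed.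

Lemma fwd_nonempty f : fwd f <> [::].
Proof.
case: f => [c|] /=; first exact: top_nonempty.
by move=> E; have := dbot_path hD; rewrite E /= => /ini_ter.
Qed.

Lemma bwd_nonempty f : bwd f <> [::].
Proof. by case: f => [c|] //=; apply: bot_nonempty. Qed.

Lemma face_paths f : exists x y, pos_path x (fwd f) y /\ pos_path x (bwd f) y.
Proof.
have h1 a e e' b : fwd f = a ++ e :: e' :: b -> tgt e = src e'.
  by move=> /(cycle_forth hcyc) h; have := org_face (e, true); rewrite h.
have h2 a e e' b : bwd f = a ++ e :: e' :: b -> tgt e = src e'.
  by move=> /(cycle_back hcyc) h; have := org_face (e', false); rewrite h.
case E1: (fwd f) (@fwd_nonempty f) => [//|e1 p1] _.
case E2: (bwd f) (@bwd_nonempty f) => [//|e2 p2] _.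
have := pos_path_chain E1 h1; have := pos_path_chain E2 h2; rewrite E1 E2.
have <- : src e1 = src e2.
  by have := org_face (e2, false); rewrite (cycle_head hcyc E1 E2).
have <- : last (tgt e1) [seq tgt e | e <- p1] = last (tgt e2) [seq tgt e | e <- p2].
  rewrite !last_map; have := org_face (last e1 p1, true).
  rewrite (lastI e1) in E1; rewrite (lastI e2) in E2.
  by rewrite (cycle_last hcyc E1 E2).
by exists (src e1), (last (tgt e1) [seq tgt e | e <- p1]).
Qed.

(** A corner is an incoming dart followed, counterclockwise, by an outgoing one. Uniqueness of the
    corner at a vertex is the form in which planarity is used. *)
Definition corners := [set d : dart | ~~ d.2 && (rot d).2].

(** At the last edge [e] of its forward side a face turns into its backward side, so [(e, false)] is
    followed by an incoming dart and is not a corner. The [(ncell D).+1] faces, the unbounded one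
    included, have distinct last edges. *)
Lemma card_corners : #|corners| + (ncell D).+1 <= nedge D.
Proof.
have [e0 _] : exists e0, e0 \in dtop D.
  by case: (dtop D) hne => // e0 p _; exists e0; rewrite mem_head.
pose lst f := last e0 (fwd f).
have lstE f : exists s, fwd f = rcons s (lst f).
  rewrite /lst; case/lastP: (fwd f) (@fwd_nonempty f) => // s e _.
  by exists s; rewrite last_rcons.
have lst_mem f : lst f \in fwd f by have [s ->] := lstE f; rewrite mem_rcons mem_head.
have lst_inj : injective lst.
  move=> f f' E; have := lst_mem f; have := lst_mem f'; rewrite -E !belowE.
  by move=> /eqP <- /eqP.
have -> : (ncell D).+1 = #|[set lst f | f in [set: option (cell D)]]|.
  by rewrite card_imset // cardsT card_option card_ord.
have -> : #|corners| = #|[set d.1 | d in corners]|.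
  rewrite card_in_imset // => -[e1 b1] [e2 b2]; rewrite !inE /=.
  by case: b1 b2 => -[] //= _ _ ->.
rewrite -[leqRHS]card_ord -(cardsC [set lst f | f in [set: option (cell D)]]).
rewrite addnC leq_add2l; apply: subset_leq_card; apply/fintype.subsetP => e.
case/imsetP=> -[e' []]; rewrite inE //= => h ->; rewrite inE.
apply/imsetP => -[f _ E]; move: h; rewrite E.
have [s E1] := lstE f; case/lastP E2: (bwd f) (@bwd_nonempty f) => [//|s2 e2] _.
by have := cycle_last hcyc E1 E2; rewrite /face /flip /= => ->.
Qed.

Lemma vertex_corner x : x <> ini D -> x <> ter D -> x \in [set org d | d in corners].
Proof.
move=> xi xt.
have [e he] : exists e, tgt e = x.
  apply: contrapT => h; apply: xi; apply/(source_unique hD) => e he.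
  by apply: h; exists e.
have [e' he'] : exists e, src e = x.
  apply: contrapT => h; apply: xt; apply/(sink_unique hD) => e' he'.
  by apply: h; exists e'.
have : fconnect (@Defs.rot _ D) (e, false) (e', true).
  by rewrite (rot_orbit hD) /org /= he he'.
move=> /iter_findex; move: (findex _ _ _) => n.
have : org (e, false) = x by [].
have : (e, false).2 = false by [].
move: (e, false) => d; elim: n d => [|n IH] d; first by move=> /= + _ E; rewrite E.
rewrite iterSr => d2 dx h; case r2: (rot d).2.
  by apply/imsetP; exists d; rewrite ?inE ?d2 ?r2.
by apply: (IH (rot d)); rewrite ?org_rot.
Qed.

(** By Euler's formula there are at most [nvert D - 2] corners, while each of the [nvert D - 2]
    interior vertices carries one. *)
Lemma corner_inj : {in corners &, injective (@org _ D)}.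
Proof.
apply/imset_injP; rewrite eqn_leq leq_imset_card /=.
apply: (@leq_trans (nvert D - 2)).
  have aux (k v n m : nat) : v + m.+1 = n + 2 -> k + m.+1 <= n -> k <= v - 2 by lia.
  exact: aux (euler hD) card_corners.
have -> : nvert D - 2 = #|~: [set ini D; ter D]|.
  by rewrite cardsCs finset.setCK cards2 card_ord; case: eqP => // /ini_ter.
apply: subset_leq_card; apply/fintype.subsetP => x; rewrite !inE negb_or.
by move=> /andP[/eqP h1 /eqP h2]; apply: vertex_corner.
Qed.

(** Two consecutive edges of a forward side form a corner at their common vertex, so forward sides
    through one interior vertex use the same two edges there. *)
Lemma corner_unique f a e e' b f1 a1 e1 e1' b1 :
  fwd f = a ++ e :: e' :: b -> fwd f1 = a1 ++ e1 :: e1' :: b1 ->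
  src e' = src e1' -> e = e1 /\ e' = e1'.
Proof.
move=> /(cycle_forth hcyc) E /(cycle_forth hcyc) E1 h.
have h1 : (e, false) \in corners by rewrite inE; have := E; rewrite /face /flip /= => ->.
have h2 : (e1, false) \in corners by rewrite inE; have := E1; rewrite /face /flip /= => ->.
have : org (e, false) = org (e1, false).
  have := org_face (e, true); have := org_face (e1, true); rewrite E E1 /org /=.
  by rewrite -h => -> ->.
move=> /(corner_inj h1 h2) [ee]; split=> //.
by have := E; rewrite ee E1 => -[->].
Qed.

Lemma no_into_ini e : tgt e <> ini D.
Proof. exact: (proj2 (source_unique hD (ini D))). Qed.

Lemma no_from_ter e : src e <> ter D.
Proof. exact: (proj2 (sink_unique hD (ter D))). Qed.

(* Walking to the right along a cut: when the top path of [c] leaves the cut at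
   a vertex, that vertex is interior to the top path of [c], hence to no other
   one, so that the cell below the next edge of the cut starts there. *)
Lemma cut_cell_right a b c e t t' : pos_path (ini D) (a ++ b) (ter D) ->
  b = e :: t -> top c = e :: t' ->
  exists a' c' b', a ++ b = a' ++ top c' ++ b'.
Proof.
have [n] := ubnP (size b); elim: n a b c e t t' => // n IH a b c e t t'.
move=> sz hp hb hc.
have [z [s [s' [Ez Es h]]]] := common_prefix (top c) b.
have zn : z <> [::].
  move=> z0; move: h; rewrite z0 /= in Ez Es; rewrite -Ez -Es hc hb.
  by case=> // -[? [? [? [? [/eqP ne [? _] [? _]]]]]]; apply: ne; congruence.
(* [z] is the part that [top c] shares with the cut. It is all of [top c], or the cut ends first,
   which is excluded because no edge leaves [ter D], or the two part at an interior vertex. *)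
case: h => [s0|s0|[x [y [s2 [t2 [xy sx sy]]]]]].
- by exists a, c, s'; rewrite {1}Es -[z]cats0 -s0 -Ez.
- case/lastP: z zn Ez Es => // z e1 _ Ez Es; rewrite s0 cats0 in Es.
  case: s Ez => [|e2 s] Ez; first by exists a, c, [::]; rewrite cats0 Es Ez cats0.
  have := cycle_forth hcyc (f := Some c) (a := z) (e := e1) (e' := e2) (b := s).
  rewrite /= Ez cat_rcons => /(_ erefl) h; have := org_face (e1, true); rewrite h.
  rewrite /org /= => h1; exfalso; apply: (@no_from_ter e2); rewrite h1.
  by rewrite (pos_path_last hp) Es -rcons_cat map_rcons last_rcons.
case/lastP: z zn Ez Es => // z e1 _ Ez Es; subst s s'.
rewrite !cat_rcons in Ez Es.
have h1 : tgt e1 = src y.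
  move: hp; rewrite Es => /pos_path_cat[? _ /pos_path_cat[? _]] /=.
  by case=> _ [].
have h2 : tgt e1 = src x.
  by have := org_face (e1, true); rewrite (cycle_forth hcyc (f := Some c) Ez).
have : y \in fwd (below y) by rewrite belowE.
case/path.splitPr E: (fwd (below y)) / => [s1 s3].
case/lastP: s1 E => [|s1 e3] E; last first.
  rewrite cat_rcons in E; exfalso; case/eqP: xy.
  by have [] := corner_unique (f1 := Some c) E Ez (etrans (esym h1) h2).
case Ey: (below y) E => [c'|] /= E; last first.
  exfalso; apply: (@no_into_ini e1); have := dbot_path hD; rewrite E /= => -[<- _].
  by rewrite h1.
have [] := IH (a ++ rcons z e1) (y :: t2) c' y t2 s3 _ _ erefl E.
- by move: sz; rewrite Es size_cat /=; lia.
- by rewrite -catA cat_rcons -Es.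
by move=> a' [c2 [b' E']]; exists a', c2, b'; rewrite -E' -catA cat_rcons -Es.
Qed.

Lemma path_suffix_last x a e b y : pos_path x (a ++ e :: b) y ->
  (a = [::] /\ src e = x) \/ (exists a' e', a = rcons a' e' /\ src e = tgt e').
Proof.
case/pos_path_cat=> z; case/lastP: a => [|a' e'] /=; first by move=> <- [-> _]; left.
move=> /pos_path_last; rewrite map_rcons last_rcons => -> [-> _].
by right; exists a', e'.
Qed.

(** Take the first edge of the cut that is not on the bottom path of the diagram. It begins the top
    path of the cell below it: otherwise that top path and [dbot D], which contains the preceding
    edge of the cut, would both run through its source by different edges, against [corner_unique].
    From there [cut_cell_right] applies. *)
Lemma cut_cell p e : pos_path (ini D) p (ter D) -> e \in p -> below e <> None ->
  exists a c b, p = a ++ top c ++ b.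
Proof.
move=> hp ep he.
have hh : has (fun e => below e != None) p by apply/hasP; exists e => //; apply/eqP.
case: (split_find hh) hp => {hh ep he e} e a b he /hasPn ha.
rewrite cat_rcons => hp.
case Ec: (below e) he => [c|] // _.
have : e \in fwd (Some c) by rewrite belowE Ec.
case/path.splitPr E: (fwd (Some c)) / => [s1 s3].
case/lastP: s1 E => [|s1 e1] E; first exact: (cut_cell_right hp erefl E).
exfalso; rewrite cat_rcons in E.
have h1 : tgt e1 = src e.
  by have := org_face (e1, true); rewrite (cycle_forth hcyc E).
case: (path_suffix_last hp) => [[_ h2]|[a' [e' [Ea h2]]]].
  by apply: (@no_into_ini e1); rewrite h1 h2.
have : e' \in fwd None.
  by rewrite belowE; have := ha e'; rewrite Ea mem_rcons mem_head negbK; apply.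
case/path.splitPr E': (fwd None) / => [s2 [|e2 s4]].
  apply: (@no_from_ter e); rewrite h2.
  have := pos_path_last (dbot_path hD).
  by rewrite -[dbot D]/(fwd None) E' map_cat last_cat.
have h3 : tgt e' = src e2.
  by have := org_face (e', true); rewrite (cycle_forth hcyc E').
have [_ ee] := corner_unique E E' (etrans h2 h3).
have : e2 \in fwd None by rewrite E' mem_cat !inE eqxx !orbT.
by rewrite -ee belowE Ec.
Qed.
(** The unbounded face lies both above the top path and below the bottom path of the diagram; hence
    the two different values at [None]. *)
Definition up U f := if f is Some c then c \in U else true.
Definition down U f := if f is Some c then c \in U else false.

(* The cut [p] separates the cells in [U], which lie above it, from the other
   ones. *)
Definition reach U p :=
  [/\ pos_path (ini D) p (ter D),
      forall e, (e \in p) = up U (above e) && ~~ down U (below e) &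
      forall e, down U (below e) -> up U (above e)].

Lemma reach_start : reach [::] (dtop D).
Proof.
split; first exact: dtop_path hD.
  by move=> e; rewrite mem_dtop; case: (above e) (below e) => [?|] [].
by move=> e; case: (below e).
Qed.

Lemma top_path_replace x y a c b : pos_path x (a ++ top c ++ b) y ->
  pos_path x (a ++ bot c ++ b) y.
Proof.
case/pos_path_cat=> z h1 /pos_path_cat[z' h2 h3].
apply/pos_path_cat; exists z => //; apply/pos_path_cat; exists z' => //.
have [u [v []]] := face_paths (Some c) => /=.
have := top_nonempty (c := c); have := bot_nonempty (c := c).
case: (top c) h2 => // e s h2; case: (bot c) => // e' s' _ _ h4 h5.
have [h2a _] := h2; have [h4a _] := h4; have [h5a _] := h5; subst z u.
by rewrite (pos_path_last h2) -(pos_path_last h4).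
Qed.

Lemma reach_uniq U p : reach U p -> uniq p.
Proof. by case=> /path_uniq. Qed.

Lemma reach_step U a c b : reach U (a ++ top c ++ b) ->
  c \notin U /\ reach (c :: U) (a ++ bot c ++ b).
Proof.
move=> h; have hu := reach_uniq h; case: h => h1 h2 h3.
have cU : c \notin U.
  case E: (top c) (top_nonempty (c := c)) => [//|e s] _.
  have et : e \in top c by rewrite E mem_head.
  have := h2 e; rewrite !mem_cat et orbT /=; move: et; rewrite mem_top => /eqP ->.
  by case/esym/andP.
split=> //; split; first exact: top_path_replace h1.
  move=> e; have := h2 e; have := h3 e; rewrite !mem_cat.
  have : e \in top c -> (e \notin a) && (e \notin b).
    move=> et; move: hu; rewrite cat_uniq => /and3P[_ /hasPn ha].
    rewrite cat_uniq => /and3P[_ /hasPn hb _]; apply/andP; split.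
      by apply: ha; rewrite mem_cat et.
    by apply/negP => /hb; rewrite /= et.
  have -> : up (c :: U) (above e) = up U (above e) || (e \in bot c).
    by rewrite mem_bot; case: (above e) => //= c1; rewrite inE orbC.
  have -> : down (c :: U) (below e) = down U (below e) || (e \in top c).
    by rewrite mem_top; case: (below e) => //= c1; rewrite inE orbC.
  have : e \in bot c -> ~~ up U (above e) by rewrite mem_bot => /eqP ->.
  move: (e \in a) (e \in b) (up _ _) (down _ _) (e \in top c) (e \in bot c).
  by do 6!case=> //=; do ?[by move=> /(_ isT) | by move=> _ /(_ isT)
    | by move=> _ _ /(_ isT)].
move=> e; have := h2 e; have := h3 e; rewrite !mem_cat mem_top.
case: (above e) (below e) => [c1|] [c2|] //=; rewrite ?inE.
case: (eqVneq c2 c) => [->|_] /=; last by move=> h _ /h ->; rewrite orbT.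
by rewrite eqxx orbT => _ /esym/andP[->]; rewrite orbT.
Qed.

Lemma peel_reach U p cs q : reach U p -> uniq U -> peel p cs q ->
  reach (catrev (cells cs) U) q /\ uniq (catrev (cells cs) U).
Proof.
elim: cs U p => [|[[a c] b] cs IH] U p /= hp hU; first by move=> <-.
case=> E h; rewrite E in hp; have [cU hp'] := reach_step hp.
by apply: IH h => //=; rewrite cU.
Qed.

(** Positive paths never close up: if the first edge of [p] came later in [q], the part of [q]
    before it would be a closed path at [x]. *)
Lemma path_sub_eq x y p q : pos_path x p y -> pos_path x q y ->
  {subset p <= q} -> p = q.
Proof.
elim: p x q => [|e p IH] x q /=.
  by move=> <- /closed_path ->.
move=> hp hq sub; have eq := sub e (mem_head _ _); case/path.splitPr: eq hq sub => [s1 s2].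
case/pos_path_cat=> z h1 [h2 h3] sub; case: hp => sx hp.
move: h1; rewrite -h2 sx => /closed_path s10; rewrite s10 /= in sub *.
congr (_ :: _); apply: (IH _ _ hp h3) => e' he'.
have := sub e'; rewrite !inE he' orbT => /(_ isT) /orP[/eqP ee|//].
have := @path_uniq x (e :: p) y; rewrite /= -ee he'.
by rewrite ee => /(_ (conj sx hp)).
Qed.

Lemma reach_end U p : reach U p -> (forall e, e \in p -> below e = None) ->
  p = dbot D.
Proof.
case=> hp _ _ h; apply: path_sub_eq hp (dbot_path hD) _ => e /h he.
by rewrite mem_dbot he.
Qed.

Lemma reach_complete U p : reach U p -> uniq U -> exists cs, peel p cs (dbot D).
Proof.
have [n] := ubnP (ncell D - size U); elim: n U p => // n IH U p sz hp hU.
have [h|h] := pselect (forall e, e \in p -> below e = None).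
  by exists [::]; apply: reach_end hp h.
have [e [ep he]] : exists e, e \in p /\ below e <> None.
  apply: contrapT => h'; apply: h => e ep; apply: contrapT => he.
  by apply: h'; exists e.
have [hpath _ _] := hp; have [a [c [b E]]] := cut_cell hpath ep he.
rewrite E in hp; have [cU hp'] := reach_step hp.
have hcU : uniq (c :: U) by rewrite /= cU.
have [] := IH (c :: U) (a ++ bot c ++ b) _ hp' hcU.
  have := max_card (mem (c :: U)); rewrite (card_uniqP hcU) card_ord /=.
  have aux (k m : nat) : m - k < n.+1 -> k < m -> m - k.+1 < n by lia.
  exact: aux sz.
by move=> cs h'; exists ((a, c, b) :: cs).
Qed.

(** As [A] looks at the edge only, stability under [face] implies stability under the rotation. So
    [A] spreads to all edges at a vertex and, by connectedness, to all edges. *)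
Lemma edge_ind (A : pred (edge D)) : (exists e, A e) ->
  (forall d, A d.1 -> A (face d).1) -> forall e, A e.
Proof.
case=> e0 h0 hA.
have hrot d : A d.1 -> A (rot d).1.
  by move=> h; have := hA (flip d); rewrite /face flipK; apply.
have horb d d' : org d = org d' -> A d.1 -> A d'.1.
  move=> E; have : fconnect (@Defs.rot _ D) d d' by rewrite (rot_orbit hD) E.
  move=> /iter_findex <-; elim: (findex _ _ _) => //= n IH /IH; exact: hrot.
have hv x y : connect (@neighbour _ D) x y -> (exists2 d, org d = x & A d.1) ->
    (exists2 d, org d = y & A d.1).
  case/connectP=> s hs ->; elim: s x hs => //= z s IH x /andP[/existsP[e he] hs].
  case=> d dx hd; apply: IH hs _; case/orP: he => /andP[/eqP h1 /eqP h2].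
    exists (e, false) => //; apply: (@horb d (e, true)) => //.
    by rewrite dx.
  exists (e, true) => //; apply: (@horb d (e, false)) => //.
  by rewrite dx.
move=> e; have [] := hv (src e0) (src e) (graph_connected hD _ _).
  by exists (e0, true).
by move=> d dx; apply: (@horb d (e, true)).
Qed.

(** This excludes cells left over when the cut has come down to the bottom path. The edges whose
    upper face is already treated are stable under [face], hence are all the edges by [edge_ind]. *)
Lemma reach_dbot U : reach U (dbot D) ->
  (forall e, up U (above e)) /\ (forall c, c \in U).
Proof.
case=> h1 h2 h3.
have hup : forall e, up U (above e).
  apply: edge_ind.
    case E: (dbot D) (fwd_nonempty (f := None)) => [|e s] // _; exists e.
    by have := h2 e; rewrite E mem_head => /esym/andP[].
  have hdown e : up U (above e) -> below e = None \/ down U (below e).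
    move=> he; have := h2 e; rewrite he mem_dbot /=.
    by case: eqP => [|_ /esym/negbFE]; [left|right].
  case=> e b /= he.
  have [f hf hfU] : exists2 f, (e, b) \in boundary f & up U f.
    case: b; [exists (below e) | exists (above e)] => //.
    - by rewrite mem_boundary /= belowE.
    - by case: (hdown _ he) => [->|] //; case: (below e).
    - by rewrite mem_boundary /= aboveE.
  have : face (e, b) \in boundary f.
    have := next_cycle (face_cycle hD f) hf => /eqP ->; by rewrite mem_next.
  case: (face _) => e' [] /=; rewrite mem_boundary /=.
    rewrite belowE => /eqP hb; case: f hfU hb {hf} => [c|] /= hc hb.
      by apply: h3; rewrite hb.
    by have := h2 e'; rewrite mem_dbot hb => /esym/andP[].
  by rewrite aboveE => /eqP ->.
split=> // c; case E: (top c) (top_nonempty (c := c)) => [//|e s] _.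
have : below e == Some c by rewrite -mem_top E mem_head.
move=> /eqP hb; have := h2 e; rewrite hup mem_dbot hb /=.
by move/esym/negbFE.
Qed.

(** Exactly one face lies above an edge, so [dtop D ++ bots cs] enumerates the edges without
    repetition, by [uniq_cut_bots] and [all_edges], when [cs] peels the whole diagram. The order is
    dictated by the peeling, which is how the edges of two diagrams with the same moves are matched
    later. *)
Definition bots cs := flatten [seq bot c | c <- cells cs].

Lemma peel_cells cs : peel (dtop D) cs (dbot D) ->
  uniq (cells cs) /\ (forall c, c \in cells cs).
Proof.
move=> h; have [h1 h2] := peel_reach reach_start isT h.
rewrite catrevE cats0 rev_uniq in h2; split=> // c.
by have [_ /(_ c)] := reach_dbot h1; rewrite catrevE cats0 mem_rev.
Qed.

Lemma peel_ncell cs : peel (dtop D) cs (dbot D) -> size cs = ncell D.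
Proof.
case/peel_cells=> h1 h2; rewrite -[RHS]card_ord -(size_map (fun z => z.1.2)).
by rewrite -(card_uniqP h1); apply: eq_card => c; rewrite h2.
Qed.

Lemma mem_bots cs e : (e \in bots cs) = down (cells cs) (above e).
Proof.
rewrite /bots; elim: (cells cs) => [|c s IH] /=; first by case: above.
by rewrite mem_cat IH mem_bot; case: (above e) => //= c'; rewrite inE.
Qed.

Lemma uniq_bots cs : uniq (cells cs) -> uniq (bots cs).
Proof.
rewrite /bots; elim: cs => [|z cs IH] //= /andP[hz /IH hu].
rewrite cat_uniq hu (uniq_bwd (Some z.1.2)) andbT /=; apply/hasPn => e.
rewrite mem_bots mem_bot; case: (above e) => //= c' hc'.
by apply: contra hz => /eqP[<-].
Qed.

Lemma uniq_cut_bots U p cs : reach U p -> uniq U -> peel p cs (dbot D) ->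
  uniq (p ++ bots cs).
Proof.
move=> hp hU h; have [_] := peel_reach hp hU h.
rewrite catrevE cat_uniq rev_uniq => /and3P[hu /hasPn hc _].
rewrite cat_uniq (reach_uniq hp) uniq_bots //= andbT; apply/hasPn => e.
rewrite mem_bots => he; apply/negP => /= ep; have [_ h2 _] := hp.
move: ep; rewrite h2; case: (above e) he => //= c hcs /andP[/hc]; rewrite /= mem_rev.
by rewrite hcs.
Qed.

Lemma all_edges cs e : peel (dtop D) cs (dbot D) -> e \in dtop D ++ bots cs.
Proof.
move=> /peel_cells[_ h]; rewrite mem_cat mem_dtop mem_bots.
by case: (above e) => //= c; rewrite h.
Qed.

Lemma peel_deriv p cs q : peel p cs q ->
  deriv P (dlabel p) (map emv cs) (dlabel q).
Proof.
elim: cs p => [|[[a c] b] cs IH] p /= => [-> //|[-> /IH]].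
rewrite /mtgt /msrc /emv /= !dlabel_cat => h; split=> //.
exact: cell_label hD c.
Qed.

Lemma square_emv a c m c' b :
  square [:: emv (a, c, m ++ top c' ++ b); emv (a ++ bot c ++ m, c', b)]
         [:: emv (a ++ top c ++ m, c', b); emv (a, c, m ++ bot c' ++ b)].
Proof. by rewrite /emv /= !dlabel_cat; apply: Square. Qed.

Lemma reach_disjoint U a c b a' c' b' : reach U (a ++ top c ++ b) ->
  a ++ top c ++ b = a' ++ top c' ++ b' -> c <> c' ->
  (exists m, a' = a ++ top c ++ m /\ b = m ++ top c' ++ b') \/
  (exists m, a = a' ++ top c' ++ m /\ b' = m ++ top c ++ b).
Proof.
move=> hU E ne; apply: disjoint_segments E; try exact: top_nonempty.
by move=> e; rewrite !mem_top => /eqP -> /eqP [].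
Qed.

Lemma peel_size U p cs : reach U p -> uniq U -> peel p cs (dbot D) ->
  size cs + size U = ncell D.
Proof.
move=> hp hU h; have [h1 h2] := peel_reach hp hU h; have [_ h3] := reach_dbot h1.
have -> : size cs + size U = size (catrev (cells cs) U).
  by rewrite catrevE size_cat size_rev size_map.
by rewrite -[RHS]card_ord -(card_uniqP h2); apply: eq_card => c; rewrite h3.
Qed.

(** If the first cells differ, their top paths are disjoint segments of the cut, so both cells can
    be peeled in either order. A peeling of what remains after both links the two given ones, by
    induction on the length. *)
Lemma peel_comm U p cs cs' : reach U p -> uniq U ->
  peel p cs (dbot D) -> peel p cs' (dbot D) -> comm (map emv cs) (map emv cs').
Proof.
have [n] := ubnP (size cs); elim: n U p cs cs' => // n IH U p cs cs' sz hp hU.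
have nodbot a c b : reach U (a ++ top c ++ b) -> dbot D <> a ++ top c ++ b.
  move=> h E; have [cU _] := reach_step h; move: h; rewrite -E => /reach_dbot[_ h].
  by rewrite h in cU.
case: cs cs' sz => [|[[a c] b] cs] [|[[a' c'] b'] cs'] /= sz.
- by move=> *; apply: comm_refl.
- by move=> E0 [E _]; case: (nodbot a' c' b'); rewrite -?E -?E0.
- by move=> [E _] E'; case: (nodbot a c b); rewrite -?E -?E'.
case=> E h [E' h']; subst p; have [cU hr] := reach_step hp.
have hcU : uniq (c :: U) by rewrite /= cU.
have [ec|/eqP ne] := eqVneq c c'.
  subst c'; have hu := reach_uniq hp.
  have [ea eb] := uniq_segment (@top_nonempty c) hu E'; subst a' b'.
  by have := comm_cat [:: emv (a, c, b)] [::] (IH _ _ _ _ sz hr hcU h h'); rewrite !cats0.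
have hp' := hp; rewrite E' in hp'; have [cU' hr'] := reach_step hp'.
have hcU' : uniq (c' :: U) by rewrite /= cU'.
(* Here [c1] lies to the left of [c2]; the other position follows by symmetry. [r3] is the common
   remainder after both cells. *)
have fin (a1 m b1 : seq (edge D)) c1 c2 r1 r2 :
  size r1 < n -> reach (c1 :: U) (a1 ++ bot c1 ++ m ++ top c2 ++ b1) -> uniq (c1 :: U) ->
  reach (c2 :: U) ((a1 ++ top c1 ++ m) ++ bot c2 ++ b1) -> uniq (c2 :: U) ->
  peel (a1 ++ bot c1 ++ m ++ top c2 ++ b1) r1 (dbot D) ->
  peel ((a1 ++ top c1 ++ m) ++ bot c2 ++ b1) r2 (dbot D) ->
  comm (emv (a1, c1, m ++ top c2 ++ b1) :: map emv r1)
       (emv (a1 ++ top c1 ++ m, c2, b1) :: map emv r2).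
  move=> sz1 hr1 hu1 hr2 hu2 hq1 hq2.
  have e1 : a1 ++ bot c1 ++ m ++ top c2 ++ b1 = (a1 ++ bot c1 ++ m) ++ top c2 ++ b1.
    by rewrite -!catA.
  have e2 : (a1 ++ bot c1 ++ m) ++ bot c2 ++ b1 = a1 ++ bot c1 ++ m ++ bot c2 ++ b1.
    by rewrite -!catA.
  have e3 : (a1 ++ top c1 ++ m) ++ bot c2 ++ b1 = a1 ++ top c1 ++ m ++ bot c2 ++ b1.
    by rewrite -!catA.
  have hr1' := hr1; rewrite e1 in hr1'.
  have [c2U hr12] := reach_step hr1'.
  have hu12 : uniq (c2 :: c1 :: U) by rewrite /= c2U.
  have [r3 hr3] := reach_complete hr12 hu12.
  have k1 : comm (map emv r1) (map emv ((a1 ++ bot c1 ++ m, c2, b1) :: r3)).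
    by apply: (IH _ _ _ _ sz1 hr1 hu1 hq1); rewrite /= -e1.
  have k2 : comm (map emv ((a1, c1, m ++ bot c2 ++ b1) :: r3)) (map emv r2).
    have := comm_size k1; rewrite /= !size_map => sz3.
    have sz4 : size ((a1, c1, m ++ bot c2 ++ b1) :: r3) < n by rewrite /= -sz3.
    by apply: (IH _ _ _ _ sz4 hr2 hu2 _ hq2); rewrite /= e3 -e2.
  have := comm_cat [:: emv (a1, c1, m ++ top c2 ++ b1)] [::] k1; rewrite !cats0 /=.
  move=> k3; apply: comm_trans k3 _.
  have := comm_cat [:: emv (a1 ++ top c1 ++ m, c2, b1)] [::] k2; rewrite !cats0 /=.
  apply: comm_trans; apply: comm_step (comm_refl _) _.
  exact: (Swap [::] (map emv r3) (or_introl (square_emv a1 c1 m c2 b1))).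
have [[m [Ea Eb]]|[m [Ea Eb]]] := reach_disjoint hp E' ne; subst.
  exact: fin sz hr hcU hr' hcU' h h'.
apply: comm_sym; move: h h' hr hr' => h h' hr hr'.
have sz' : size cs' < n.
  have := peel_size hr hcU h; have := peel_size hr' hcU' h'; move: sz => /=.
  by lia.
exact: fin sz' hr' hcU' hr hcU h' h.
Qed.

(** Moves record labels only, but labels determine lengths, so paths split into edges where their
    labels split into words. The second cell thus already has its top path on the initial cut. *)
Lemma peel_square p cs q t : peel p cs q ->
  square (map emv cs) t \/ square t (map emv cs) ->
  exists2 cs', peel p cs' q & map emv cs' = t.
Proof.
move=> hp [] h.
  have [s0 E0] : exists s0, map emv cs = s0 by eexists.
  rewrite E0 in h; case: h E0 hp.
  move=> A U V B U' V' C; case: cs => [|[[a c] b] [|[[a' c'] b'] []]] //=.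
  rewrite /emv /= => -[ea ec ed /map_eq_cat[m [s [eb em /map_eq_cat[t' [b2 [es et eb2]]]]]]].
  case=> ea' ec' ed' eb' [-> [E <-]]; subst b s.
  have sz : size (a ++ bot c ++ m) = size a'.
    by rewrite -[RHS]size_dlabel ea' -ea -ed -em !size_cat !size_dlabel ?size_map.
  have [E1 E2] : a ++ bot c ++ m = a' /\ t' ++ b2 = top c' ++ b'.
    by apply: cat_size_inj sz _; rewrite -E -!catA.
  have [E3 E4] : t' = top c' /\ b2 = b'.
    by apply: cat_size_inj E2; rewrite -(size_map (@lab _ D)) et -ec' size_dlabel.
  subst a' t' b2; exists [:: (a ++ top c ++ m, c', b'); (a, c, m ++ bot c' ++ b')].
    by rewrite /= -!catA.
  by rewrite /emv /= !dlabel_cat ea ec ed -em ec' ed' eb'.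
have [s0 E0] : exists s0, map emv cs = s0 by eexists.
rewrite E0 in h; case: h E0 hp.
move=> A U V B U' V' C; case: cs => [|[[a c] b] [|[[a' c'] b'] []]] //=.
rewrite /emv /= => -[/map_eq_cat[a1 [s [ea ea1 /map_eq_cat[t' [m [es et em]]]]]]].
move=> ec ed eb [ea' ec' ed' eb' [-> [E <-]]]; subst a s.
have sz : size a1 = size a'.
  by rewrite -[RHS]size_dlabel ea' -ea1 ?size_dlabel ?size_map.
have [E1 E2] : a1 = a' /\ t' ++ m ++ bot c ++ b = top c' ++ b'.
  by apply: cat_size_inj sz _; rewrite -E -!catA.
have [E3 E4] : t' = top c' /\ m ++ bot c ++ b = b'.
  by apply: cat_size_inj E2; rewrite -(size_map (@lab _ D)) et -ec' size_dlabel.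
subst a' t' b'; exists [:: (a1, c', m ++ top c ++ b); (a1 ++ bot c' ++ m, c, b)].
  by rewrite /= -!catA.
by rewrite /emv /= !dlabel_cat ec' ed' ec ed eb -ea1 -em.
Qed.

Lemma peel_swap p cs q t : peel p cs q -> comm (map emv cs) t ->
  exists2 cs', peel p cs' q & map emv cs' = t.
Proof.
move=> hp h; have [s E] : exists s, map emv cs = s by eexists.
rewrite E in h; elim: h cs hp E => [s0|s0 t0 r _ IH h] cs hp E; first by exists cs.
have {IH} [cs1 hp1 E1] := IH cs hp E.
case: h E1 => a b x y h /map_eq_cat[ca [cs2 [E2 Ea /map_eq_cat[cx [cb [E3 Ex Eb]]]]]].
subst cs1 cs2 a b x; have [r1 h1 /peel_cat[r2 h2 h3]] := (peel_cat _ _ _ _).1 hp1.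
have [cy h4 <-] := peel_square h2 h.
exists (ca ++ cy ++ cb); last by rewrite !map_cat.
by apply/peel_cat; exists r1 => //; apply/peel_cat; exists r2.
Qed.

(** Equal left contexts put [top c'] in the place of [bot c]: the two cells form the dipole
    [dipole c' c], in which the upper cell is [c]. *)
Lemma peel_cancel p a c b a' c' b' q : peel p [:: (a, c, b); (a', c', b')] q ->
  emv (a', c', b') = minv (emv (a, c, b)) ->
  [/\ a' = a, b' = b, top c' = bot c & dlabel (bot c') = dlabel (top c)].
Proof.
rewrite /= /minv /emv /= => -[_ [E _]] [ea et eb _].
have sz : size a = size a' by rewrite -size_dlabel -ea size_dlabel.
have [<- E2] := cat_size_inj sz E.
have sz2 : size (bot c) = size (top c') by rewrite -size_dlabel -et size_dlabel.
by have [-> ->] := cat_size_inj sz2 E2.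
Qed.

Lemma reach_to_cell U p c : reach U p -> uniq U -> c \notin U ->
  exists cs a b, peel p cs (a ++ top c ++ b) /\ c \notin cells cs.
Proof.
move=> hp hU hc; have [cs hcs] := reach_complete hp hU.
have [h1 h2] := peel_reach hp hU hcs; have [_ /(_ c)] := reach_dbot h1.
rewrite catrevE mem_cat mem_rev (negPf hc) orbF => /mapP[[[a c'] b]] /=.
move=> hin E; subst c'; case/path.splitPr: hin hcs h1 h2 => [cs1 cs2].
case/peel_cat=> q h [Eq _] _; rewrite catrevE => hu.
exists cs1, a, b; rewrite -Eq; split=> //.
move: hu; rewrite cat_uniq rev_uniq /cells map_cat cat_uniq /= => /andP[/and3P[_ + _] _].
by case/norP.
Qed.

End Diagram.
End Planar.

Local Notation moves := (map (@emv _ _)).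

(** * Construction of diagrams *)

Section FixRot.
Variables (Sigma : Type) (P : presentation Sigma) (D : plane_graph Sigma).
Local Notation dart := (edge D * bool)%type.

Definition face_of (d : dart) := odflt None [pick f | d \in boundary f].

(* The rotation is the one for which the boundaries are the face cycles. *)
Definition fix_rot : plane_graph Sigma :=
  @PlaneGraph Sigma (nvert D) (nedge D) (ncell D) (@src _ D) (@tgt _ D)
    (@lab _ D) (fun d => next (boundary (face_of (flip d))) (flip d))
    (@top _ D) (@bot _ D) (ini D) (ter D) (dtop D) (dbot D).

Lemma uniq_boundary (p q : seq (edge D)) :
  uniq (forth p ++ back q) = uniq p && uniq q.
Proof.
rewrite cat_uniq rev_uniq !map_inj_uniq; try by move=> ? ? [].
case: hasP => [[d]|_] //=; rewrite /= mem_forth mem_back.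
by case: d.2.
Qed.

Hypothesis bd_uniq : forall f : option (cell D), uniq (boundary f).
Hypothesis bd_ex : forall d : dart, exists! f, d \in boundary f.

Lemma face_ofE d f : d \in boundary f -> face_of d = f.
Proof.
have [g [h1 h2]] := bd_ex d; move=> /h2 <-.
by rewrite /face_of; case: pickP => [f' /h2 ->|/(_ g)] //; rewrite h1.
Qed.

Lemma mem_face_of d : d \in boundary (face_of d).
Proof. by have [g [h1 _]] := bd_ex d; rewrite (face_ofE h1). Qed.

Lemma fix_face (d : dart) : @face _ fix_rot d = next (boundary (face_of d)) d.
Proof. by rewrite /face /=; case: d => e []. Qed.

Lemma fix_cycle (f : option (cell D)) : fcycle (@face _ fix_rot) (boundary f).
Proof.
rewrite -(@eq_in_cycle _ (mem (boundary f)) (frel (next (boundary f)))).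
- exact: cycle_next (bd_uniq f).
- move=> d d' hd _; have E := fix_face d; rewrite (face_ofE hd) in E.
  exact: (congr1 (fun z => z == d') (esym E)).
by apply/allP.
Qed.

Lemma fix_inj : injective (@Defs.rot _ fix_rot).
Proof.
move=> d d' /= E.
have h : Defs.rot (p := fix_rot) d \in boundary (face_of (flip d)).
  by rewrite /= mem_next mem_face_of.
have h' : Defs.rot (p := fix_rot) d \in boundary (face_of (flip d')).
  by rewrite /= E mem_next mem_face_of.
have ee := face_ofE h; rewrite (face_ofE h') in ee.
have : flip d = flip d'.
  by apply: (can_inj (prev_next (bd_uniq (face_of (flip d))))); rewrite E ee.
by move/(congr1 (@flip _ D)); rewrite !flipK.
Qed.

Hypothesis bd_paths : forall f : option (cell D), exists x y,
  pos_path x (fwd f) y /\ pos_path x (bwd f) y.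
Hypothesis bd_nonempty : forall f : option (cell D), bwd f <> [::].

Lemma fix_org (d : dart) : org (Defs.rot (p := fix_rot) d : dart) = org d.
Proof.
rewrite /=; have hd := mem_face_of (flip d).
have [x [y [h1 h2]]] := bd_paths (face_of (flip d)).
have := boundary_cycle (val := @org _ D) (@bd_nonempty _) h1 h2; rewrite -boundaryE.
by move=> /next_cycle/(_ hd)/eqP; rewrite flipK.
Qed.

Hypothesis bd_orbit : forall d d' : dart, org d = org d' ->
  fconnect (@Defs.rot _ fix_rot) d d'.
Hypothesis bd_euler : nvert D + (ncell D).+1 = nedge D + 2.
Hypothesis bd_source : forall x, (forall e : edge D, tgt e <> x) <-> x = ini D.
Hypothesis bd_sink : forall x, (forall e : edge D, src e <> x) <-> x = ter D.
Hypothesis bd_label : forall c : cell D, step P (dlabel (top c)) (dlabel (bot c)).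
Variable height : vert D -> nat.
Hypothesis bd_height : forall e : edge D, height (src e) < height (tgt e).
Hypothesis bd_dtop : pos_path (ini D) (dtop D) (ter D).
Hypothesis bd_dbot : pos_path (ini D) (dbot D) (ter D).

Lemma fix_from_ini x : exists p, pos_path (ini D) p x.
Proof.
have [n] := ubnP (height x); elim: n x => // n IH x hx.
have [->|h] := pselect (x = ini D); first by exists [::].
have [e he] : exists e, tgt e = x.
  by apply: contrapT => h'; apply/h/bd_source => e he; apply: h'; exists e.
have [|p hp] := IH (src e).
  by apply: leq_trans (bd_height e) _; rewrite he -ltnS.
by exists (p ++ [:: e]); apply/pos_path_cat; exists (src e).
Qed.

Lemma fix_to_ter x : exists p, pos_path x p (ter D).
Proof.
pose m := \max_y height y; have [n] := ubnP (m - height x); elim: n x => // n IH x hx.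
have [->|h] := pselect (x = ter D); first by exists [::].
have [e he] : exists e, src e = x.
  by apply: contrapT => h'; apply/h/bd_sink => e he; apply: h'; exists e.
have [|p hp] := IH (tgt e); last by exists (e :: p).
have := bd_height e; have : height (tgt e) <= m by apply: leq_bigmax.
by rewrite he; move: hx => /=; lia.
Qed.

Lemma path_connect x p y : pos_path x p y -> connect (@neighbour _ D) x y.
Proof.
elim: p x => [|e p IH] x /= => [->|[hx /IH h]]; first exact: connect0.
apply: connect_trans h; apply: connect1; apply/existsP; exists e.
by rewrite hx !eqxx.
Qed.

Lemma path_height x (p : seq (edge D)) y : pos_path x p y -> uniq (x :: [seq tgt e | e <- p]).
Proof.
move=> hp; suff h : path (fun x y => height x < height y) x [seq tgt e | e <- p].
  apply: (@sorted_uniq _ (fun x y => height x < height y)) => //.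
  - by move=> y1 y2 y3; apply: ltn_trans.
  - by move=> z; rewrite ltnn.
by elim: p x hp => //= e p IH x [<- /IH ->]; rewrite bd_height.
Qed.

(** The boundaries determine the rotation. The increasing height does the rest: vertices cannot
    repeat on a positive path, and descending or ascending links every vertex to [ini D] and to
    [ter D], whence also connectedness. *)
Lemma fix_diagram : is_diagram P fix_rot.
Proof.
split.
- exact: fix_inj.
- move=> d d'; apply/idP/eqP => [/iter_findex <-|]; last exact: bd_orbit.
  elim: (findex _ _ _) => // n IH; rewrite iterS.
  exact: etrans IH (esym (fix_org (iter n _ d))).
- move=> x y; have [p hp] := fix_from_ini x; have [q hq] := fix_from_ini y.
  apply: (@connect_trans _ (@neighbour _ D) (ini D)); last exact: path_connect hq.
  rewrite (@sym_connect_sym _ (@neighbour _ D)); first exact: path_connect hp.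
  by move=> u v; apply/eq_existsb => e; rewrite orbC.
- exact: fix_cycle.
- exact: bd_uniq.
- exact: bd_ex.
- exact: bd_euler.
- exact: bd_source.
- exact: bd_sink.
- exact: bd_label.
- move=> x; have [p hp] := fix_from_ini x; have [q hq] := fix_to_ter x.
  by exists p, q.
- by move=> x y p; apply: path_height.
- exact: bd_dtop.
- exact: bd_dbot.
Qed.

End FixRot.

Lemma pos_path_enum (Sigma : Type) (D : plane_graph Sigma) k (g : 'I_k -> edge D)
    (v : nat -> vert D) : (forall j, src (g j) = v j /\ tgt (g j) = v j.+1) ->
  pos_path (v 0) (map g (enum 'I_k)) (v k).
Proof.
move=> h; have aux (s : seq 'I_k) i : map val s = iota i (size s) ->
    pos_path (v i) (map g s) (v (i + size s)).
  elim: s i => [|j s IH] i /=; first by rewrite addn0.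
  case=> ji /IH; rewrite addSnnS; have [-> ->] := h j.
  by rewrite ji.
by have := aux (enum 'I_k) 0; rewrite val_enum_ord size_enum_ord; apply.
Qed.

Lemma enum_consecutive k (i j : 'I_k) : j = i.+1 :> nat ->
  exists a b, enum 'I_k = a ++ i :: j :: b.
Proof.
move=> ji; exists (take i (enum 'I_k)), (drop i.+2 (enum 'I_k)).
have e1 := drop_nth i (_ : i < size (enum 'I_k)).
have e2 := drop_nth i (_ : i.+1 < size (enum 'I_k)).
rewrite -[LHS](cat_take_drop i) e1 ?e2 ?size_enum_ord ?ltn_ord -?ji ?ltn_ord //.
by rewrite !nth_ord_enum.
Qed.

(** * The diagram without cells *)

Section PathDiagram.
Variables (Sigma : Type) (P : presentation Sigma) (w : seq Sigma).

(** The rotation [id] is a placeholder that [fix_rot] replaces. *)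
Definition path_graph : plane_graph Sigma :=
  @PlaneGraph Sigma (size w).+1 (size w) 0
    (widen_ord (leqnSn _)) (lift ord0) (tnth (in_tuple w)) id
    (fun=> [::]) (fun=> [::]) ord0 ord_max (enum 'I_(size w)) (enum 'I_(size w)).

Hypothesis w_nonempty : w <> [::].

Lemma path_graph_path : pos_path (D := path_graph) ord0 (enum 'I_(size w)) ord_max.
Proof.
have := @pos_path_enum _ path_graph (size w) id inord.
rewrite map_id; have -> : inord 0 = ord0 :> vert path_graph.
  by apply: val_inj; rewrite /= inordK.
have -> : inord (size w) = ord_max :> vert path_graph.
  by apply: val_inj; rewrite /= inordK.
apply=> j; split; apply: val_inj; rewrite /= inordK //; last exact: ltn_ord.
by rewrite ltnS ltnW.
Qed.

Lemma path_diagram : is_diagram P (fix_rot path_graph).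
Proof.
have noc (f : option (cell path_graph)) : f = None by case: f => [[]|].
have bE (f : option (cell path_graph)) :
    boundary f = forth (dbot path_graph) ++ back (dtop path_graph).
  by rewrite (noc f).
have bu (f : option (cell path_graph)) : uniq (boundary f).
  by rewrite bE uniq_boundary enum_uniq.
have bx (d : edge path_graph * bool) : exists! f, d \in boundary f.
  exists None; split; last by move=> f; rewrite (noc f).
  rewrite bE mem_cat mem_forth mem_back; case: d => e [];
  by rewrite mem_enum.
have en : enum 'I_(size w) <> [::].
  by move=> /(congr1 size); rewrite size_enum_ord => /size0nil.
apply: (@fix_diagram _ _ _ bu bx _ _ _ _ _ _ _ (fun x => x)) => //=.
- by move=> f; exists ord0, ord_max; rewrite (noc f) /=; split; apply: path_graph_path.
- by move=> f; rewrite (noc f).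
- have cons (e e' : edge path_graph) : tgt e = src e' ->
      fconnect (@Defs.rot _ (fix_rot path_graph)) (e, false) (e', true).
    move=> /(congr1 val) /= E; apply/connect1/eqP.
    have [a [b ab]] := enum_consecutive (esym E).
    exact: (@cycle_forth _ (fix_rot path_graph) (fix_cycle bu bx) None a e e' b ab).
  case=> e [] [e' []]; rewrite /org /=.
  + by move=> /(congr1 val) /= /val_inj ->; apply: connect0.
  + by move=> E; rewrite fconnect_sym; [apply: cons | apply: fix_inj bu bx].
  + exact: cons.
  + by move=> /lift_inj ->; apply: connect0.
- by rewrite addn1 addn2.
- move=> x; split=> [h|-> e /(congr1 val)//].
  case: (unliftP ord0 x) => [j|//] E; case: (h j); by rewrite E.
- move=> x; split=> [h|-> e /(congr1 val) /= E].
    apply: val_inj => /=; apply/eqP; rewrite eqn_leq -ltnS ltn_ord leqNgt.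
    by apply/negP => hx; apply: (h (Ordinal hx)); apply: val_inj.
  by have := ltn_ord e; rewrite E ltnn.
- by case.
- exact: path_graph_path.
- exact: path_graph_path.
Qed.

End PathDiagram.

(* Two cycles sharing the arc [Z] are obtained from one cycle by replacing the
   arc [T] with [S]; the second one closes [T] with [B]. *)
Lemma splice_cycles (U1 U2 : eqType) (f : U1 -> U1) (g : U2 -> U2) (o : U1 -> U2)
    (T Z : seq U1) (S B : seq U2) (s0 sl b0 bl : U2) (r1 r2 r3 r4 : seq U2) :
  fcycle f (T ++ Z) -> fcycle g (S ++ map o Z) -> fcycle g (map o T ++ B) ->
  T <> [::] -> Z <> [::] -> S = s0 :: r1 -> S = rcons r2 sl ->
  B = b0 :: r3 -> B = rcons r4 bl ->
  forall d, d \in T ++ Z -> [\/ g (o d) = o (f d),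
    g (o d) = b0 /\ g sl = o (f d) | g (o d) = s0 /\ g bl = o (f d)].
Proof.
move=> hD hN hC Tn Zn S0 Sl B0 Bl d; rewrite mem_cat => /orP[] hd.
  case/path.splitPr: hd hD hC {Tn} => T1 [|d' T2] hD hC; last first.
    rewrite -catA in hD; rewrite map_cat -catA in hC; apply: Or31.
    have /eqP -> := cycle_consecutive hD.
    by have /= /eqP -> := cycle_consecutive hC.
  case: Z Zn hD hN => // z Z _; rewrite -catA => hD.
  rewrite Sl /= cat_rcons => hN; rewrite map_cat -catA B0 in hC; apply: Or32.
  have /eqP -> := cycle_consecutive hD; have /eqP -> := cycle_consecutive hN.
  by have /= /eqP -> := cycle_consecutive hC.
case/path.splitPr: hd hD hN {Zn} => Z1 [|d' Z2] hD hN; last first.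
  rewrite catA in hD; rewrite map_cat catA in hN; apply: Or31.
  have /eqP -> := cycle_consecutive hD.
  by have /= /eqP -> := cycle_consecutive hN.
apply: Or33; case: T Tn hD hC => // x T _.
rewrite cats1 cat_cons -rcons_cat => hD; have /eqP -> := cycle_wrap hD.
rewrite Bl /= -rcons_cat => hC; have /eqP -> := cycle_wrap hC.
rewrite S0 map_cat cats1 cat_cons -rcons_cat in hN.
by have /eqP -> := cycle_wrap hN.
Qed.

(** * Gluing one cell under a segment of the bottom path *)

Section AddCell.
Variables (Sigma : Type) (P : presentation Sigma) (D : plane_graph Sigma).
Hypotheses (hD : is_diagram P D) (hne : dtop D <> [::]).
Variables (p1 p2 t' : seq (edge D)) (t0 : edge D) (v : seq Sigma).
Let t := t0 :: t'.
Hypothesis dbotE : dbot D = p1 ++ t ++ p2.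
Hypothesis v_step : step P (dlabel t) v.
Let k := size v.

Definition old_edge (e : edge D) : 'I_(nedge D + k) := lshift k e.
Definition new_edge (j : 'I_k) : 'I_(nedge D + k) := rshift (nedge D) j.
Definition oldv (x : vert D) : 'I_(nvert D + k.-1) := lshift k.-1 x.
Definition new_path := map new_edge (enum 'I_k).

(** The [i]-th vertex along the new path. Its ends are old and its [k.-1] inner vertices are new;
    [insub] fails exactly for [i >= k], which stands for the end of [t]. *)
Definition vpos (i : nat) : 'I_(nvert D + k.-1) :=
  if i is i'.+1 then
    if insub i' is Some j then rshift (nvert D) j
    else oldv (last (tgt t0) (map (@tgt _ D) t'))
  else oldv (src t0).

(** As in [path_graph], the rotation is left to [fix_rot]. *)
Definition add_cell : plane_graph Sigma :=
  @PlaneGraph Sigma (nvert D + k.-1) (nedge D + k) (ncell D + 1)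
    (fun e => match split e with inl e => oldv (src e) | inr j => vpos j end)
    (fun e => match split e with inl e => oldv (tgt e) | inr j => vpos j.+1 end)
    (fun e => match split e with inl e => lab e | inr j => tnth (in_tuple v) j end)
    id
    (fun c => map old_edge (if split c is inl c then top c else t))
    (fun c => if split c is inl c then map old_edge (bot c) else new_path)
    (oldv (ini D)) (oldv (ter D)) (map old_edge (dtop D))
    (map old_edge p1 ++ new_path ++ map old_edge p2).

Let A := add_cell.
Let D' := fix_rot A.

Definition oldc (c : cell D) : cell A := lshift 1 c.
Definition newc : cell A := rshift (ncell D) ord0.

Lemma split_old e : split (old_edge e) = inl e.
Proof. exact: (unsplitK (inl e)). Qed.
Lemma split_new j : split (new_edge j) = inr j.
Proof. exact: (unsplitK (inr j)). Qed.
Lemma split_oldc c : split (oldc c) = inl c.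
Proof. exact: (unsplitK (inl c)). Qed.
Lemma split_newc : split newc = inr ord0.
Proof. exact: (unsplitK (inr ord0)). Qed.

Lemma old_newc c : (Some (oldc c) == Some newc) = false.
Proof.
apply/negP => /eqP E.
have := congr1 (fun f => if f is Some c then split c else inr ord0) E.
by rewrite split_oldc split_newc.
Qed.

Lemma edgeP (e : edge A) : (exists e0, e = old_edge e0) \/ (exists j, e = new_edge j).
Proof. by case: (split_ordP e) => [e0|j] ->; [left; exists e0 | right; exists j]. Qed.

Lemma vertP (x : vert A) : (exists x0, x = oldv x0) \/ (exists i, x = rshift (nvert D) i).
Proof. by case: (split_ordP x) => [e0|j] ->; [left; exists e0 | right; exists j]. Qed.

Lemma cellP (f : option (cell A)) :
  [\/ f = None, exists c, f = Some (oldc c) | f = Some newc].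
Proof.
case: f => [c|]; last by apply: Or31.
case: (split_ordP c) => [c0|j] ->; first by apply: Or32; exists c0.
by apply: Or33; rewrite (ord1 j).
Qed.

Lemma old_inj : injective old_edge. Proof. exact: lshift_inj. Qed.
Lemma new_inj : injective new_edge. Proof. exact: rshift_inj. Qed.
Lemma oldv_inj : injective oldv. Proof. exact: lshift_inj. Qed.

Lemma old_new e j : old_edge e <> new_edge j.
Proof. by move=> E; have := split_old e; rewrite E split_new. Qed.

Lemma oldv_new x i : oldv x <> rshift (nvert D) i.
Proof.
move=> E; have := unsplitK (inl x : 'I_(nvert D) + 'I_k.-1).
by rewrite /= -/(oldv x) E (unsplitK (inr i)).
Qed.

Lemma mem_old e (p : seq (edge D)) : (old_edge e \in map old_edge p) = (e \in p).
Proof. exact: mem_map old_inj _ _. Qed.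
Lemma mem_new j (p : seq (edge D)) : (new_edge j \in map old_edge p) = false.
Proof. by apply/negP => /mapP[e _ /esym/old_new]. Qed.
Lemma old_new_path e : (old_edge e \in new_path) = false.
Proof. by apply/negP => /mapP[j _ /old_new]. Qed.
Lemma new_new_path j : new_edge j \in new_path.
Proof. by rewrite mem_map ?mem_enum //; apply: new_inj. Qed.

Lemma src_old e : @src _ A (old_edge e) = oldv (src e).
Proof. by rewrite /= split_old. Qed.
Lemma tgt_old e : @tgt _ A (old_edge e) = oldv (tgt e).
Proof. by rewrite /= split_old. Qed.
Lemma lab_old e : @lab _ A (old_edge e) = lab e.
Proof. by rewrite /= split_old. Qed.
Lemma src_new j : @src _ A (new_edge j) = vpos j.
Proof. by rewrite /= split_new. Qed.
Lemma tgt_new j : @tgt _ A (new_edge j) = vpos j.+1.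
Proof. by rewrite /= split_new. Qed.

Lemma top_old c : @top _ A (oldc c) = map old_edge (top c).
Proof. by rewrite /= split_oldc. Qed.
Lemma bot_old c : @bot _ A (oldc c) = map old_edge (bot c).
Proof. by rewrite /= split_oldc. Qed.
Lemma top_new : @top _ A newc = map old_edge t.
Proof. by rewrite /= split_newc. Qed.
Lemma bot_new : @bot _ A newc = new_path.
Proof. by rewrite /= split_newc. Qed.

Lemma dlabel_old p : @dlabel _ A (map old_edge p) = dlabel p.
Proof. by rewrite /dlabel -map_comp; apply: eq_map => e; apply: lab_old. Qed.

Lemma dlabel_new : @dlabel _ A new_path = v.
Proof.
rewrite /dlabel /new_path -map_comp -[RHS](map_tnth_enum (in_tuple v)).
by apply: eq_map => j; rewrite /= split_new.
Qed.

Lemma k_gt0 : 0 < k.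
Proof. by rewrite /k; case: v (step_nilR v_step). Qed.

Lemma old_path x p y : pos_path x p y -> @pos_path _ A (oldv x) (map old_edge p) (oldv y).
Proof.
by elim: p x => [|e p IH] x => [->|[<- /IH h]] //; split; rewrite ?src_old ?tgt_old.
Qed.

Lemma vpos_end : vpos k = oldv (last (tgt t0) (map (@tgt _ D) t')).
Proof.
suff h i : k <= i -> vpos i = oldv (last (tgt t0) (map (@tgt _ D) t')) by apply: h.
case: i => [|i] hi; first by have := leq_trans k_gt0 hi.
by rewrite /vpos insubF //; apply/negbTE; rewrite -leqNgt -ltnS prednK ?k_gt0.
Qed.

Lemma vpos_old i x : vpos i = oldv x -> i = 0 \/ k <= i.
Proof.
case: i => [|i]; first by left.
rewrite /vpos; case: insubP => [j _ _ /esym/oldv_new|] //; rewrite -leqNgt => h _.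
by right; rewrite -(prednK k_gt0).
Qed.

Lemma vpos_new i j : vpos i = rshift (nvert D) j -> i = j.+1.
Proof.
case: i => [/oldv_new|i] //; rewrite /vpos; case: insubP => [j' _ <-|_ /oldv_new] //.
by move=> /rshift_inj ->.
Qed.

Lemma new_path_path : @pos_path _ A (vpos 0) new_path (vpos k).
Proof.
by apply: (@pos_path_enum _ A) => j; rewrite src_new tgt_new.
Qed.

Lemma t_path : pos_path (src t0) t (last (tgt t0) (map (@tgt _ D) t')).
Proof.
have := dbot_path hD; rewrite dbotE => /pos_path_cat[x _ /pos_path_cat[y h _]].
have [hx _] := h; subst x; by have /= <- := pos_path_last h.
Qed.

Lemma add_dbot_path : pos_path (ini A) (dbot A) (ter A).
Proof.
have := dbot_path hD; rewrite dbotE => /pos_path_cat[x h1 /pos_path_cat[y h2 h3]].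
have [hx _] := h2; subst x; apply/pos_path_cat; exists (vpos 0); first exact: old_path.
apply/pos_path_cat; exists (vpos k); first exact: new_path_path.
by rewrite vpos_end; have /= <- := pos_path_last h2; apply: old_path.
Qed.

Lemma add_paths (f : option (cell A)) : exists x y,
  pos_path x (fwd f) y /\ pos_path x (bwd f) y.
Proof.
case: (cellP f) => [|[c]|] ->.
- exists (ini A), (ter A); split; first exact: add_dbot_path.
  exact: (old_path (dtop_path hD)).
- have [x [y [h1 h2]]] := face_paths hD hne (Some c).
  by exists (oldv x), (oldv y); rewrite /fwd /bwd top_old bot_old; split; apply: old_path.
exists (vpos 0), (vpos k); rewrite /fwd /bwd top_new bot_new.
by split; [rewrite vpos_end; apply: old_path t_path | apply: new_path_path].
Qed.

Lemma add_nonempty (f : option (cell A)) : bwd f <> [::].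
Proof.
case: (cellP f) => [|[c]|] ->.
- by move=> /= /(congr1 size); rewrite size_map => /size0nil.
- rewrite /bwd bot_old => /(congr1 size); rewrite size_map => /size0nil.
  exact: bot_nonempty hD c.
rewrite /bwd bot_new => /(congr1 size); rewrite size_map size_enum_ord => h.
by have := k_gt0; rewrite h.
Qed.

Lemma dbot_uniq : [/\ uniq p1, uniq p2, uniq t,
  forall e, e \in t -> (e \notin p1) && (e \notin p2) &
  forall e, e \in p1 -> e \notin p2].
Proof.
have := path_uniq hD (dbot_path hD); rewrite dbotE cat_uniq.
case/and3P=> -> /hasPn h1; rewrite cat_uniq => /and3P[-> /hasPn h2 ->].
split=> // e he.
  rewrite h1 ?mem_cat ?he //=; by apply/negP => /h2; rewrite /= he.
by apply/negP => h3; have := h1 e; rewrite mem_cat h3 orbT /= he => /(_ isT).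
Qed.

Lemma add_uniq (f : option (cell A)) : uniq (boundary f).
Proof.
rewrite boundaryE uniq_boundary; have [u1 u2 u3 u4 u5] := dbot_uniq.
have un : uniq new_path by rewrite map_inj_uniq ?enum_uniq //; apply: new_inj.
case: (cellP f) => [|[c]|] ->; rewrite /fwd /bwd ?top_old ?bot_old ?top_new ?bot_new.
- rewrite !cat_uniq un !(map_inj_uniq old_inj) u1 u2 (uniq_bwd hD None) !andbT !andTb.
  apply/andP; split; apply/hasPn => e.
    rewrite mem_cat => /orP[/mapP[j _ ->]|/mapP[e0 he ->]] /=; first by rewrite mem_new.
    by rewrite mem_old; apply/negP => /u5; rewrite he.
  by move=> /mapP[e0 _ ->] /=; rewrite old_new_path.
- by rewrite !(map_inj_uniq old_inj) (uniq_bwd hD (Some c)) (uniq_fwd hD (Some c)).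
by rewrite un andbT (map_inj_uniq old_inj t).
Qed.

Definition lift_face (f : option (cell D)) := omap oldc f.

Lemma add_below (f : option (cell A)) e : (old_edge e \in fwd f) =
  ((if e \in t then Some newc else lift_face (below e)) == f).
Proof.
have [u1 u2 u3 u4 u5] := dbot_uniq.
have bt e' : e' \in t -> below e' = None.
  by move=> he; apply/eqP; rewrite -(belowE hD) /= dbotE !mem_cat he orbT.
have oldc_inj : injective oldc by apply: lshift_inj.
case: (cellP f) => [|[c]|] ->; rewrite /fwd ?top_old ?top_new.
- rewrite !mem_cat !mem_old old_new_path /=; case: ifP => he.
    by have := u4 e he => /andP[/negbTE -> /negbTE ->].
  have := belowE hD e None; rewrite /= dbotE !mem_cat he /= => ->.
  by case: (below e).
- rewrite mem_old (mem_top hD); case: ifP => he; first by rewrite (bt _ he); apply: esym; rewrite eq_sym; apply: old_newc.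
  by case: (below e) => //= c'; rewrite /eq_op /= (inj_eq oldc_inj).
rewrite mem_old; case: ifP => he; rewrite ?eqxx //.
by case: (below e) => // c'; apply: (esym (old_newc c')).
Qed.

Lemma add_above (f : option (cell A)) e :
  (old_edge e \in bwd f) = (lift_face (above e) == f).
Proof.
have oldc_inj : injective oldc by apply: lshift_inj.
case: (cellP f) => [|[c]|] ->; rewrite /bwd ?bot_old ?bot_new.
- by rewrite mem_old (mem_dtop hD); case: (above e).
- rewrite mem_old (mem_bot hD).
  by case: (above e) => //= c'; rewrite /eq_op /= (inj_eq oldc_inj).
by rewrite old_new_path; case: (above e) => // c'; apply: (esym (old_newc c')).
Qed.

Lemma add_below_new (f : option (cell A)) j : (new_edge j \in fwd f) = (None == f).
Proof.
case: (cellP f) => [|[c]|] ->; rewrite /fwd ?top_old ?top_new ?mem_new //=.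
by rewrite !mem_cat new_new_path orbT.
Qed.

Lemma add_above_new (f : option (cell A)) j : (new_edge j \in bwd f) = (Some newc == f).
Proof.
case: (cellP f) => [|[c]|] ->; rewrite /bwd ?bot_old ?bot_new ?mem_new ?eqxx //=.
  by rewrite eq_sym old_newc.
by rewrite new_new_path.
Qed.

Lemma add_faces (d : edge A * bool) : exists! f, d \in boundary f.
Proof.
have ex (g : option (cell A)) : (forall f, (d \in boundary f) = (g == f)) ->
    exists! f, d \in boundary f.
  by move=> h; exists g; split=> [|f]; rewrite h ?eqxx // => /eqP.
case: d ex => e [] ex; case: (edgeP e) ex => -[j ->] ex.
- by apply: ex => f; rewrite mem_boundary /= add_below.
- by apply: ex => f; rewrite mem_boundary /= add_below_new.
- by apply: ex => f; rewrite mem_boundary /= add_above.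
- by apply: ex => f; rewrite mem_boundary /= add_above_new.
Qed.

Notation rot' := (@Defs.rot _ D').
Notation face' := (@face _ D').
Definition odart (d : edge D * bool) : edge A * bool := (old_edge d.1, d.2).

Lemma odart_inj : injective odart.
Proof.
move=> [e b] [e' b'] E; have /old_inj -> : old_edge e = old_edge e' := congr1 fst E.
by have /= -> := congr1 snd E.
Qed.

Lemma add_cycle (f : option (cell A)) : fcycle face' (boundary f).
Proof. exact: fix_cycle add_uniq add_faces f. Qed.

Lemma rot_face d : rot' d = face' (flip d).
Proof. by rewrite /face /flip /=; case: d => e []. Qed.

Lemma map_forth p : @forth _ A (map old_edge p) = map odart (@forth _ D p).
Proof. by rewrite /forth -!map_comp. Qed.
Lemma map_back p : @back _ A (map old_edge p) = map odart (@back _ D p).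
Proof. by rewrite /back -!map_comp map_rev -map_comp. Qed.

Lemma add_connect_sym : connect_sym (frel rot').
Proof. exact: fconnect_sym (fix_inj add_uniq add_faces). Qed.

Section Outer.
Let T := @forth _ D t.
Let Z := @forth _ D p2 ++ @back _ D (dtop D) ++ @forth _ D p1.

Lemma outer_cycle : fcycle (@face _ D) (T ++ Z).
Proof.
have := face_cycle hD None; rewrite /boundary dbotE /forth !map_cat -!catA.
by rewrite cycle_catC -!catA.
Qed.

Lemma outer_cycle' : fcycle face' (@forth _ A new_path ++ map odart Z).
Proof.
have := add_cycle None; rewrite /boundary /= /forth !map_cat -/(forth _) -/(forth _).
rewrite -!catA cycle_catC -!catA -!map_forth.
by rewrite -!map_back.
Qed.

Lemma newcell_cycle : fcycle face' (map odart T ++ @back _ A new_path).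
Proof. by have := add_cycle (Some newc); rewrite boundaryE /fwd /bwd top_new bot_new map_forth. Qed.

Lemma new_ends : exists s0 s1 sl s2,
  [/\ new_path = s0 :: s1, new_path = rcons s2 sl, s0 = new_edge (Ordinal k_gt0)
    & forall j : 'I_k, j.+1 = k -> new_edge j = sl].
Proof.
have : size new_path = k by rewrite size_map size_enum_ord.
rewrite /new_path; have := k_gt0.
have : map val (enum 'I_k) = iota 0 k by apply: val_enum_ord.
case/lastP E1: (enum 'I_k) => [|s2 sl] hv hk; first by rewrite /= => hk'; rewrite -hk' in hk.
case E2: (enum 'I_k) => [|s0 s1] // _; first by move: E1; rewrite E2; case: (s2).
rewrite -E1; exists (new_edge s0), (map new_edge s1), (new_edge sl), (map new_edge s2).
rewrite {1}E2 {1}E1 map_rcons; split=> //.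
  congr new_edge; apply: val_inj => /=.
  have h n : head 0 (iota 0 n) = 0 by case: n.
  have : head 0 (map val (enum 'I_k)) = head 0 (iota 0 k) by rewrite val_enum_ord.
  by rewrite E2 h.
move=> j jk; congr new_edge; apply: val_inj => /=.
have : last 0 (map val (enum 'I_k)) = last 0 (iota 0 k) by rewrite val_enum_ord.
have lst n : last 0 (iota 0 n.+1) = n by rewrite -nth_last size_iota nth_iota.
rewrite E1 map_rcons last_rcons => ->; have := lst j; rewrite (congr1 (iota 0) jk).
by move=> ->.
Qed.


(** In the outer boundary the arc [t] is replaced by the new path, while [t] now bounds the new
    cell. A turn of the old rotation along the outer face survives, except at the two ends of [t],
    where a dart of the new path is inserted and the turn takes two steps. *)
Lemma old_step d : d \in boundary None ->
  fconnect rot' (odart (flip d)) (odart (face d)).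
Proof.
have [s0 [s1 [sl [s2 [E1 E2 E3 E4]]]]] := new_ends.
have rotE x : rot' (odart (flip x)) = face' (odart x).
  by rewrite rot_face; case: x => e [].
have hZ : Z <> [::].
  rewrite /Z => /(congr1 size); rewrite !size_cat /back size_rev !size_map.
  by case: (dtop D) hne => //= ? ? _; rewrite addnS.
have fs0 : @forth _ A new_path = (s0, true) :: @forth _ A s1 by rewrite E1.
have fsl : @forth _ A new_path = rcons (@forth _ A s2) (sl, true).
  by rewrite E2 /forth map_rcons.
have bsl : @back _ A new_path = (sl, false) :: @back _ A s2.
  by rewrite E2 /back map_rcons rev_rcons.
have bs0 : @back _ A new_path = rcons (@back _ A s1) (s0, false).
  by rewrite E1 /back /= rev_cons.
move=> hd; have {}hd : d \in T ++ Z.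
  have cat p q : @forth _ D (p ++ q) = forth p ++ forth q by apply: map_cat.
  move: hd; rewrite boundaryE [fwd _]dbotE cat (cat t) /T /Z !mem_cat.
  by case/orP=> [/or3P[]|] ->; rewrite ?orbT.
have Tn : T <> [::] by [].
have := splice_cycles outer_cycle outer_cycle' newcell_cycle Tn hZ fs0 fsl bsl bs0 hd.
case=> [h|[h1 h2]|[h1 h2]].
- by apply/connect1/eqP; rewrite -h rotE.
- apply: (@connect_trans _ _ (sl, false)); apply/connect1/eqP; first by rewrite rotE.
  by rewrite rot_face.
- apply: (@connect_trans _ _ (s0, true)); apply/connect1/eqP; first by rewrite rotE.
  by rewrite rot_face.
Qed.

Lemma old_connect d d' : fconnect (@Defs.rot _ D) d d' -> fconnect rot' (odart d) (odart d').
Proof.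
move=> /iter_findex <-; elim: (findex _ _ _) => [|n IH]; first exact: connect0.
apply: connect_trans IH _; rewrite iterS; move: (iter n _ d) => {}d.
have [f [hf _]] := faces hD (flip d).
have -> : Defs.rot d = face (flip d) by rewrite /face flipK.
case: f hf => [c|] hf; last by have := old_step hf; rewrite flipK.
apply/connect1/eqP; rewrite rot_face; change (face' (odart (flip d)) = odart (face (flip d))).
have h1 := next_cycle (face_cycle hD (Some c)) hf.
have h2 : odart (flip d) \in @boundary _ A (Some (oldc c)).
  by rewrite mem_boundary /fwd /bwd top_old bot_old; move: hf; rewrite mem_boundary;
     case: (flip d) => e [] /=; rewrite mem_old.
have /eqP -> := next_cycle (add_cycle (Some (oldc c))) h2.
move/eqP: h1 => ->; rewrite !boundaryE /fwd /bwd top_old bot_old map_forth map_back.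
rewrite -map_cat next_map //; first exact: odart_inj.
by have := face_uniq hD (Some c); rewrite boundaryE.
Qed.

Lemma odart_org d : @org _ A (odart d) = oldv (org d).
Proof. by case: d => e []; rewrite /org /= ?src_old ?tgt_old // split_old. Qed.

Lemma org_new j b : @org _ A (new_edge j, b) = vpos (if b then j : nat else j.+1).
Proof. by case: b; rewrite /org ?src_new ?tgt_new. Qed.

(** The only new darts at old vertices are the first and the last one of the new path, and each is
    next to a dart of [t] in the rotation. *)
Lemma dart_oldv a x : @org _ A a = oldv x ->
  exists2 d, org d = x & fconnect rot' (odart d) a.
Proof.
have [s0 [s1 [sl [s2 [E1 E2 E3 E4]]]]] := new_ends.
have fix_orgA := fix_org add_faces add_paths add_nonempty.
have conn d b : fconnect rot' (odart d) b -> @org _ A b = oldv (org d).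
  move=> /iter_findex <-; elim: (findex _ _ _) => [|n IH]; first exact: odart_org.
  by rewrite iterS; exact: etrans (fix_orgA (iter n rot' (odart d))) IH.
suff h : @org _ A a = oldv x -> exists d, fconnect rot' (odart d) a.
  move=> ax; have [d hd] := h ax; exists d => //.
  by apply: oldv_inj; rewrite -(conn _ _ hd).
case: a => e b; case: (edgeP e) => -[j ->]; first by exists (j, b); apply: connect0.
rewrite org_new => /vpos_old; case: b => -[] // hj.
- exists (t0, true); rewrite add_connect_sym; apply/connect1/eqP; rewrite rot_face.
  have -> : new_edge j = s0 by rewrite E3; congr new_edge; apply: val_inj.
  have := newcell_cycle; rewrite E1 /back map_cons rev_cons -rcons_cat.
  by move=> h; have /eqP := cycle_wrap h.
- by move: hj; rewrite leqNgt ltn_ord.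
exists (last t0 t', false); apply/connect1/eqP; rewrite rot_face.
have -> : new_edge j = sl by apply: E4; apply/eqP; rewrite eqn_leq hj ltn_ord.
have := newcell_cycle; rewrite E2 /T /t lastI /back /forth !map_rcons rev_rcons -cats1 -catA.
by move=> h; have /eqP := cycle_consecutive h.
Qed.

Lemma dart_newv a i : @org _ A a = rshift (nvert D) i ->
  exists2 j : 'I_k, j = i :> nat & fconnect rot' (new_edge j, false) a.
Proof.
have ik : i < k by apply: leq_trans (ltn_ord i) (leq_pred _).
case: a => e b; case: (edgeP e) => -[j ->].
  by move=> h; have := odart_org (j, b); rewrite /odart /= h => /esym/oldv_new.
rewrite org_new => /vpos_new; case: b => hj; last first.
  by exists j; [case: hj | apply: connect0].
exists (Ordinal ik) => //; apply/connect1/eqP; rewrite rot_face.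
have [a [b ab]] := @enum_consecutive k (Ordinal ik) j hj.
have := add_cycle None; rewrite /boundary /= /new_path ab /forth !map_cat /=.
by rewrite -!catA /= catA => h; have /eqP := cycle_consecutive h.
Qed.

Lemma add_orbit a b : @org _ A a = @org _ A b -> fconnect rot' a b.
Proof.
case: (vertP (@org _ A b)) => -[x hb] ha; rewrite hb in ha.
  have [d1 h1 c1] := dart_oldv ha; have [d2 h2 c2] := dart_oldv hb.
  rewrite add_connect_sym in c1; apply: connect_trans c1 _; apply: connect_trans _ c2.
  by apply: old_connect; rewrite (rot_orbit hD) h1 h2.
have [j1 h1 c1] := dart_newv ha; have [j2 h2 c2] := dart_newv hb.
rewrite add_connect_sym in c1; apply: connect_trans c1 _.
by rewrite (_ : j1 = j2) //; apply: val_inj; rewrite /= h1 h2.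
Qed.

End Outer.
Variable height : vert D -> nat.
Hypothesis height_lt : forall e : edge D, height (src e) < height (tgt e).

(** Multiplying the old heights by [k] makes room for the [k.-1] new vertices between the ends of
    [t]. *)
Definition add_height (x : vert A) : nat :=
  match split x with inl x => k * height x | inr i => k * height (src t0) + i.+1 end.

Lemma add_height_old x : add_height (oldv x) = k * height x.
Proof. by rewrite /add_height (unsplitK (inl x)). Qed.

Lemma add_height_vpos i : i < k -> add_height (vpos i) = k * height (src t0) + i.
Proof.
case: i => [_|i hi]; first by rewrite add_height_old addn0.
rewrite /vpos; case: insubP => [j _ <-|]; first by rewrite /add_height (unsplitK (inr j)).
by rewrite -ltnS prednK ?k_gt0 // hi.
Qed.

Lemma height_path x (p : seq (edge D)) y : pos_path x p y -> height x + (p != [::]) <= height y.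
Proof.
elim: p x => [|e p IH] x /=; first by move=> ->; rewrite addn0.
case=> <- /IH; rewrite addn1 => h; apply: leq_trans (height_lt e) _.
exact: leq_trans (leq_addr _ _) h.
Qed.

Lemma add_height_lt (e : edge A) : add_height (src e) < add_height (tgt e).
Proof.
case: (edgeP e) => -[j ->].
  by rewrite src_old tgt_old !add_height_old ltn_pmul2l ?k_gt0 ?height_lt.
rewrite src_new tgt_new add_height_vpos ?ltn_ord //.
have [h|h] := ltnP j.+1 k; first by rewrite add_height_vpos // addnS.
have -> : j.+1 = k by apply/eqP; rewrite eqn_leq h ltn_ord.
rewrite vpos_end add_height_old; have := height_path t_path; rewrite /= addn1 => h1.
apply: (@leq_trans (k * (height (src t0)).+1)); last by rewrite leq_pmul2l ?k_gt0.
by rewrite mulnS addnC ltn_add2r ltn_ord.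
Qed.

Lemma add_diagram : is_diagram P D'.
Proof.
apply: (fix_diagram add_uniq add_faces add_paths add_nonempty add_orbit _ _ _ _
  add_height_lt).
- have := euler hD; have := k_gt0; rewrite /=; move: (k) => k0.
  move: (nvert D) (nedge D) (ncell D) => a b c; lia.
- move=> x; split=> [h|-> e].
    case: (vertP x) h => -[y ->] h.
      congr oldv; apply/(source_unique hD) => e he; apply: (h (old_edge e)).
      by rewrite tgt_old he.
    have yk : y < k by apply: leq_trans (ltn_ord y) (leq_pred _).
    case: (h (new_edge (Ordinal yk))); rewrite tgt_new /=.
    by case: insubP => [j _ /val_inj ->|] //; rewrite ltn_ord.
  case: (edgeP e) => -[j ->]; first by rewrite tgt_old => /oldv_inj/(no_into_ini hD).
  rewrite tgt_new => E; case: (vpos_old E) => // hj.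
  have jk : j.+1 = k by apply/eqP; rewrite eqn_leq hj ltn_ord.
  by move: E; rewrite jk vpos_end last_map => /oldv_inj/(no_into_ini hD).
- move=> x; split=> [h|-> e].
    case: (vertP x) h => -[y ->] h.
      congr oldv; apply/(sink_unique hD) => e he; apply: (h (old_edge e)).
      by rewrite src_old he.
    have yk : y.+1 < k by rewrite -ltn_predRL; apply: ltn_ord.
    case: (h (new_edge (Ordinal yk))); rewrite src_new /=.
    by case: insubP => [j _ /val_inj ->|] //; rewrite ltn_ord.
  case: (edgeP e) => -[j ->]; first by rewrite src_old => /oldv_inj/(no_from_ter hD).
  rewrite src_new => E; case: (vpos_old E) => hj.
    by move: E; rewrite hj => /oldv_inj/(no_from_ter hD).
  by move: hj; rewrite leqNgt ltn_ord.
- move=> c; case: (cellP (Some c)) => [//|[c0 [->]]|[->]].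
    by rewrite top_old bot_old !dlabel_old; apply: cell_label hD c0.
  by rewrite top_new bot_new dlabel_old dlabel_new.
- exact: old_path (dtop_path hD).
- exact: add_dbot_path.
Qed.

End AddCell.

Section PeelMap.
Variables (Sigma : Type) (D1 D2 : plane_graph Sigma).
Variables (fe : edge D1 -> edge D2) (fc : cell D1 -> cell D2).

Definition lift_ecell (z : ecell D1) : ecell D2 :=
  (map fe z.1.1, fc z.1.2, map fe z.2).

Lemma peel_map p cs q :
  (forall c, c \in cells cs -> top (fc c) = map fe (top c) /\ bot (fc c) = map fe (bot c)) ->
  peel p cs q -> peel (map fe p) (map lift_ecell cs) (map fe q).
Proof.
elim: cs p => [|[[a c] b] cs IH] p /= h => [-> //|[-> hp]].
have [-> ->] := h c (mem_head _ _); rewrite -!map_cat; split=> //.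
by apply: IH hp => c' hc'; apply: h; rewrite inE hc' orbT.
Qed.

Lemma emv_map cs : (forall e, lab (fe e) = lab e) ->
  (forall c, c \in cells cs -> top (fc c) = map fe (top c) /\ bot (fc c) = map fe (bot c)) ->
  moves (map lift_ecell cs) = moves cs.
Proof.
move=> hl h; have dl p : dlabel (map fe p) = dlabel p.
  by rewrite /dlabel -map_comp; apply: eq_map.
elim: cs h => [|[[a c] b] cs IH] //= h; rewrite IH; last first.
  by move=> c' hc'; apply: h; rewrite inE hc' orbT.
by have [h1 h2] := h c (mem_head _ _); rewrite /emv /= h1 h2 !dl.
Qed.

End PeelMap.

Definition realizes (Sigma : Type) (D : plane_graph Sigma) (s : seq (move Sigma)) :=
  exists2 cs, peel (dtop D) cs (dbot D) & moves cs = s.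

(** Each further move glues a cell under the bottom path of the diagram built so far. The induction
    also carries a height function, because [add_diagram] asks for one. *)
Lemma exists_diagram (Sigma : Type) (P : presentation Sigma) x s y :
  x <> [::] -> deriv P x s y -> exists D : plane_graph Sigma,
  [/\ is_diagram P D, dlabel (dtop D) = x, dlabel (dbot D) = y & realizes D s].
Proof.
move=> xn hs; suff : exists D : plane_graph Sigma,
  [/\ is_diagram P D, dlabel (dtop D) = x, dlabel (dbot D) = y, realizes D s
    & exists h : vert D -> nat, forall e, h (src e) < h (tgt e)].
  by case=> D [? ? ? ? _]; exists D.
elim/last_ind: s y hs => [|s m IH] y.
  move=> <-; exists (fix_rot (path_graph x)).
  have hl : dlabel (dtop (fix_rot (path_graph x))) = x.
    exact: (map_tnth_enum (in_tuple x)).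
  split=> //; first exact: path_diagram xn.
    by exists [::].
  by exists (fun i => i : nat) => e; rewrite /= /bump.
rewrite -cats1 => /deriv_cat[z /IH[D [hD h1 h2 [cs hcs hs] [h hh]]] /= [hm Ez <-]].
have hne : dtop D <> [::] by move=> E; apply: xn; rewrite -h1 E.
move: Ez; rewrite -h2 /msrc => /esym/map_eq_cat[p1 [r [Ed Ep1 /map_eq_cat[t [p2 [Er Et Ep2]]]]]].
subst r; case: t Ed Et => [|t0 t'] Ed Et; first by have := step_nilL hm; rewrite -Et.
rewrite -Et in hm; pose A := add_cell p1 p2 t' t0 (mv m).
exists (fix_rot A).
have dl p : @dlabel _ A (map (@old_edge _ D (mv m)) p) = dlabel p by apply: dlabel_old.
have dn : @dlabel _ A (new_path D (mv m)) = mv m by apply: dlabel_new.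
split.
- exact: (add_diagram hD hne Ed hm hh).
- by rewrite -h1; apply: dl.
- change (@dlabel _ A (dbot A) = mtgt m).
  by rewrite [dbot A]/(_ ++ _) !dlabel_cat !dl dn /mtgt -Ep1 -Ep2.
- pose lc := @lift_ecell _ D A (@old_edge _ D (mv m)) (oldc p1 p2 t' t0 (mv m)).
  exists (map lc cs ++ [:: (map (@old_edge _ D (mv m)) p1, newc p1 p2 t' t0 (mv m), map (@old_edge _ D (mv m)) p2)]).
    apply/peel_cat; exists (map (@old_edge _ D (mv m)) (dbot D)).
      by apply: peel_map hcs => c _; rewrite top_old bot_old.
    rewrite /= Ed !map_cat; split; first by rewrite split_newc.
    by rewrite split_newc.
  rewrite map_cat -hs; congr (_ ++ [:: _]).
    by apply: emv_map => *; rewrite ?lab_old ?top_old ?bot_old.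
  transitivity (Move (ml m) (mu m) (mv m) (mr m)); last by case: (m).
  rewrite -[LHS]/(@emv _ A _) /emv top_new bot_new !dl dn; congr Move; [exact: Ep1 | exact: Et | exact: Ep2].
- exists (@add_height _ D p1 p2 t' t0 (mv m) h); exact: (add_height_lt hD Ed hm hh).
Qed.

(** * Concatenation *)

(** The last hypothesis covers the default value: [s'] supplies one, or else [s] exhausts [T], which
    is then empty whenever [s'] is. *)
Lemma match_seq (T T' : eqType) (s : seq T) (s' : seq T') :
  uniq s -> size s = size s' -> s' <> [::] \/ (forall x, x \in s) ->
  exists f : T -> T', map f s = s'.
Proof.
case: s' => [|y s'] hu hs h.
  move: hs => /size0nil E; case: h => // h.
  have f (x : T) : T' by have := h x; rewrite E.
  by exists f; rewrite E.
exists (fun x => nth y (y :: s') (index x s)).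
apply: (@eq_from_nth _ y); rewrite size_map // => i hi.
case: s hu hs hi {h} => // x s hu hs hi.
by rewrite (nth_map x) // index_uniq.
Qed.

Lemma uniq_map_inj (T T' : eqType) (f : T -> T') s : uniq (map f s) -> {in s &, injective f}.
Proof.
elim: s => //= x s IH /andP[hx hu] y z; rewrite !inE.
case/predU1P=> [->|hy] /predU1P[->|hz] //.
- by move=> E; move: hx; rewrite E map_f.
- by move=> E; move: hx; rewrite -E map_f.
by apply: IH.
Qed.

Lemma map_map_in (T U V W : eqType) (g : T -> U) (h : U -> V) (k : T -> W) (l : W -> V) s :
  map h (map g s) = map l (map k s) -> {in s, forall x, h (g x) = l (k x)}.
Proof. by rewrite -!map_comp => /eq_in_map. Qed.

Lemma map_flatten_inj (T T' : eqType) (f : T -> T') (ss : seq (seq T)) ss' :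
  map f (flatten ss) = flatten ss' -> shape ss = shape ss' -> map (map f) ss = ss'.
Proof.
rewrite map_flatten => h hs; apply: eq_from_flatten_shape => //.
by rewrite -hs /shape -map_comp; apply: eq_map => x; rewrite /= size_map.
Qed.

(** * Maps defined on the vertices of a diagram *)

Section VertexMap.
Variables (Sigma : Type) (P : presentation Sigma) (D : plane_graph Sigma).
Hypotheses (hD : is_diagram P D) (hne : dtop D <> [::]).

Lemma vertex_dart (x : vert D) : exists d, org d = x.
Proof.
have [->|h] := pselect (x = ini D).
  have := dtop_path hD; case: (dtop D) hne => // e p _ [he _].
  by exists (e, true).
apply: contrapT => h'; apply: h; apply/(source_unique hD) => e he.
by apply: h'; exists (e, false).
Qed.

Lemma dtop_ends : exists e e', [/\ e \in dtop D, e' \in dtop D, org (e, true) = ini D,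
  org (e', false) = ter D & forall (D' : plane_graph Sigma) (fe : edge D -> edge D'),
  is_diagram P D' -> dtop D' = map fe (dtop D) -> src (fe e) = ini D' /\ tgt (fe e') = ter D'].
Proof.
have h := dtop_path hD; case E: (dtop D) hne h => [//|e p] _ h.
exists e, (last e p); split=> //.
- exact: mem_head.
- exact: mem_last.
- by case: h.
- by have := pos_path_last h; rewrite /= last_map.
move=> D' fe d' E'; have h' := dtop_path d'; rewrite E' in h'; split; first by case: h'.
by have := pos_path_last h'; rewrite /= !last_map.
Qed.

(** A vertex is an orbit of darts under the rotation, so a map on vertices amounts to a map on darts
    that is constant on orbits. By [boundary_cycle] this can be checked along the two sides of each
    face. *)
Lemma vertex_map (T : eqType) (val : edge D * bool -> T) :
  (forall f, exists u v, vpath val u (fwd f) v /\ vpath val u (bwd f) v) ->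
  exists fv : vert D -> T, forall d, fv (org d) = val d.
Proof.
move=> h.
have hface d : val (face d) = val (flip d).
  have [f [hf _]] := faces hD d; have [u [v [h1 h2]]] := h f.
  have := boundary_cycle (bwd_nonempty hD hne (f := f)) h1 h2; rewrite -boundaryE.
  move=> /next_cycle/(_ hf)/eqP; have /eqP := next_cycle (face_cycle hD f) hf.
  by move=> ->.
have horb d d' : org d = org d' -> val d = val d'.
  move=> E; have : fconnect (@Defs.rot _ D) d d' by rewrite (rot_orbit hD) E.
  move=> /iter_findex <-; elim: (findex _ _ _) => // n {1}->; rewrite iterS.
  by have := hface (flip (iter n (@Defs.rot _ D) d)); rewrite /face flipK.
have [g hg] := boolp.choice vertex_dart.
by exists (fun x => val (g x)) => d; apply: horb; rewrite hg.
Qed.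

End VertexMap.

Lemma vpath_map (Sigma : Type) (D D' : plane_graph Sigma) (fe : edge D -> edge D')
    (val : edge D * bool -> vert D') x p y :
  (forall e b, e \in p -> val (e, b) = org (fe e, b)) ->
  pos_path x (map fe p) y -> vpath val x p y.
Proof.
elim: p x => //= e p IH x h [hx hp]; rewrite !h ?mem_head //; split=> //.
by apply: IH => // e' b he'; apply: h; rewrite inE he' orbT.
Qed.

(** * Matching two peelings with the same moves *)

Section Match.
Variables (Sigma : Type) (D D' : plane_graph Sigma).
Implicit Types (fe : edge D -> edge D').

Definition tops (E : plane_graph Sigma) (cs : seq (ecell E)) := [seq top c | c <- cells cs].
Definition botss (E : plane_graph Sigma) (cs : seq (ecell E)) := [seq bot c | c <- cells cs].

Lemma size_emv (E E' : plane_graph Sigma) (z : ecell E) (z' : ecell E') : emv z = emv z' ->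
  [/\ size z.1.1 = size z'.1.1, size (top z.1.2) = size (top z'.1.2),
      size (bot z.1.2) = size (bot z'.1.2) & size z.2 = size z'.2].
Proof.
by case=> /(congr1 size) h1 /(congr1 size) h2 /(congr1 size) h3 /(congr1 size) h4;
  rewrite !size_dlabel in h1 h2 h3 h4.
Qed.

Lemma shape_emv (E E' : plane_graph Sigma) (cs : seq (ecell E)) (cs' : seq (ecell E')) :
  moves cs = moves cs' -> shape (botss cs) = shape (botss cs').
Proof.
elim: cs cs' => [|z cs IH] [|z' cs'] //= [] h1 h2 h3 h4 /IH; rewrite /shape /= => ->.
by have [_ _ ->] := size_emv (z := z) (z' := z') (f_equal4 (@Move Sigma) h1 h2 h3 h4).
Qed.

(** The moves fix the lengths at which every cut splits. So the images of the initial path and of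
    the bottom paths determine those of all later cuts and of all top paths. *)
Lemma match_peel fe p cs q p' cs' q' : peel p cs q -> peel p' cs' q' ->
  moves cs = moves cs' -> map fe p = p' ->
  map (map fe) (botss cs) = botss cs' ->
  map fe q = q' /\ map (map fe) (tops cs) = tops cs'.
Proof.
elim: cs p p' cs' => [|z cs IH] p p' [|z' cs'] //=.
  by move=> -> ->.
case: z z' => [[a c] b] [[a' c'] b'] [Ep h] [Ep' h'] [].
rewrite /= => h1 h2 h3 h4 hm hp [hb hbs].
have [s1 s2 _ _] := size_emv (z := (a, c, b)) (z' := (a', c', b'))
  (f_equal4 (@Move Sigma) h1 h2 h3 h4).
rewrite /= in s1 s2; move: hp; rewrite Ep Ep' map_cat => /cat_size_inj[].
  by rewrite size_map.
move=> ha; rewrite map_cat => /cat_size_inj[]; first by rewrite size_map.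
move=> ht hb'; have [] := IH _ _ _ h h' hm _ hbs; first by rewrite !map_cat ha hb hb'.
by move=> -> ->; rewrite ht.
Qed.

Lemma dlabel_match fe p p' : map fe p = p' -> dlabel p = dlabel p' ->
  forall e, e \in p -> lab (fe e) = lab e.
Proof. by move=> <-; rewrite /dlabel -map_comp => /esym/eq_in_map. Qed.

Lemma emv_match fe (cs : seq (ecell D)) (cs' : seq (ecell D')) :
  moves cs = moves cs' -> map (map fe) (botss cs) = botss cs' ->
  forall e, e \in bots cs -> lab (fe e) = lab e.
Proof.
move=> h hb; apply: (@dlabel_match fe _ (bots cs')).
  by rewrite /bots map_flatten -/(botss _) hb.
rewrite /bots; elim: cs cs' h {hb} => [|z cs IH] [|z' cs'] //= [] _ _ h _ /IH.
by rewrite !dlabel_cat h => ->.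
Qed.

End Match.

Section Morphism.
Variables (Sigma : Type) (P : presentation Sigma) (D D' : plane_graph Sigma).
Hypotheses (hD : is_diagram P D) (hne : dtop D <> [::]).

Lemma morphism_vertices (fe : edge D -> edge D') :
  (forall f, exists x y, pos_path x (map fe (fwd f)) y /\ pos_path x (map fe (bwd f)) y) ->
  exists fv : vert D -> vert D', forall d, fv (org d) = org (fe d.1, d.2).
Proof.
move=> h; apply: (vertex_map hD hne) => f; have [x [y [h1 h2]]] := h f.
by exists x, y; split; [apply: (vpath_map _ h1) | apply: (vpath_map _ h2)].
Qed.

(** The paths [p'] and [q'] may be inner cuts of [D'], so that a whole diagram can be matched with a
    part of a larger one, as concatenation demands. The edge map sends one enumeration by [bots] to
    the other. *)
Lemma full_match cs p' cs' q' : peel (dtop D) cs (dbot D) -> peel p' cs' q' ->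
  moves cs = moves cs' -> dlabel (dtop D) = dlabel p' ->
  exists (fe : edge D -> edge D') (fc : cell D -> cell D'),
  [/\ map fe (dtop D) = p', map fe (dbot D) = q', map fc (cells cs) = cells cs',
      forall c, top (fc c) = map fe (top c) /\ bot (fc c) = map fe (bot c) &
      (forall e, lab (fe e) = lab e) /\ map fe (bots cs) = bots cs'].
Proof.
move=> h h' hm hl; have hu := uniq_cut_bots hD hne (reach_start hD) isT h.
have sz : size (dtop D) = size p' by rewrite -size_dlabel hl size_dlabel.
have sh := shape_emv hm.
have [|fe hfe] := match_seq (s' := p' ++ bots cs') hu _ (or_intror (fun e => all_edges hD hne e h)).
  by rewrite !size_cat sz /bots !size_flatten -/(botss _) -/(botss _) sh.
move: (hfe); rewrite map_cat => /cat_size_inj[]; first by rewrite size_map.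
move=> h1 h2.
have h3 : map (map fe) (botss cs) = botss cs' by apply: map_flatten_inj.
have [h4 h5] := match_peel h h' hm h1 h3.
have [uc allc] := peel_cells hD hne h.
have [|fc hfc] := match_seq (s' := cells cs') uc _ (or_intror allc).
  by rewrite !size_map -(size_map (@emv _ D)) hm size_map.
exists fe, fc; split=> //.
  move=> c; have hc := allc c.
  rewrite /tops -hfc in h5; rewrite /botss -hfc in h3.
  by rewrite (map_map_in h5 hc) (map_map_in h3 hc).
split=> // e; have := all_edges hD hne e h; rewrite mem_cat => /orP[].
  exact: dlabel_match h1 hl e.
exact: emv_match hm h3 e.
Qed.

End Morphism.

(** * Derivations realized by a diagram *)

Section Realizes.
Variables (Sigma : Type) (P : presentation Sigma).
Implicit Types (D : diagram P) (s : seq (move Sigma)).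

Lemma concat_realizes D1 D2 D s1 s2 : concat D1 D2 D ->
  realizes D1 s1 -> realizes D2 s2 -> realizes D (s1 ++ s2).
Proof.
case=> v1 [f1 [c1 [v2 [f2 [c2 [[m1 m2 _ _] [_ E _] _ [hc1 hc2] [Et Eb]]]]]]].
case=> cs1 h1 <- [cs2 h2 <-].
exists (map (lift_ecell f1 c1) cs1 ++ map (lift_ecell f2 c2) cs2).
  apply/peel_cat; exists (map f1 (dbot D1)).
    by rewrite Et; apply: peel_map h1 => c _; apply: hc1.
  by rewrite Eb E; apply: peel_map h2 => c _; apply: hc2.
rewrite map_cat; congr (_ ++ _); apply: emv_map => [e|c _].
- by have [] := m1 e isT.
- exact: hc1.
- by have [] := m2 e isT.
- exact: hc2.
Qed.

Lemma iso_realizes D D' s : diag_iso D D' -> realizes D s -> realizes D' s.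
Proof.
case=> fv [fe [fc [_ m _ hc [_ _ Et Eb]]]] [cs h <-].
exists (map (lift_ecell fe fc) cs).
  by rewrite Et Eb; apply: peel_map h => c _; apply: hc.
by apply: emv_map => // e; have [] := m e isT.
Qed.

Lemma realizes_deriv D s : realizes D s -> deriv P (dlabel (dtop D)) s (dlabel (dbot D)).
Proof. by case=> cs h <-; apply: peel_deriv (diagramP D) _ _ _ h. Qed.

Lemma realizes_comm D s s' : dtop D <> [::] -> realizes D s -> realizes D s' -> comm s s'.
Proof.
move=> hne [cs h <-] [cs' h' <-].
exact: (peel_comm (diagramP D) hne (reach_start (diagramP D)) isT h h').
Qed.

Lemma comm_realizes D s s' : comm s s' -> realizes D s -> realizes D s'.
Proof.
move=> hc [cs h E]; rewrite -E in hc.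
by have [cs' h' E'] := peel_swap h hc; exists cs'.
Qed.

Lemma realizes_ex D : dtop D <> [::] -> exists s, realizes D s.
Proof.
move=> hne; have [cs h] := reach_complete (diagramP D) hne (reach_start (diagramP D)) isT.
by exists (moves cs), cs.
Qed.

Lemma realizes_size D s : dtop D <> [::] -> realizes D s -> size s = ncell D.
Proof. by move=> hne [cs h <-]; rewrite size_map; apply: peel_ncell (diagramP D) hne _ h. Qed.

(** The two parts of the peeling of [D] are copies of [D1] and [D2], and they meet in the cut [r]
    between them. *)
Lemma concat_exists D1 D2 D s1 s2 : dtop D1 <> [::] -> dtop D2 <> [::] -> dtop D <> [::] ->
  dlabel (dtop D1) = dlabel (dtop D) -> dlabel (dbot D1) = dlabel (dtop D2) ->
  realizes D1 s1 -> realizes D2 s2 -> realizes D (s1 ++ s2) -> concat D1 D2 D.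
Proof.
move=> n1 n2 n l1 l2 [cs1 h1 E1] [cs2 h2 E2] [cs h E].
have d1 := diagramP D1; have d2 := diagramP D2; have dD := diagramP D.
have [cs1' [cs2' [Ecs E1' E2']]] := map_eq_cat E; subst cs.
have [r h1' h2'] := (peel_cat _ _ _ _).1 h.
have hm1 : moves cs1 = moves cs1' by rewrite E1 E1'.
have hm2 : moves cs2 = moves cs2' by rewrite E2 E2'.
have [f1 [c1 [Et1 Er1 Ec1 hc1 [hl1 Eb1]]]] := full_match d1 n1 h1 h1' hm1 l1.
have lr : dlabel (dtop D2) = dlabel r.
  rewrite -l2; apply: deriv_fun (peel_deriv d1 h1) _.
  by rewrite E1 -E1' l1; apply: peel_deriv dD _ _ _ h1'.
have [f2 [c2 [Et2 Er2 Ec2 hc2 [hl2 Eb2]]]] := full_match d2 n2 h2 h2' hm2 lr.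
have [hr] := peel_reach dD n (reach_start dD) isT h1'.
set U := catrev _ _ in hr * => hU; have [hrp hrm hrd] := hr.
have uE c : (c \in U) = (c \in cells cs1') by rewrite /U catrevE cats0 mem_rev.
have [ucs allcs] := peel_cells dD n h.
have ucs' : uniq (cells cs1' ++ cells cs2') by rewrite -map_cat.
have allE := all_edges dD n (cs := cs1' ++ cs2').
have u1 : uniq (map f1 (dtop D1 ++ bots cs1)).
  have := uniq_cut_bots dD n (reach_start dD) isT h.
  by rewrite /bots /cells !map_cat flatten_cat catA cat_uniq Et1 Eb1 => /andP[].
have u2 : uniq (map f2 (dtop D2 ++ bots cs2)).
  by rewrite map_cat Et2 Eb2; exact (uniq_cut_bots dD n hr hU h2').
have i1 : injective f1.
  by move=> e e'; apply: (uniq_map_inj u1); apply: (all_edges d1 n1 _ h1).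
have i2 : injective f2.
  by move=> e e'; apply: (uniq_map_inj u2); apply: (all_edges d2 n2 _ h2).
have [v1 hv1] : exists v1 : vert D1 -> vert D, forall d, v1 (org d) = org (f1 d.1, d.2).
  apply: (morphism_vertices d1 n1) => -[c|] /=.
    by have [<- <-] := hc1 c; apply: (face_paths dD n (Some (c1 c))).
  exists (ini D), (ter D); rewrite Et1 Er1; split=> //.
  exact: dtop_path dD.
have [v2 hv2] : exists v2 : vert D2 -> vert D, forall d, v2 (org d) = org (f2 d.1, d.2).
  apply: (morphism_vertices d2 n2) => -[c|] /=.
    by have [<- <-] := hc2 c; apply: (face_paths dD n (Some (c2 c))).
  exists (ini D), (ter D); rewrite Et2 Er2; split=> //.
  exact: dbot_path dD.
exists v1, f1, c1, v2, f2, c2; split.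
- split=> // e _; split=> //.
  + by have := hv1 (e, true).
  + by have := hv1 (e, false).
  + by have := hv2 (e, true).
  + by have := hv2 (e, false).
- split; last 2 first.
  + by rewrite Er1 Et2.
  + move=> e1 e2 ee.
    (* As an edge of the first copy a common edge is not below [r], and as an edge of the second it
       is not above; so it is on [r]. *)
    have up1 : up U (above (f1 e1)).
      have : f1 e1 \in map f1 (dtop D1 ++ bots cs1).
        by rewrite map_f // (all_edges d1 n1 _ h1).
      rewrite map_cat Et1 Eb1 mem_cat (mem_dtop dD) (mem_bots dD).
      by case: (above _) => //= c; rewrite uE.
    have er : f1 e1 \in r.
      have : f2 e2 \in map f2 (dtop D2 ++ bots cs2).
        by rewrite map_f // (all_edges d2 n2 _ h2).
      rewrite map_cat Et2 Eb2 mem_cat -ee => /orP[//|].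
      rewrite (mem_bots dD); move: up1; case: (above _) => //= c; rewrite uE => hc hc'.
      by move: ucs'; rewrite cat_uniq => /and3P[_ /hasPn/(_ c hc')]; rewrite /= hc.
    split; first by rewrite -Er1 (mem_map i1) in er.
    by rewrite ee -Et2 (mem_map i2) in er.
  + move=> e; have := allE e h; rewrite /bots /cells !map_cat flatten_cat catA mem_cat.
    case/orP; first by rewrite -Et1 -[flatten _]Eb1 -map_cat => /mapP[e1 _ ->]; left; exists e1.
    by rewrite -[flatten _]Eb2 => /mapP[e2 _ ->]; right; exists e2.
- have [uc1 ac1] := peel_cells d1 n1 h1; have [uc2 ac2] := peel_cells d2 n2 h2.
  have ic1 c : c1 c \in cells cs1' by rewrite -Ec1 map_f.
  have ic2 c : c2 c \in cells cs2' by rewrite -Ec2 map_f.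
  move: ucs'; rewrite cat_uniq => /and3P[uc1' /hasPn dis uc2'].
  apply: inj_card_bij; last first.
    rewrite card_sum !card_ord -(peel_ncell dD n h) -(peel_ncell d1 n1 h1) -(peel_ncell d2 n2 h2).
    by rewrite size_cat -(size_map (@emv _ D1)) -(size_map (@emv _ D2)) E1 E2 -E1' -E2' !size_map.
  move=> [a|a] [b|b] ee.
  + by congr inl; apply: (uniq_map_inj (f := c1) (s := cells cs1)) => //; rewrite Ec1.
  + by have := dis _ (ic2 b); rewrite /= -ee ic1.
  + by have := dis _ (ic2 a); rewrite /= ee ic1.
  + by congr inr; apply: (uniq_map_inj (f := c2) (s := cells cs2)) => //; rewrite Ec2.
- by [].
- by rewrite Et1 Er2.
Qed.

Lemma full_match_inj D D' cs cs' : dtop D <> [::] -> dtop D' <> [::] ->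
  peel (dtop D) cs (dbot D) -> peel (dtop D') cs' (dbot D') ->
  moves cs = moves cs' -> dlabel (dtop D) = dlabel (dtop D') ->
  exists (fe : edge D -> edge D') (fc : cell D -> cell D'),
  [/\ injective fe, injective fc, map fe (dtop D) = dtop D' /\ map fe (dbot D) = dbot D',
      forall c, top (fc c) = map fe (top c) /\ bot (fc c) = map fe (bot c) &
      forall e, lab (fe e) = lab e].
Proof.
move=> n n' h h' hm hl; have d := diagramP D; have d' := diagramP D'.
have [fe [fc [Et Eb Ec hc [hlab Ebs]]]] := full_match d n h h' hm hl.
exists fe, fc; split=> //.
- have u : uniq (map fe (dtop D ++ bots cs)).
    rewrite map_cat Et Ebs; exact (uniq_cut_bots d' n' (reach_start d') isT h').
  by move=> e1 e2; apply: (uniq_map_inj u); apply: (all_edges d n _ h).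
have [uc' _] := peel_cells d' n' h'; have [_ ac] := peel_cells d n h.
by move=> c1 c2; apply: (uniq_map_inj (f := fc) (s := cells cs)) => //; rewrite Ec.
Qed.

(** The matching of edges and cells preserves boundaries, hence [face], hence the rotation. Vertices
    being orbits of the rotation, the induced map on vertices is well defined and injective. *)
Lemma realizes_iso D D' s : dtop D <> [::] -> dlabel (dtop D) = dlabel (dtop D') ->
  realizes D s -> realizes D' s -> diag_iso D D'.
Proof.
move=> n hl [cs h E] [cs' h' E']; have d := diagramP D; have d' := diagramP D'.
have n' : dtop D' <> [::].
  by move=> E0; apply: n; apply/size0nil; rewrite -size_dlabel hl E0.
have hm : moves cs = moves cs' by rewrite E E'.
have [fe [fc [ie ic [Et Eb] hc hlab]]] := full_match_inj n n' h h' hm hl.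
have [ge [gc [ie' ic' _ _ _]]] := full_match_inj n' n h' h (esym hm) (esym hl).
have lee := leq_card _ ie; have lee' := leq_card _ ie'.
have lec := leq_card _ ic; have lec' := leq_card _ ic'.
have [fv hv] : exists fv : vert D -> vert D', forall x, fv (org x) = org (fe x.1, x.2).
  apply: (morphism_vertices d n) => -[c|] /=.
    by have [<- <-] := hc c; apply: (face_paths d' n' (Some (fc c))).
  by exists (ini D'), (ter D'); rewrite Et Eb; split; [apply: dbot_path d' | apply: dtop_path d'].
have hrot (x : edge D * bool) : Defs.rot (fe x.1, x.2) = (fe (Defs.rot x).1, (Defs.rot x).2).
  have [f [hf _]] := faces d (flip x).
  pose g (y : edge D * bool) := (fe y.1, y.2); pose f' := omap fc f.
  have ig : injective g by move=> [e b] [e2 b2] [/ie -> ->].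
  have Ef : boundary f' = map g (boundary f).
    rewrite !boundaryE map_cat /forth /back map_rev -!map_comp.
    case: (f) @f' => [c|] /=; first by have [-> ->] := hc c; rewrite -!map_comp.
    by rewrite -Et -Eb -!map_comp.
  have hf' : g (flip x) \in boundary f' by rewrite Ef map_f.
  have /eqP := next_cycle (face_cycle d' f') hf'; rewrite Ef next_map ?(face_uniq d) //.
  have /eqP <- := next_cycle (face_cycle d f) hf.
  by rewrite /face flipK /g /flip /= negbK; case: (x).
have iv : injective fv.
  have hiter k (x : edge D * bool) : iter k (@Defs.rot _ D') (fe x.1, x.2) =
      (fe (iter k (@Defs.rot _ D) x).1, (iter k (@Defs.rot _ D) x).2).
    by elim: k => //= k ->; rewrite hrot.
  move=> x y; have [dx <-] := vertex_dart d n x; have [dy <-] := vertex_dart d n y.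
  rewrite !hv => Exy; have : fconnect (@Defs.rot _ D') (fe dx.1, dx.2) (fe dy.1, dy.2).
    by rewrite (rot_orbit d') Exy.
  move=> /iter_findex; rewrite hiter; set k := findex _ _ _ => -[/ie h1 h2].
  have <- : iter k (@Defs.rot _ D) dx = dy.
    by rewrite [LHS]surjective_pairing h1 h2 -surjective_pairing.
  by apply/eqP; rewrite -(rot_orbit d) fconnect_iter.
exists fv, fe, fc; split.
(* Injections in both directions equate the numbers of edges and of cells; Euler's formula then
   equates the numbers of vertices. *)
- split; apply: inj_card_bij => //.
  by move: lee lee' lec lec' (euler d) (euler d'); rewrite !card_ord; lia.
- move=> e _; split=> //; first by have := hv (e, true).
  by have := hv (e, false).
- exact: hrot.
- exact: hc.
have [e [e2 [_ _ h1 h2 /(_ D' fe d' (esym Et)) [h3 h4]]]] := dtop_ends d n.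
by rewrite -h1 -h2 !hv /org /= h3 h4.
Qed.

End Realizes.

(** * Reduction *)

(** Designed for the common path of a dipole, which has to be collapsed onto the place of another
    path of possibly different length: everything stays at [u] until the last edge jumps to [v]. *)
Lemma vpath_const (Sigma : Type) (D : plane_graph Sigma) (T : eqType)
    (val : edge D * bool -> T) u v e0 p : p <> [::] -> uniq p ->
  (forall e, e \in p -> val (e, true) = u) ->
  (forall e, e \in p -> val (e, false) = if e == last e0 p then v else u) ->
  vpath val u p v.
Proof.
elim: p e0 => // e [|e' p] IH e0 _ hu ht hf.
  by rewrite /= ht ?mem_head // hf ?mem_head //= eqxx.
have [hn hu'] := andP hu; split; first by rewrite ht ?mem_head.
rewrite hf ?mem_head //; case: eqP => [E|_].
  by move: hn; rewrite E /= mem_last.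
by apply: (IH e) => // x hx; [apply: ht | apply: hf]; rewrite inE hx orbT.
Qed.

Lemma map3_in (T U V W : eqType) (k : T -> U) (g : U -> V) (h : V -> W) (l : T -> W) s :
  map h (map g (map k s)) = map l s -> {in s, forall x, h (g (k x)) = l x}.
Proof. by rewrite -!map_comp => /eq_in_map. Qed.

Section Reduction.
Variables (Sigma : Type) (P : presentation Sigma).
Implicit Types (D : diagram P) (s : seq (move Sigma)).

(* The part of the data in [reduction] that is needed to compare decompositions
   of [D] and [D']. *)
Definition dipole_map D D' (c1 c2 : cell D) (fe : edge D -> edge D') (fc : cell D' -> cell D) :=
  [/\ forall e, e \notin top c1 -> lab (fe e) = lab e,
      map fe (top c2) = map fe (bot c1),
      forall c, c <> c1 -> c <> c2 -> exists c', fc c' = c,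
      forall c, top c = map fe (top (fc c)) /\ bot c = map fe (bot (fc c)) &
      dtop D' = map fe (dtop D) /\ dbot D' = map fe (dbot D)].

Lemma reduction_dipole_map D D' : reduction D D' ->
  exists c1 c2 : cell D, dipole c1 c2 /\ exists fe fc, @dipole_map D D' c1 c2 fe fc.
Proof.
case=> c1 [c2 [hd [fv [fe [fc [[hm _ _] [_ h1 _] [_ h2] h3 h4]]]]]].
exists c1, c2; split=> //; exists fe, fc; split=> //.
- by move=> e he; have [] := hm e he.
- by move=> c n1 n2; apply/h2.
Qed.

(** The last hypothesis says that the cut does not pass between the two cells: the upper cell [c2]
    is still to come, or the lower cell [c1] is already gone. So the cut avoids [top c1], where [fe]
    is arbitrary. *)
Lemma dipole_peel D D' (c1 c2 : cell D) fe fc U p cs q :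
  dtop D <> [::] -> @dipole_map D D' c1 c2 fe fc ->
  top c1 = bot c2 -> reach U p -> peel p cs q ->
  c1 \notin cells cs -> c2 \notin cells cs -> (c2 \notin U) || (c1 \in U) ->
  exists cs', peel (map fe p) cs' (map fe q) /\ moves cs' = moves cs.
Proof.
move=> n [hl _ hfc hc _] E12; have d := diagramP D.
elim: cs U p => [|[[a c] b] cs IH] U p /=; first by move=> _ ->; exists [::].
move=> hp [Ep hq]; rewrite !inE !negb_or => /andP[n1 n1'] /andP[n2 n2'] hU.
have [_ hm _] := hp; rewrite Ep in hp; have [cU hp'] := reach_step d n hp.
have [|cs' [h1 h2]] := IH (c :: U) _ hp' hq n1' n2' _.
  by rewrite !inE (negPf n2); case/orP: hU => ->; rewrite ?orbT.
have [c' Ec] := hfc c (fun E => negP n1 (introT eqP (esym E))) (fun E => negP n2 (introT eqP (esym E))).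
have [ht hb] := hc c'; rewrite Ec in ht hb.
have avoid e : e \in p -> e \notin top c1.
  rewrite hm => /andP[hu hd]; apply/negP => he; move: hu hd.
  have := he; rewrite (mem_top d) => /eqP ->.
  move: he; rewrite E12 (mem_bot d) => /eqP -> /=.
  by case/orP: hU => [/negPf -> | ->].
have dl t : {subset t <= p} -> dlabel (map fe t) = dlabel t.
  move=> hs; rewrite /dlabel -map_comp; apply/eq_in_map => e /hs/avoid; exact: hl.
exists ((map fe a, c', map fe b) :: cs'); split.
  by rewrite /= Ep !map_cat ht hb -!map_cat.
have sub t : t = a \/ t = top c \/ t = b -> {subset t <= p}.
  by move=> ht' e he; rewrite Ep !mem_cat; case: ht' => [|[]] <-; rewrite he ?orbT.
rewrite /= h2 /emv /= ht hb (dl a) ?(dl (top c)) ?(dl b); try by apply: sub; tauto.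
congr (Move _ _ _ _ :: _); rewrite /dlabel -map_comp; apply/eq_in_map => e he; apply: hl.
rewrite E12 (mem_bot d); move: he; rewrite (mem_bot d) => /eqP ->.
by apply: contra n2 => /eqP[->].
Qed.

Lemma dipole_map_realizes D D' (c1 c2 : cell D) fe fc a b cs1 cs2 :
  dtop D <> [::] -> @dipole_map D D' c1 c2 fe fc -> top c1 = bot c2 ->
  peel (dtop D) (cs1 ++ (a, c2, b) :: (a, c1, b) :: cs2) (dbot D) ->
  realizes D' (moves cs1 ++ moves cs2).
Proof.
move=> n hm E12 h; have d := diagramP D; have [hu _] := peel_cells d n h.
have [r h1 /= [Er [_ h2]]] := (peel_cat _ _ _ _).1 h.
have [hr hU] := peel_reach d n (reach_start d) isT h1.
rewrite /cells map_cat cat_uniq /= inE !negb_or in hu.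
case/and3P: hu => u1 /and3P[n2 n1 _] /and3P[/andP[n12 n2'] n1' u2].
have [cs1' [h1' e1]] := dipole_peel n hm E12 (reach_start d) h1 n1 n2 isT.
rewrite Er in hr; have [c2U hr2] := reach_step d n hr.
rewrite -E12 in hr2; have [c1U hr1] := reach_step d n hr2.
have [|cs2' [h2' e2]] := dipole_peel n hm E12 hr1 h2 n1' n2' _.
  by rewrite mem_head orbT.
have [_ hE _ _ [Et Eb]] := hm; exists (cs1' ++ cs2'); last by rewrite map_cat e1 e2.
apply/peel_cat; exists (map fe r); first by rewrite Et.
by rewrite Eb Er !map_cat hE -!map_cat.
Qed.

(** The upper cell [c2] comes first in the peeling. [L] enumerates the edges outside [top c1]; it is
    sent to [L'], in which the segment [m'] of the cut [r'] is listed a second time for [bot c1]. So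
    [top c2] and [bot c1] both map to [m'], as the reduction of the dipole prescribes. *)
Lemma reduction_match D D' (c1 c2 : cell D) a b cs1 cs2 : dtop D <> [::] ->
  dlabel (dtop D) = dlabel (dtop D') -> dipole c1 c2 ->
  peel (dtop D) (cs1 ++ (a, c2, b) :: (a, c1, b) :: cs2) (dbot D) ->
  realizes D' (moves cs1 ++ moves cs2) ->
  reduction D D' /\ exists fe fc, @dipole_map D D' c1 c2 fe fc.
Proof.
move=> n hl [E12 lb] h [cs' h' E']; have d := diagramP D; have d' := diagramP D'.
have n' : dtop D' <> [::].
  by move=> E0; apply: n; apply/size0nil; rewrite -size_dlabel hl E0.
have [cs1' [cs2' [Ecs e1 e2]]] := map_eq_cat E'; subst cs'.
have [hu ac] := peel_cells d n h; have [hu' ac'] := peel_cells d' n' h'.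
have hE := uniq_cut_bots d n (reach_start d) isT h.
have hE' := uniq_cut_bots d' n' (reach_start d') isT h'.
have [r h1 /= [Er [_ h2]]] := (peel_cat _ _ _ _).1 h.
have [r' h1' h2'] := (peel_cat _ _ _ _).1 h'.
have lr : dlabel r = dlabel r'.
  apply: deriv_fun (peel_deriv d h1) _; rewrite -e1 hl; exact: peel_deriv d' _ _ _ h1'.
have sr : size r = size r' by rewrite -size_dlabel lr size_dlabel.
pose m' := take (size (top c2)) (drop (size a) r').
have sm : size (bot c1) = size m'.
  rewrite -size_dlabel lb size_dlabel size_take size_drop -sr Er !size_cat addKn.
  by case: ltnP => // h0; apply/eqP; rewrite eqn_leq h0 leq_addr.
pose L := dtop D ++ bots cs1 ++ bot c1 ++ bots cs2.
pose L' := dtop D' ++ bots cs1' ++ m' ++ bots cs2'.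
have botsE : bots (cs1 ++ (a, c2, b) :: (a, c1, b) :: cs2) =
    bots cs1 ++ bot c2 ++ bot c1 ++ bots cs2.
  by rewrite /bots /cells map_cat /= map_cat flatten_cat.
have botsE' : bots (cs1' ++ cs2') = bots cs1' ++ bots cs2'.
  by rewrite /bots /cells !map_cat flatten_cat.
rewrite botsE in hE; rewrite botsE' in hE'.
have uL : uniq L.
  apply: subseq_uniq hE; do 2! [apply: cat_subseq => //].
  by apply: suffix_subseq.
have cE c : (c \in cells cs1) || (c \in cells cs2) = (c != c1) && (c != c2).
  have := ac c; move: hu; rewrite /cells map_cat cat_uniq mem_cat /= !inE !negb_or.
  case/and3P=> _ /and3P[n2 n1 _] /and3P[/andP[n12 n2'] n1' _].
  case: (eqVneq c c1) => [->|_]; first by rewrite (negPf n1) (negPf n1').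
  by case: (eqVneq c c2) => [->|_]; first by rewrite (negPf n2) (negPf n2').
have n12 : c2 != c1.
  move: hu; rewrite /cells map_cat cat_uniq /= !inE !negb_or.
  by case/and3P=> _ _ /and3P[/andP[]].
have memA e : (e \in dtop D) || (e \in bots cs1) || (e \in bots cs2) =
    (e \notin bot c1) && (e \notin bot c2).
  rewrite (mem_dtop d) !(mem_bots d) !(mem_bot d); case: (above e) => [c|] //=.
have memL e : (e \in L) = (e \notin top c1).
  have ex : ~~ ((e \in bot c1) && (e \in bot c2)).
    apply/negP => /andP[]; rewrite !(mem_bot d) => /eqP -> /eqP[E].
    by rewrite E eqxx in n12.
  rewrite E12 /L !mem_cat; move: (memA e) ex.
  move: (e \in _) (e \in _) (e \in _) (e \in _) (e \in _).
  by do 5!case.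
have sz1 : size (dtop D) = size (dtop D') by rewrite -size_dlabel hl size_dlabel.
have sh1 := shape_emv (esym e1); have sh2 := shape_emv (esym e2).
have sb1 : size (bots cs1) = size (bots cs1').
  by rewrite /bots !size_flatten -/(botss _) -/(botss _) sh1.
have sb2 : size (bots cs2) = size (bots cs2').
  by rewrite /bots !size_flatten -/(botss _) -/(botss _) sh2.
have [||fe hfe] := match_seq (s' := L') uL.
- by rewrite !size_cat sz1 sb1 sb2 sm.
- by left; rewrite /L'; case: (dtop D') n'.
move: (hfe); rewrite !map_cat => /cat_size_inj[]; first by rewrite size_map.
move=> ht /cat_size_inj[]; first by rewrite size_map.
move=> hb1 /cat_size_inj[]; first by rewrite size_map.
move=> hm hb2.
have hbs1 : map (map fe) (botss cs1) = botss cs1' by apply: map_flatten_inj.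
have hbs2 : map (map fe) (botss cs2) = botss cs2' by apply: map_flatten_inj.
have [hr ht1] := match_peel h1 h1' (esym e1) ht hbs1.
have hm' : map fe (top c2) = m'.
  by rewrite /m' -hr -map_drop -map_take Er drop_size_cat // take_size_cat.
have hr2 : map fe (a ++ bot c1 ++ b) = r'.
  by rewrite !map_cat hm -hm' -!map_cat -Er.
have [hdb ht2] := match_peel h2 h2' (esym e2) hr2 hbs2.
have [fc hfc] : exists fc : cell D' -> cell D, map fc (cells (cs1' ++ cs2')) = cells (cs1 ++ cs2).
  apply: match_seq => //; last by right.
  by rewrite !size_map !size_cat -(size_map (@emv _ D')) -[size cs2'](size_map (@emv _ D')) e1 e2 !size_map.
have hc c : top c = map fe (top (fc c)) /\ bot c = map fe (bot (fc c)).
  have hc := ac' c; split; apply/esym; apply: (map3_in _ hc);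
    rewrite hfc /cells !map_cat -!/(cells _) /=.
    by rewrite -!/(tops _) ht1 ht2.
  by rewrite -!/(botss _) hbs1 hbs2.
have hlr : forall e, e \in r -> lab (fe e) = lab e by apply: dlabel_match hr lr.
have hlt : forall e, e \in bot c1 -> lab (fe e) = lab e.
  apply: dlabel_match hm _; rewrite lb -hm' /dlabel -map_comp.
  by apply/esym/eq_in_map => e he; apply: hlr; rewrite Er !mem_cat he orbT.
have hlab e : e \notin top c1 -> lab (fe e) = lab e.
  rewrite -memL /L !mem_cat => /or4P[].
  - exact: dlabel_match ht hl e.
  - exact: emv_match (esym e1) hbs1 e.
  - exact: hlt.
  - exact: emv_match (esym e2) hbs2 e.
have hmap : dipole_map c1 c2 fe fc.
  split=> //; last 2 first.
  - by rewrite hm' hm.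
  - move=> c m1 m2; have : c \in map fc (cells (cs1' ++ cs2')).
      rewrite hfc /cells map_cat mem_cat -!/(cells _) cE.
      by move/eqP: m1 => ->; move/eqP: m2 => ->.
    by case/mapP=> c' _ ->; exists c'.
split; last by exists fe, fc.
have u2 : uniq (map fe (dtop D ++ bots cs1 ++ bots cs2)).
  by rewrite !map_cat ht hb1 hb2.
have fe_inj e e' : e \notin bot c1 -> e \notin top c1 -> e' \notin bot c1 ->
    e' \notin top c1 -> fe e = fe e' -> e = e'.
  by move=> h3 h4 h5 h6; apply: (uniq_map_inj u2); rewrite !mem_cat orbA memA -E12 ?h3 ?h5 ?h4 ?h6.
have hbot1 e : e \in bot c1 -> e \notin top c1.
  by rewrite E12 !(mem_bot d) => /eqP ->; apply: contra n12 => /eqP[->].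
have [hreach hU] := peel_reach d n (reach_start d) isT h1.
have htop2 e : e \in top c2 -> e \notin top c1 /\ e \notin bot c1.
  move=> he; split; first by move: he; rewrite !(mem_top d) => /eqP ->; apply: contra n12 => /eqP[->].
  have er : e \in r by rewrite Er !mem_cat he orbT.
  have [_ hm2 _] := hreach; move: er; rewrite hm2 (mem_bot d) => /andP[hup _].
  apply/negP => /eqP ea; move: hup; rewrite ea /= catrevE cats0 mem_rev.
  by have := cE c1; rewrite eqxx /= => /negbT/norP[/negPf ->].
have dtopn e : e \in dtop D -> e \notin top c1.
  by rewrite E12 (mem_bot d) (mem_dtop d) => /eqP ->.
have dbotn e : e \in dbot D -> e \notin top c1.
  by rewrite (mem_top d) (mem_dbot d) => /eqP ->.
have uc1 : uniq (map fe (bot c1)).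
  rewrite hm -hm' map_inj_in_uniq ?(uniq_fwd d (Some c2)) // => e e' /htop2[h3 h4] /htop2[h5 h6].
  exact: fe_inj.
have [x [y hxy]] : exists x y, pos_path x m' y.
  have [hr' _] := peel_reach d' n' (reach_start d') isT h1'; have [hp _ _] := hr'.
  move: hp; rewrite -hr Er !map_cat => /pos_path_cat[x _ /pos_path_cat[y hp _]].
  by exists x, y; rewrite -hm'.
have [e0 he0] : exists e0, e0 \in top c1.
  by case: (top c1) (top_nonempty d (c := c1)) => // e0 p _; exists e0; rewrite mem_head.
(* On the vanishing path [top c1] all vertices but the last go to [x], the last one to [y]. *)
pose val (f : edge D * bool) : vert D' := if f.1 \in top c1 then
    (if ~~ f.2 && (f.1 == last e0 (top c1)) then y else x) else org (fe f.1, f.2).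
have valE p u v : {in p, forall e, e \notin top c1} -> pos_path u (map fe p) v -> vpath val u p v.
  by move=> hp; apply: vpath_map => e b0 /hp; rewrite /val /= => /negPf ->.
have val1 : vpath val x (top c1) y.
  apply: (vpath_const (e0 := e0)) => [|| e he | e he]; rewrite /val /= ?he //.
  - exact: (top_nonempty d).
  - exact: uniq_fwd d (Some c1).
have [fv hv] : exists fv : vert D -> vert D', forall f, fv (org f) = val f.
  apply: (vertex_map d n) => -[c|] /=; last first.
    exists (ini D'), (ter D'); split; apply: valE => //.
      by rewrite hdb; apply: dbot_path d'.
    by rewrite ht; apply: dtop_path d'.
  have [->|m1] := eqVneq c c1.
    by exists x, y; split=> //; apply: valE => [e /hbot1|] //; rewrite hm.
  have [->|m2] := eqVneq c c2.
    exists x, y; split; last by rewrite -E12.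
    by apply: valE => [e /htop2[]|] //; rewrite hm'.
  have [_ _ hfc2 _ _] := hmap; have [c' Ec] := hfc2 c (elimN eqP m1) (elimN eqP m2).
  have [hc1 hc2] := hc c'; rewrite Ec in hc1 hc2.
  have [u [v [h3 h4]]] := face_paths d' n' (Some c'); rewrite /fwd /bwd hc1 hc2 in h3 h4.
  exists u, v; split; apply: valE => // e.
    by rewrite !(mem_top d) => /eqP ->; apply: contra m1 => /eqP[->].
  by rewrite E12 !(mem_bot d) => /eqP ->; apply: contra m2 => /eqP[->].
have hv2 f : f.1 \notin top c1 -> fv (org f) = org (fe f.1, f.2).
  by rewrite hv /val => /negPf ->.
exists c1, c2; split; first by split.
have [_ _ hfc2 _ _] := hmap.
exists fv, fe, fc; split.
- split.
  + move=> e he; split; last exact: hlab.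
      by have := hv2 (e, true) he.
    by have := hv2 (e, false) he.
  + have [e [_ [he _ <- _ /(_ D' fe d' (esym ht)) [h3 _]]]] := dtop_ends d n.
    by rewrite hv2 ?dtopn.
  + have [_ [e [_ he _ <- /(_ D' fe d' (esym ht)) [_ h3]]]] := dtop_ends d n.
    by rewrite hv2 ?dtopn.
- split.
  + move=> e'; have : e' \in map fe L.
      rewrite hfe /L' !mem_cat; have := all_edges d' n' e' h'; rewrite botsE' !mem_cat.
      by case/or3P=> ->; rewrite ?orbT.
    by case/mapP=> e; rewrite memL => he ->; exists e.
  + by rewrite hm' hm.
  + move=> f1 f2 m1 m2 E.
    (* [fe] is injective off [bot c1] and [top c1], so an edge there identified with one of [bot c1]
       is the edge of [top c2] facing it. *)
    have col u v : u \in bot c1 -> v \notin bot c1 -> v \notin top c1 -> fe u = fe v ->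
        (v, u) \in zip (top c2) (bot c1).
      move=> hu1 hv1 hv3 E1; have szz : size (top c2) = size (bot c1).
        by rewrite -size_dlabel -lb size_dlabel.
      have ui : index u (bot c1) < size (bot c1) by rewrite index_mem.
      have Ev : v = nth u (top c2) (index u (bot c1)).
        have hin : nth u (top c2) (index u (bot c1)) \in top c2 by rewrite mem_nth // szz.
        have [h3 h4] := htop2 _ hin; apply: fe_inj => //.
        by rewrite -E1 -(nth_map _ (fe u)) ?szz // hm' -hm (nth_map u) // nth_index.
      have -> : (v, u) = nth (u, u) (zip (top c2) (bot c1)) (index u (bot c1)).
        by rewrite nth_zip // -Ev nth_index.
      by rewrite mem_nth // size_zip szz minnn.
    case: (boolP (f1 \in bot c1)) => b1; case: (boolP (f2 \in bot c1)) => b2.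
    * by apply: Or31; apply: (uniq_map_inj uc1).
    * by apply: Or33; apply: col.
    * by apply: Or32; apply: col.
    * by apply: Or31; apply: fe_inj.
- split.
  + move=> c c'; apply: (uniq_map_inj (f := fc) (s := cells (cs1' ++ cs2'))); last 2 first.
    * exact: ac'.
    * exact: ac'.
    rewrite hfc; apply: subseq_uniq hu; rewrite /cells !map_cat; apply: cat_subseq => //.
    exact: (suffix_subseq [:: c2; c1]).
  + move=> c; split=> [[c' <-]|[]]; last exact: hfc2.
    have : fc c' \in map fc (cells (cs1' ++ cs2')) by rewrite map_f.
    rewrite hfc /cells map_cat mem_cat -!/(cells _) cE => /andP[/eqP ? /eqP ?].
    by split.
- exact: hc.
- by rewrite ht hdb.
Qed.

End Reduction.

(** * Uniqueness of reduced derivations *)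

Section Confluence.
Variables (Sigma : Type) (P : presentation Sigma).
Implicit Types (D : diagram P) (s t : seq (move Sigma)).

Definition reds s t := exists a m b, comm s (a ++ [:: m; minv m] ++ b) /\ t = a ++ b.

Lemma diagram_of x s y : x <> [::] -> deriv P x s y -> exists D,
  [/\ dtop D <> [::], dlabel (dtop D) = x, dlabel (dbot D) = y & realizes D s].
Proof.
move=> xn hs; have [D [d h1 h2 h3]] := exists_diagram xn hs.
by exists (Diagram d); split=> // E; apply: xn; rewrite -h1 /= E.
Qed.

Lemma dipole_split D a m b : realizes D (a ++ [:: m; minv m] ++ b) ->
  exists (c1 c2 : cell D) p q cs1 cs2, [/\ dipole c1 c2,
    peel (dtop D) (cs1 ++ (p, c2, q) :: (p, c1, q) :: cs2) (dbot D),
    moves cs1 = a & moves cs2 = b].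
Proof.
case=> cs h /map_eq_cat[cs1 [cs0 [E <- /map_eq_cat[cs3 [cs2 [E0 E3 <-]]]]]]; subst cs cs0.
case: cs3 E3 h => [|[[p c2] q] [|[[p' c1] q'] []]] // E3 h.
have hm1 : emv (p, c2, q) = m := congr1 (head m) E3.
have hm2 : emv (p', c1, q') = minv m := congr1 (fun l => head m (behead l)) E3.
have [r h1 h2] := (peel_cat _ _ _ _).1 h.
have [r' h3 h4] := (peel_cat r [:: (p, c2, q); (p', c1, q')] cs2 _).1 h2.
have [|Ep Eq Et Eb] := peel_cancel h3 _; first by rewrite hm2 hm1.
by subst p' q'; exists c1, c2, p, q, cs1, cs2.
Qed.

Lemma dipole_minv D (c1 c2 : cell D) p q : dipole c1 c2 ->
  emv (p, c1, q) = minv (emv (p, c2, q)).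
Proof. by case=> h1 h2; rewrite /emv /minv /= h1 h2. Qed.

Lemma dipole_removed D (c1 c2 : cell D) p q cs1 cs2 : dtop D <> [::] -> dipole c1 c2 ->
  peel (dtop D) (cs1 ++ (p, c2, q) :: (p, c1, q) :: cs2) (dbot D) ->
  exists D', [/\ dtop D' <> [::], dlabel (dtop D) = dlabel (dtop D')
    & realizes D' (moves cs1 ++ moves cs2)].
Proof.
move=> n hd h; have xn : dlabel (dtop D) <> [::].
  by move=> /(congr1 size); rewrite size_dlabel => /size0nil.
have := peel_deriv (diagramP D) h; rewrite map_cat /= (dipole_minv p q hd).
move=> /(cancel_deriv (Cancel _ _ _))/(diagram_of xn)[D' [n' hl _ hr]].
by exists D'.
Qed.

Lemma reach_dipole D (c1 c2 : cell D) U p q : dtop D <> [::] -> top c1 = bot c2 ->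
  reach U (p ++ top c2 ++ q) -> uniq U ->
  reach (c1 :: c2 :: U) (p ++ bot c1 ++ q) /\ uniq (c1 :: c2 :: U).
Proof.
move=> n E hr hU; have d := diagramP D.
have [u2 hr2] := reach_step d n hr; rewrite -E in hr2.
by have [u1 hr1] := reach_step d n hr2; rewrite /= u1 u2.
Qed.

(** The peeling in which the dipole is exposed does not matter: both remainders are realized by one
    and the same reduced copy [D'], and realizations of a diagram agree up to commutation. *)
Lemma dipole_comm D (c1 c2 : cell D) p q cs1 cs2 p' q' cs1' cs2' :
  dtop D <> [::] -> dipole c1 c2 ->
  peel (dtop D) (cs1 ++ (p, c2, q) :: (p, c1, q) :: cs2) (dbot D) ->
  peel (dtop D) (cs1' ++ (p', c2, q') :: (p', c1, q') :: cs2') (dbot D) ->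
  comm (moves cs1 ++ moves cs2)
       (moves cs1' ++ moves cs2').
Proof.
move=> n hd h h'; have [D' [n' hl hr]] := dipole_removed n hd h.
have [_ [fe [fc hm]]] := reduction_match n hl hd h hr.
apply: realizes_comm n' hr _; case: hd => E12 _.
exact: dipole_map_realizes n hm E12 h'.
Qed.

Lemma dipole_prefix D (c1 c2 c3 c4 : cell D) cs1 p q :
  dtop D <> [::] -> dipole c1 c2 -> dipole c3 c4 ->
  peel (dtop D) cs1 (p ++ top c2 ++ q) ->
  c4 \notin cells cs1 -> c4 <> c2 -> c4 <> c1 ->
  exists cs5 p' q' cs6, peel (dtop D)
    (cs1 ++ (p, c2, q) :: (p, c1, q) :: (cs5 ++ (p', c4, q') :: (p', c3, q') :: cs6)) (dbot D).
Proof.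
move=> n [E12 _] [E34 _] h c4n n2 n1; have d := diagramP D.
have [hr hU] := peel_reach d n (reach_start d) isT h.
have [hr1 hU1] := reach_dipole n E12 hr hU.
have c4U : c4 \notin c1 :: c2 :: catrev (cells cs1) [::].
  rewrite !inE catrevE cats0 mem_rev !negb_or c4n andbT.
  by apply/andP; split; apply/eqP.
have [cs5 [p' [q' [h5 _]]]] := reach_to_cell d n hr1 hU1 c4U.
have [hr5 hU5] := peel_reach d n hr1 hU1 h5.
have [hr3 hU3] := reach_dipole n E34 hr5 hU5.
have [cs6 h6] := reach_complete d n hr3 hU3.
exists cs5, p', q', cs6; apply/peel_cat; exists (p ++ top c2 ++ q) => //.
rewrite /= -E12; do 2!split=> //; apply/peel_cat; exists (p' ++ top c4 ++ q') => //.
by rewrite /= -E34.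
Qed.

Lemma dipole_eq D (c1 c2 c3 c4 : cell D) : dipole c1 c2 -> dipole c3 c4 ->
  (c1 = c3 <-> c2 = c4).
Proof.
move=> [E12 _] [E34 _]; have d := diagramP D; split=> E.
  have [e he] : exists e, e \in bot c2.
    by case: (bot c2) (bot_nonempty d (c := c2)) => // e s _; exists e; rewrite mem_head.
  have := he; rewrite -E12 E E34; move: he; rewrite !(mem_bot d) => /eqP -> /eqP[].
  by [].
have [e he] : exists e, e \in top c1.
  by case: (top c1) (top_nonempty d (c := c1)) => // e s _; exists e; rewrite mem_head.
have := he; rewrite E12 E -E34; move: he; rewrite !(mem_top d) => /eqP -> /eqP[].
by [].
Qed.

(** The three cells can be peeled consecutively as [c2], [c1], [c3]. The moves of [c2] and [c3]
    coincide, so it makes no difference which of the two pairs is removed. *)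
Lemma dipole_overlap D (c1 c2 c3 : cell D) p q cs1 cs2 p' q' cs1' cs2' :
  dtop D <> [::] -> dipole c1 c2 -> dipole c3 c1 ->
  peel (dtop D) (cs1 ++ (p, c2, q) :: (p, c1, q) :: cs2) (dbot D) ->
  peel (dtop D) (cs1' ++ (p', c1, q') :: (p', c3, q') :: cs2') (dbot D) ->
  comm (moves cs1 ++ moves cs2)
       (moves cs1' ++ moves cs2').
Proof.
move=> n hd hd' h h'; have d := diagramP D.
have [E12 L12] := hd; have [E31 L31] := hd'.
have [r h1 /= [Er [_ _]]] := (peel_cat _ _ _ _).1 h; rewrite Er in h1.
have [hr hU] := peel_reach d n (reach_start d) isT h1.
have [hr1 u1] := reach_dipole n E12 hr hU; rewrite -E31 in hr1.
have [u3 hr3] := reach_step d n hr1.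
have [cs h4] : exists cs, peel (p ++ bot c3 ++ q) cs (dbot D).
  by apply: reach_complete d n _ _ hr3 _; rewrite cons_uniq u3.
have k1 : peel (dtop D) (cs1 ++ (p, c2, q) :: (p, c1, q) :: (p, c3, q) :: cs) (dbot D).
  apply/peel_cat; exists (p ++ top c2 ++ q) => //=.
  by rewrite -E12 -E31.
have k2 : peel (dtop D) ((cs1 ++ [:: (p, c2, q)]) ++ (p, c1, q) :: (p, c3, q) :: cs) (dbot D).
  by rewrite -catA.
apply: comm_trans (dipole_comm n hd h k1) _.
apply: comm_trans (dipole_comm n hd' k2 h').
rewrite map_cat -catA /=; have -> : emv (p, c3, q) = emv (p, c2, q).
  by rewrite /emv /= E31 L12 L31 E12.
exact: comm_refl.
Qed.

(** Some peeling exposes both dipoles as adjacent pairs; dropping both gives a common reduct. The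
    prefix [cs0] ensures that [c2] is reached before [c4]. *)
Lemma dipole_disjoint D (c1 c2 c3 c4 : cell D) p q cs1 cs2 p' q' cs1' cs2' p0 q0 cs0 :
  dtop D <> [::] -> dipole c1 c2 -> dipole c3 c4 ->
  peel (dtop D) (cs1 ++ (p, c2, q) :: (p, c1, q) :: cs2) (dbot D) ->
  peel (dtop D) (cs1' ++ (p', c4, q') :: (p', c3, q') :: cs2') (dbot D) ->
  peel (dtop D) cs0 (p0 ++ top c2 ++ q0) -> c4 \notin cells cs0 -> c4 <> c2 -> c4 <> c1 ->
  exists t, reds (moves cs1 ++ moves cs2) t /\
            reds (moves cs1' ++ moves cs2') t.
Proof.
move=> n hd hd' h h' h0 n0 n2 n1.
have [cs5 [p5 [q5 [cs6 k1]]]] := dipole_prefix n hd hd' h0 n0 n2 n1.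
have k2 := k1; rewrite -!cat_cons catA in k2.
exists (moves cs0 ++ moves cs5 ++ moves cs6); split.
  exists (moves cs0 ++ moves cs5), (emv (p5, c4, q5)), (moves cs6).
  split; last by rewrite catA.
  have := dipole_comm n hd h k1; rewrite map_cat /= (dipole_minv _ _ hd').
  by rewrite -catA.
exists (moves cs0), (emv (p0, c2, q0)), (moves cs5 ++ moves cs6).
split=> //; have := dipole_comm n hd' h' k2; rewrite map_cat /= (dipole_minv _ _ hd).
by rewrite -catA.
Qed.

(** Two dipoles of a diagram coincide, share one cell or are disjoint. In the first two cases the
    results already agree up to commutation. *)
Lemma local_confluence x y s t1 t2 : x <> [::] -> deriv P x s y ->
  reds s t1 -> reds s t2 -> comm t1 t2 \/
  exists t, reds t1 t /\ reds t2 t.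
Proof.
move=> xn hs [a [m [b [h1 ->]]]] [a' [m' [b' [h2 ->]]]].
have [D [n _ _ hr]] := diagram_of xn hs; have d := diagramP D.
have [c1 [c2 [p [q [cs1 [cs2 [hd k1 <- <-]]]]]]] := dipole_split (comm_realizes h1 hr).
have [c3 [c4 [p' [q' [cs3 [cs4 [hd' k2 <- <-]]]]]]] := dipole_split (comm_realizes h2 hr).
have [e13|n13] := pselect (c1 = c3).
  have e24 := (dipole_eq hd hd').1 e13; subst c3 c4.
  by left; apply: dipole_comm n hd k1 k2.
have [e14|n14] := pselect (c1 = c4).
  by subst c4; left; apply: dipole_overlap n hd hd' k1 k2.
have [e23|n23] := pselect (c2 = c3).
  by subst c3; left; apply: comm_sym; apply: dipole_overlap n hd' hd k2 k1.
right; have n24 : c2 <> c4 by move=> /(dipole_eq hd hd').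
have [r h /= [Er _]] := (peel_cat _ _ _ _).1 k1; rewrite Er in h.
(* If [c4] is peeled before [c2], the two dipoles exchange their roles. *)
case: (boolP (c4 \in cells cs1)) => [|h4]; last first.
  exact: dipole_disjoint n hd hd' k1 k2 h h4 (nesym n24) (nesym n14).
move=> /mapP[[[p4 c] q4] hin /= E]; subst c.
case/path.splitPr: hin h k1 => cs5 cs6 h k1.
have [r' h5 /= [Er' _]] := (peel_cat _ _ _ _).1 h; rewrite Er' in h5.
have h6 : c2 \notin cells cs5.
  have [+ _] := peel_cells d n k1; rewrite /cells -catA map_cat cat_uniq.
  case/and3P=> _ /hasPn hn _; apply: hn; rewrite /= map_cat inE mem_cat /= inE.
  by rewrite eqxx !orbT.
have [t [r1 r2]] := dipole_disjoint n hd' hd k2 k1 h5 h6 n24 n23.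
by exists t.
Qed.

Lemma reds_size s t : reds s t -> size t < size s.
Proof.
by case=> a [m [b [h ->]]]; rewrite (comm_size h) !size_cat /= addnS ltnS leq_add2l leqnSn.
Qed.

Lemma reds_deriv x s t y : reds s t -> deriv P x s y -> deriv P x t y.
Proof.
case=> a [m [b [h ->]]] /(comm_deriv h); apply: cancel_deriv; exact: Cancel.
Qed.

Lemma reds_comm s s' t : comm s s' -> reds s t -> reds s' t.
Proof.
move=> h [a [m [b [h1 ->]]]]; exists a, m, b; split=> //.
by apply: comm_trans h1; apply: comm_sym.
Qed.

Lemma reds_or_irred s : irred s \/ exists t, reds s t.
Proof.
have [h|h] := pselect (irred s); [by left | right].
apply: contrapT => h'; apply: h => a m b h; apply: h'.
by exists (a ++ b), a, m, b.
Qed.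

Inductive nf : seq (move Sigma) -> seq (move Sigma) -> Prop :=
| nf_irred s t : comm s t -> irred s -> nf s t
| nf_reds s s' t : reds s s' -> nf s' t -> nf s t.

Lemma nf_exists s : exists t, nf s t.
Proof.
have [n] := ubnP (size s); elim: n s => // n IH s sz.
have [h|[t h]] := reds_or_irred s; first by exists s; apply: nf_irred (comm_refl s) h.
have [|t' h'] := IH t; first exact: leq_trans (reds_size h) _.
by exists t'; apply: nf_reds h h'.
Qed.

Lemma nf_comm s s' t : comm s s' -> nf s t -> nf s' t.
Proof.
move=> h hn; case: hn h => [s0 t0 h1 h2|s0 s1 t0 h1 h2] h.
  by apply: nf_irred (irred_comm h h2); apply: comm_trans (comm_sym h) h1.
exact: nf_reds (reds_comm h h1) h2.
Qed.

(** Newman's argument modulo [comm], by induction on the size, which every cancellation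
    decreases. *)
Lemma nf_unique x y s t1 t2 : x <> [::] -> deriv P x s y -> nf s t1 -> nf s t2 -> comm t1 t2.
Proof.
move=> xn; have [n] := ubnP (size s); elim: n s t1 t2 => // n IH s t1 t2 sz hs h1 h2.
have nored u v : irred u -> reds u v -> False.
  by move=> hu [a [m [b [h _]]]]; apply: hu h.
case: h1 sz hs h2 => [u t h hi|u u' t h hn] sz hs h2.
  case: h2 h hi {sz hs} => [v t' h' _|v v' t' h' _] h hi.
    exact: comm_trans (comm_sym h) h'.
  by case: (nored _ _ hi h').
case: h2 h sz hs => [v t' h' hi|v v' t' h' hn'] h sz hs; first by case: (nored _ _ hi h).
have sz1 : size u' < n := leq_trans (reds_size h) sz.
have sz2 : size v' < n := leq_trans (reds_size h') sz.
have d1 := reds_deriv h hs; have d2 := reds_deriv h' hs.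
have [hc|[t3 [k1 k2]]] := local_confluence xn hs h h'.
  exact: IH sz1 d1 hn (nf_comm (comm_sym hc) hn').
have [t4 h4] := nf_exists t3.
apply: comm_trans (IH _ _ _ sz1 d1 hn (nf_reds k1 h4)) _.
exact: IH sz2 d2 (nf_reds k2 h4) hn'.
Qed.

Lemma htpy_nf x y s t : htpy P x y s t -> x <> [::] ->
  forall u v, nf s u -> nf t v -> comm u v.
Proof.
move=> h xn; elim: h => [s0 hs|s0 t0 r h IH hstep hr] u v hu hv.
  exact: nf_unique xn hs hu hv.
have ht := htpy_derivR h; have [w hw] := nf_exists t0.
apply: comm_trans (IH _ _ hu hw) _.
case: hstep => [h1|[a m b]|[a m b]] in ht hr hw hv *.
- apply: nf_unique xn hr _ hv; apply: nf_comm hw.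
  by apply: comm_step h1; apply: comm_refl.
- apply: nf_unique xn ht hw _; apply: nf_reds hv.
  by exists a, m, b; split=> //; apply: comm_refl.
- apply: nf_unique xn hr _ hv; apply: nf_reds hw.
  by exists a, m, b; split=> //; apply: comm_refl.
Qed.

Lemma htpy_irred_comm x y s t : x <> [::] -> htpy P x y s t -> irred s -> irred t -> comm s t.
Proof.
by move=> xn h hs ht; apply: (htpy_nf h xn); apply: nf_irred => //; apply: comm_refl.
Qed.

Lemma reduced_irred D s : dtop D <> [::] -> reduced D -> realizes D s -> irred s.
Proof.
move=> n hred hr a m b h.
by have [c1 [c2 [? [? [? [? [hd _ _ _]]]]]]] := dipole_split (comm_realizes h hr); apply: hred hd.
Qed.

Lemma dipole_decomposition D (c1 c2 : cell D) : dtop D <> [::] -> dipole c1 c2 ->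
  exists p q cs1 cs2, peel (dtop D) (cs1 ++ (p, c2, q) :: (p, c1, q) :: cs2) (dbot D).
Proof.
move=> n [E12 _]; have d := diagramP D.
have [cs1 [p [q [h1 _]]]] := reach_to_cell d n (reach_start d) isT (isT : c2 \notin [::]).
have [hr hU] := peel_reach d n (reach_start d) isT h1.
have [hr1 hU1] := reach_dipole n E12 hr hU.
have [cs2 h2] := reach_complete d n hr1 hU1.
exists p, q, cs1, cs2; apply/peel_cat; exists (p ++ top c2 ++ q) => //=.
by rewrite -E12.
Qed.

Lemma reduction_htpy D D' s s' : dtop D <> [::] -> dtop D' <> [::] -> reduction D D' ->
  realizes D s -> realizes D' s' -> htpy P (dlabel (dtop D)) (dlabel (dbot D)) s s'.
Proof.
move=> n n' /reduction_dipole_map[c1 [c2 [hd [fe [fc hm]]]]] hs hs'.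
have [p [q [cs1 [cs2 h]]]] := dipole_decomposition n hd.
have h1 : realizes D (moves cs1 ++ [:: emv (p, c2, q); minv (emv (p, c2, q))] ++ moves cs2).
  by eexists; [apply: h | rewrite map_cat /= (dipole_minv _ _ hd)].
have h2 := dipole_map_realizes n hm (proj1 hd) h.
apply: htpy_trans (comm_htpy (realizes_deriv hs) (realizes_comm n hs h1)) _.
have d2 := cancel_deriv (Cancel _ _ _) (realizes_deriv h1).
have step := htpy_step (htpy_refl (realizes_deriv h1)) (Or32 _ _ (Cancel _ _ _)) d2.
exact: htpy_trans step (comm_htpy d2 (realizes_comm n' h2 hs')).
Qed.

Lemma reduction_dtop D D' : dtop D <> [::] -> reduction D D' ->
  [/\ dtop D' <> [::], dlabel (dtop D') = dlabel (dtop D) & dlabel (dbot D') = dlabel (dbot D)].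
Proof.
move=> n /reduction_dipole_map[c1 [c2 [[E12 _] [fe [fc [hl _ _ _ [Et Eb]]]]]]].
have d := diagramP D; rewrite Et Eb; split.
- by case: (dtop D) n.
- rewrite /dlabel -map_comp; apply/eq_in_map => e he; apply: hl.
  by move: he; rewrite E12 (mem_bot d) (mem_dtop d) => /eqP ->.
- rewrite /dlabel -map_comp; apply/eq_in_map => e he; apply: hl.
  by move: he; rewrite (mem_top d) (mem_dbot d) => /eqP ->.
Qed.

Lemma reduces_trans D D1 D2 : reduces D D1 -> reduces D1 D2 -> reduces D D2.
Proof. by move=> h1; elim=> // D3 D4 _ h; apply: reduces_step h. Qed.

Lemma reduced_exists D : dtop D <> [::] -> exists D', reduces D D' /\ reduced D'.
Proof.
have [k] := ubnP (ncell D); elim: k D => // k IH D sz n.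
have [h|h] := pselect (reduced D); first by exists D; split=> //; apply: reduces_refl.
have [c1 [c2 hd]] : exists c1 c2 : cell D, dipole c1 c2.
  by apply: contrapT => h'; apply: h => c1 c2 hd; apply: h'; exists c1, c2.
have [p [q [cs1 [cs2 h1]]]] := dipole_decomposition n hd.
have [D1 [n1 hl hr]] := dipole_removed n hd h1.
have [hred _] := reduction_match n hl hd h1 hr.
have [||D' [h2 h3]] := IH D1 => //.
  have {}sz : ncell D <= k := sz.
  rewrite -(realizes_size n1 hr); apply: leq_trans sz.
  rewrite -(peel_ncell (diagramP D) n h1) !size_cat !size_map /= addnS.
  by rewrite ltnS leq_add2l leqnSn.
exists D'; split=> //; apply: reduces_trans h2; apply: reduces_step hred.
exact: reduces_refl.
Qed.

Lemma reduces_htpy D D' s : dtop D <> [::] -> reduces D D' -> realizes D s ->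
  [/\ dtop D' <> [::], dlabel (dtop D') = dlabel (dtop D), dlabel (dbot D') = dlabel (dbot D)
    & forall s', realizes D' s' -> htpy P (dlabel (dtop D)) (dlabel (dbot D)) s s'].
Proof.
move=> n h hs; elim: h => [|D1 D2 _ [n1 l1 l1' IH] h].
  split=> // s' hs'; apply: comm_htpy (realizes_comm n hs hs'); exact: realizes_deriv.
have [n2 l2 l2'] := reduction_dtop n1 h; split; rewrite ?l2 ?l2' // => s' hs'.
have [s1 hs1] := realizes_ex n1; apply: htpy_trans (IH _ hs1) _.
by rewrite -l1 -l1'; apply: reduction_htpy n1 n2 h hs1 hs'.
Qed.

End Confluence.

(** * Hyperplanes *)

Section Hyperplanes.
Variables (Sigma : Type) (P : presentation Sigma).
Local Notation word := (seq Sigma).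
Implicit Types (k s t : seq (move Sigma)) (m n : move Sigma) (a b u v x y : word).

(* [around u k a b a' b'] : the derivation [k], from [a u b] to [a' u b'],
   applies its moves to the left or to the right of [u]. *)
Inductive around u : seq (move Sigma) -> word -> word -> word -> word -> Prop :=
| around_nil a b : around u [::] a b a b
| around_left x (s t : word) y b k a' b' : step P s t ->
    around u k (x ++ t ++ y) b a' b' ->
    around u (Move x s t (y ++ u ++ b) :: k) (x ++ s ++ y) b a' b'
| around_right a x (s t : word) y k a' b' : step P s t ->
    around u k a (x ++ t ++ y) a' b' ->
    around u (Move (a ++ u ++ x) s t y :: k) a (x ++ s ++ y) a' b'.

Lemma around_deriv u k a b a' b' : around u k a b a' b' ->
  deriv P (a ++ u ++ b) k (a' ++ u ++ b').
Proof.
elim=> // {a b a' b'}.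
  move=> x s t y b k0 a' b' hs _ h; split=> //; rewrite /msrc /mtgt /= -?catA //.
  by move: h; rewrite -!catA.
by move=> a x s t y k0 a' b' hs _ h; split=> //; rewrite /msrc /mtgt /= -?catA.
Qed.

Lemma around_cat u k k' a b a' b' a2 b2 : around u k a b a' b' -> around u k' a' b' a2 b2 ->
  around u (k ++ k') a b a2 b2.
Proof.
move=> h; elim: h => // {}x => [s t y b0 k0 ? ? hs _ IH /IH h|].
  exact: around_left.
by move=> ? ? ? ? ? ? ? hs _ IH /IH h; apply: around_right.
Qed.

Lemma around_sinv u k a b a' b' : around u k a b a' b' -> around u (sinv k) a' b' a b.
Proof.
elim=> [? ?|x s t y b0 k0 ? ? hs _ IH|a0 x s t y k0 ? ? hs _ IH]; first exact: around_nil.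
  rewrite /sinv /= rev_cons -cats1; apply: around_cat IH _.
  by apply: around_left (step_sym hs) _; apply: around_nil.
rewrite /sinv /= rev_cons -cats1; apply: around_cat IH _.
by apply: around_right (step_sym hs) _; apply: around_nil.
Qed.

Lemma around_swap_left x (s t : word) y u v b :
  swap [:: Move (x ++ s ++ y) u v b; Move x s t (y ++ v ++ b)]
       [:: Move x s t (y ++ u ++ b); Move (x ++ t ++ y) u v b].
Proof.
exact: (Swap [::] [::] (or_intror (Square x s t y u v b))).
Qed.

Lemma around_swap_right a u v x (s t : word) y :
  swap [:: Move a u v (x ++ s ++ y); Move (a ++ v ++ x) s t y]
       [:: Move (a ++ u ++ x) s t y; Move a u v (x ++ t ++ y)].
Proof.
exact: (Swap [::] [::] (or_introl (Square a u v x s t y))).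
Qed.

(** The move [u -> v] slides along the strip of squares that it spans with [k]; [k'] is the opposite
    side of the strip. In [around_pull] the side given is the one that starts before the move. *)
Lemma around_push u v k a b a' b' : around v k a b a' b' ->
  exists2 k', around u k' a b a' b' & comm (Move a u v b :: k) (k' ++ [:: Move a' u v b']).
Proof.
elim=> [a0 b0|x s t y b0 k0 a2 b2 hs _ [k' h1 h2]|a0 x s t y k0 a2 b2 hs _ [k' h1 h2]].
- by exists [::]; [apply: around_nil | apply: comm_refl].
- exists (Move x s t (y ++ u ++ b0) :: k'); first exact: around_left.
  have := swap_cat [::] k0 (around_swap_left x s t y u v b0) => /= sw.
  apply: comm_trans (comm_step (comm_refl _) sw) _.
  by have := comm_cat [:: Move x s t (y ++ u ++ b0)] [::] h2; rewrite !cats0.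
exists (Move (a0 ++ u ++ x) s t y :: k'); first exact: around_right.
have := swap_cat [::] k0 (around_swap_right a0 u v x s t y) => /= sw.
apply: comm_trans (comm_step (comm_refl _) sw) _.
by have := comm_cat [:: Move (a0 ++ u ++ x) s t y] [::] h2; rewrite !cats0.
Qed.

Lemma around_pull u v k a b a' b' : around u k a b a' b' ->
  exists2 k', around v k' a b a' b' & comm (Move a u v b :: k') (k ++ [:: Move a' u v b']).
Proof.
elim=> [a0 b0|x s t y b0 k0 a2 b2 hs _ [k' h1 h2]|a0 x s t y k0 a2 b2 hs _ [k' h1 h2]].
- by exists [::]; [apply: around_nil | apply: comm_refl].
- exists (Move x s t (y ++ v ++ b0) :: k'); first exact: around_left.
  have := swap_cat [::] k' (around_swap_left x s t y u v b0) => /= sw.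
  apply: comm_trans (comm_step (comm_refl _) sw) _.
  by have := comm_cat [:: Move x s t (y ++ u ++ b0)] [::] h2; rewrite !cats0.
exists (Move (a0 ++ v ++ x) s t y :: k'); first exact: around_right.
have := swap_cat [::] k' (around_swap_right a0 u v x s t y) => /= sw.
apply: comm_trans (comm_step (comm_refl _) sw) _.
by have := comm_cat [:: Move (a0 ++ u ++ x) s t y] [::] h2; rewrite !cats0.
Qed.

Section InDiagrams.
Variable D : diagram P.
Hypothesis hne : dtop D <> [::].
Let d := diagramP D.

(** The unbounded face lies below the edges of [T], so no cell has any of them on its top path, and
    every cell is peeled to the left or to the right of [T]. *)
Lemma around_peel U (X T Y X' Y' : seq (edge D)) cs : T <> [::] ->
  reach U (X ++ T ++ Y) -> {in T, forall e, below e = None} -> uniq (X' ++ T ++ Y') ->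
  peel (X ++ T ++ Y) cs (X' ++ T ++ Y') ->
  around (dlabel T) (moves cs) (dlabel X) (dlabel Y) (dlabel X') (dlabel Y').
Proof.
move=> Tn hU hT hu; elim: cs U X Y hU => [|[[a c] b] cs IH] U X Y hU.
  by move=> /= E; have [-> ->] := uniq_segment Tn (reach_uniq d hU) E; apply: around_nil.
move=> [E h]; rewrite E in hU; have [_ hU'] := reach_step d hne hU.
have dis e : e \in top c -> e \in T -> False.
  by rewrite (mem_top d) => /eqP he /hT; rewrite he.
have cl := cell_label d c.
have [[m [EX Eb]]|[m [Ea EY]]] := disjoint_segments (@top_nonempty _ P D d c) Tn dis (esym E).
  subst X b; rewrite /= /emv /= !dlabel_cat; apply: around_left cl _.
  rewrite -!dlabel_cat; apply: (IH (c :: U)); first by move: hU'; rewrite -!catA.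
  by move: h; rewrite -!catA.
subst a Y; rewrite /= /emv /= !dlabel_cat; apply: around_right cl _.
rewrite -!dlabel_cat; apply: (IH (c :: U)); first by move: hU'; rewrite -!catA.
by move: h; rewrite -!catA.
Qed.

Lemma peel_around u k a b a' b' cs (A T B q : seq (edge D)) : around u k a b a' b' ->
  moves cs = k -> dlabel T = u -> dlabel A = a -> dlabel B = b ->
  peel (A ++ T ++ B) cs q ->
  exists A' B', [/\ q = A' ++ T ++ B', dlabel A' = a' & dlabel B' = b'].
Proof.
move=> h hm hT; elim: h cs A B hm => {k a b a' b'}.
- by move=> a b [|? ?] // A B _ hA hB /= <-; exists A, B.
- move=> x s t y b k a' b' hs _ IH [|[[p c] q'] cs] // A B hm hA hB [E h].
  have [hp hc hc' hq] : [/\ dlabel p = x, dlabel (top c) = s, dlabel (bot c) = t &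
    dlabel q' = y ++ u ++ b] by case: hm.
  have hk : moves cs = k by case: hm.
  have [A1 [A0 [EA e1 /map_eq_cat[A2 [A3 [EA0 e2 e3]]]]]] := map_eq_cat hA; subst A A0.
  have [E1 E2] : A1 = p /\ A2 ++ A3 ++ T ++ B = top c ++ q'.
    apply: cat_size_inj; first by rewrite -size_dlabel -[RHS]size_dlabel hp -e1.
    by rewrite -E -!catA.
  have [E3 E4] : A2 = top c /\ A3 ++ T ++ B = q'.
    by apply: cat_size_inj E2; rewrite -size_dlabel -[RHS]size_dlabel hc -e2.
  subst A1 A2 q'; apply: (IH cs (p ++ bot c ++ A3) B hk) => //.
    by rewrite !dlabel_cat hp hc' -e3.
  by move: h; rewrite -!catA.
move=> a x s t y k a' b' hs _ IH [|[[p c] q'] cs] // A B hm hA hB [E h].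
have [hp hc hc' hq] : [/\ dlabel p = a ++ u ++ x, dlabel (top c) = s, dlabel (bot c) = t &
  dlabel q' = y] by case: hm.
have hk : moves cs = k by case: hm.
have [B1 [B0 [EB e1 /map_eq_cat[B2 [B3 [EB0 e2 e3]]]]]] := map_eq_cat hB; subst B B0.
have [E1 E2] : A ++ T ++ B1 = p /\ B2 ++ B3 = top c ++ q'.
  apply: cat_size_inj; last by rewrite -E -!catA.
  by rewrite -size_dlabel -[RHS]size_dlabel hp !dlabel_cat hA hT -e1.
have [E3 E4] : B2 = top c /\ B3 = q'.
  by apply: cat_size_inj E2; rewrite -size_dlabel -[RHS]size_dlabel hc -e2.
subst p B2 q'; apply: (IH cs A (B1 ++ bot c ++ B3) hk) => //.
  by rewrite !dlabel_cat hc' -e1 -e3.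
by move: h; rewrite -!catA.
Qed.

End InDiagrams.

(** The edges of [T], and not only their labels, are common to both boundary paths. Dipole removal
    preserves this because the path that vanishes contains no edge of either boundary path. *)
Definition fixed_segment (D : diagram P) u a b a' b' :=
  exists A T B A' B', [/\ dtop D = A ++ T ++ B, dbot D = A' ++ T ++ B', dlabel T = u
    & [/\ dlabel A = a, dlabel B = b, dlabel A' = a' & dlabel B' = b']].

Lemma fixed_segment_reduction (D D' : diagram P) u a b a' b' : dtop D <> [::] -> reduction D D' ->
  fixed_segment D u a b a' b' -> fixed_segment D' u a b a' b'.
Proof.
move=> n /reduction_dipole_map[c1 [c2 [[E12 _] [fe [fc [hl _ _ _ [Et Eb]]]]]]].
have d := diagramP D; case=> A [T [B [A' [B' [E1 E2 hT [hA hB hA' hB']]]]]].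
have dl p : {subset p <= dtop D} \/ {subset p <= dbot D} -> dlabel (map fe p) = dlabel p.
  move=> hp; rewrite /dlabel -map_comp; apply/eq_in_map => e he; apply: hl.
  case: hp => /(_ e he); first by rewrite E12 (mem_bot d) (mem_dtop d) => /eqP ->.
  by rewrite (mem_top d) (mem_dbot d) => /eqP ->.
exists (map fe A), (map fe T), (map fe B), (map fe A'), (map fe B').
rewrite Et Eb E1 E2 !map_cat; split=> //.
  by rewrite dl //; left=> e he; rewrite E1 !mem_cat he orbT.
split; rewrite dl //; [left|left|right|right] => e he;
  by rewrite ?E1 ?E2 !mem_cat he ?orbT.
Qed.

(** A homotopy from [k] to [s] may well alter the occurrence of [u]. In the diagram of [k], however,
    the occurrence is a fixed segment; it persists in the reduced diagram, which also realizes [s],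
    and [around_peel] then applies. *)
Lemma around_irred u k a b a' b' s : u <> [::] -> around u k a b a' b' ->
  htpy P (a ++ u ++ b) (a' ++ u ++ b') k s -> irred s -> around u s a b a' b'.
Proof.
move=> un hk hks hs.
have xn : a ++ u ++ b <> [::] by case: a u un {hk hks} => [|? ?] // [].
have [D [n hl hl' hr]] := diagram_of xn (around_deriv hk).
have hfix : fixed_segment D u a b a' b'.
  have [A [r [E hA /map_eq_cat[T [B [Er hT hB]]]]]] := map_eq_cat hl; subst r.
  case: (hr) => cs h hm; rewrite E in h.
  have [A' [B' [E' hA' hB']]] := peel_around hk hm hT hA hB h.
  by exists A, T, B, A', B'.
have [D' [h1 h2]] := reduced_exists n.
have [n' l1 l2 h3] := reduces_htpy n h1 hr.
have {hfix} : fixed_segment D' u a b a' b'.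
  elim: h1 hfix {h2 n' l1 l2 h3} => // D1 D2 h4 IH h5 /IH h6.
  have [n1 _ _ _] := reduces_htpy n h4 hr; exact: fixed_segment_reduction n1 h5 h6.
have [s' hs'] := realizes_ex n'.
have hr' : realizes D' s.
  have h4 := h3 _ hs'; rewrite hl hl' in h4.
  have hc := htpy_irred_comm xn (htpy_trans (htpy_sym h4) hks) (reduced_irred n' h2 hs') hs.
  exact: comm_realizes hc hs'.
case=> A [T [B [A' [B' [E1 E2 hT [<- <- <- <-]]]]]]; case: hr' => cs h4 <-.
have d := diagramP D'; rewrite -hT; apply: (@around_peel D' n' [::]).
- by move=> T0; apply: un; rewrite -hT T0.
- by rewrite -E1; apply: reach_start d.
- by move=> e he; apply/eqP; rewrite -(mem_dbot d) E2 !mem_cat he orbT.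
- by rewrite -E2; apply: path_uniq d _ _ _ (dbot_path d).
by rewrite -E1 -E2.
Qed.

End Hyperplanes.

(** * Parallel edges of the universal cover *)

Section Parallel.
Variables (Sigma : Type) (P : presentation Sigma) (w : seq Sigma).
Local Notation word := (seq Sigma).
Implicit Types (k p q r s t : seq (move Sigma)) (m n o : move Sigma) (a b u v x y : word).

(* The pair [(p, m)] stands for an edge of the universal cover of S(P, w): the
   path [p] from [w], up to homotopy, is its origin. *)
Definition edge_at p m := step P (mu m) (mv m) /\ deriv P w p (msrc m).

(** Edges dual to the same hyperplane, with the same orientation: [k] leads from the origin of one
    to the origin of the other, and each of its moves spans a square with the edge. [par] forgets
    the orientation. *)
Definition par_or p m q n := [/\ mu n = mu m, mv n = mv m &
  exists2 k, around P (mu m) k (ml m) (mr m) (ml n) (mr n) &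
             htpy P w (msrc n) q (p ++ k)].

Definition par p m q n := par_or p m q n \/ par_or p m (q ++ [:: n]) (minv n).

Lemma move_eta m : Move (ml m) (mu m) (mv m) (mr m) = m.
Proof. by case: m. Qed.

Lemma edge_deriv p m : edge_at p m -> deriv P w (p ++ [:: m]) (mtgt m).
Proof. by case=> h1 h2; apply/deriv_cat; exists (msrc m). Qed.

Lemma edge_flip p m : edge_at p m -> edge_at (p ++ [:: m]) (minv m).
Proof. by move=> h; split; [case: h => /step_sym | apply: edge_deriv]. Qed.

Lemma edge_flip2 p m : edge_at p m -> htpy P w (msrc m) p ((p ++ [:: m]) ++ [:: minv m]).
Proof.
move=> h; have := edge_deriv (edge_flip h); rewrite -!catA => h'.
by apply: htpy_step (htpy_refl (proj2 h)) (Or33 _ _ _) h'; have := Cancel p m [::]; rewrite !cats0.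
Qed.

Lemma par_or_edge p m q n : edge_at p m -> par_or p m q n -> edge_at q n.
Proof. by case=> h1 h2 [e1 e2 [k _ h]]; split; [rewrite e1 e2 | apply: htpy_derivL h]. Qed.

Lemma par_or_refl p m : edge_at p m -> par_or p m p m.
Proof.
case=> h1 h2; split=> //; exists [::]; first exact: around_nil.
by rewrite cats0; apply: htpy_refl.
Qed.

Lemma par_or_trans p m q n r o : par_or p m q n -> par_or q n r o -> par_or p m r o.
Proof.
case=> e1 e2 [k h1 h2] [e3 e4 [k' h3 h4]]; split; rewrite ?e3 ?e4 //.
rewrite e1 in h3; exists (k ++ k'); first exact: around_cat h1 h3.
apply: htpy_trans h4 _; rewrite catA; apply: htpy_cat2 h2 _.
by apply: htpy_refl; have := around_deriv h3; rewrite /msrc e3 e1.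
Qed.

Lemma par_or_sym p m q n : edge_at p m -> par_or p m q n -> par_or q n p m.
Proof.
case=> hm hp [e1 e2 [k h1 h2]]; split; rewrite ?e1 ?e2 //; exists (sinv k).
  exact: around_sinv.
have hk : deriv P (msrc m) k (msrc n) by have := around_deriv h1; rewrite /msrc e1.
have hk' := deriv_sinv hk.
apply: htpy_sym; apply: htpy_trans (htpy_cat2 h2 (htpy_refl hk')) _.
by rewrite -catA; have := htpy_cat2 (htpy_refl hp) (htpy_sinvR hk); rewrite cats0.
Qed.

Lemma par_or_htpyR p m q q' n : htpy P w (msrc n) q q' -> par_or p m q n -> par_or p m q' n.
Proof.
move=> h [e1 e2 [k h1 h2]]; split=> //; exists k => //.
exact: htpy_trans (htpy_sym h) h2.
Qed.

Lemma par_or_htpyL p p' m q n : edge_at p m -> htpy P w (msrc m) p p' ->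
  par_or p m q n -> par_or p' m q n.
Proof.
move=> hp h hq.
by apply: par_or_trans hq; apply: par_or_sym => //; apply: par_or_htpyR h (par_or_refl hp).
Qed.

Lemma par_or_flip p m q n : edge_at p m -> par_or p m q n ->
  par_or (p ++ [:: m]) (minv m) (q ++ [:: n]) (minv n).
Proof.
move=> hp hq; have hqn := par_or_edge hp hq; case: hq => e1 e2 [k h1 h2].
split=> //; have [k' h3 h4] := around_pull (mv m) h1; exists k' => //.
have hn : deriv P (msrc n) [:: n] (mtgt n) by case: hqn.
apply: htpy_trans (htpy_cat2 h2 (htpy_refl hn)) _.
have hd := htpy_derivR (htpy_cat2 h2 (htpy_refl hn)).
apply: comm_htpy hd _; rewrite move_eta -e1 -e2 move_eta in h4.
by have := comm_cat p [::] (comm_sym h4); rewrite !cats0 -!catA.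
Qed.

Lemma par_refl p m : edge_at p m -> par p m p m.
Proof. by left; apply: par_or_refl. Qed.

Lemma par_sym p m q n : edge_at p m -> edge_at q n -> par p m q n -> par q n p m.
Proof.
move=> hp hq [h|h]; first by left; apply: par_or_sym.
right; apply: par_or_htpyL (edge_flip (edge_flip hq)) (htpy_sym (edge_flip2 hq)) _.
by rewrite -[n in minv n]minvK; apply: par_or_flip (edge_flip hq) (par_or_sym hp h).
Qed.

Lemma par_trans p m q n r o : edge_at p m -> edge_at q n -> edge_at r o ->
  par p m q n -> par q n r o -> par p m r o.
Proof.
move=> hp hq hr [h|h] [h'|h'].
- by left; apply: par_or_trans h h'.
- by right; apply: par_or_trans h h'.
- by right; apply: par_or_trans h (par_or_flip hq h').
- left; have := par_or_trans h (par_or_flip hq h'); rewrite minvK.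
  by apply: par_or_htpyR; apply: htpy_sym; apply: edge_flip2.
Qed.

Lemma par_flip q n : edge_at q n -> par q n (q ++ [:: n]) (minv n).
Proof.
move=> h; right; rewrite minvK; apply: par_or_htpyR (edge_flip2 h) _.
exact: par_or_refl.
Qed.

Lemma par_htpy q q' n : edge_at q n -> htpy P w (msrc n) q q' -> par q n q' n.
Proof. by move=> hq h; left; apply: par_or_htpyR h (par_or_refl hq). Qed.

Lemma square_par q a u v b u' v' c : step P u v -> step P u' v' ->
    let m := Move a u v (b ++ u' ++ c) in let n' := Move (a ++ v ++ b) u' v' c in
    let n := Move (a ++ u ++ b) u' v' c in let m' := Move a u v (b ++ v' ++ c) in
  deriv P w q (msrc m) ->
  [/\ edge_at q m, edge_at q n, edge_at (q ++ [:: m]) n' & edge_at (q ++ [:: n]) m'] /\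
  par q m (q ++ [:: n]) m' /\ par q n (q ++ [:: m]) n'.
Proof.
move=> hu hu' m n' n m' hq.
have e1 : msrc n = msrc m by rewrite /msrc /= -!catA.
have e2 : msrc n' = mtgt m by rewrite /msrc /mtgt /= -!catA.
have e3 : msrc m' = mtgt n by rewrite /msrc /mtgt /= -!catA.
have hm : edge_at q m by [].
have hn : edge_at q n by split; rewrite ?e1.
have hn' : edge_at (q ++ [:: m]) n' by split; rewrite ?e2 //; apply: edge_deriv.
have hm' : edge_at (q ++ [:: n]) m' by split; rewrite ?e3 //; apply: edge_deriv.
split=> //; split; left; split=> //.
  exists [:: n]; last by apply: htpy_refl; case: hm'.
  by apply: around_right hu' _; apply: around_nil.
exists [:: m]; last by apply: htpy_refl; case: hn'.
by apply: around_left hu _; apply: around_nil.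
Qed.

Lemma around_head u m s a b a' b' : around P u (m :: s) a b a' b' ->
  size (ml m) < size a \/ size a + size u <= size (ml m).
Proof.
have [k Ek] : exists k, k = m :: s by eexists.
rewrite -Ek => h; case: h Ek => {a b a' b' k} // [x s' t y b k a' b' hs _|a x s' t y k a' b' hs _] [<- _] /=.
  by left; rewrite !size_cat; have := step_nilL hs; case: (s') => //= ? ? _; lia.
by right; rewrite !size_cat; lia.
Qed.

Lemma crossing r m s n t : irred ((m :: s) ++ n :: t) ->
  edge_at r m -> edge_at (r ++ m :: s) n -> par r m (r ++ m :: s) n -> False.
Proof.
move=> hi hr hn; have [sm dr] := hr; have un := step_nilL sm; have vn := step_nilR sm.
have [_ /deriv_cat[x dr' ds]] := hn; have ex := deriv_fun dr dr'; subst x.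
have [_ _ ds'] := ds.
have hms : irred (m :: s) by have := @irred_infix _ [::] (m :: s) _ hi; apply.
case=> [[e1 e2 [k h1 h2]]|[e1 e2 [k h1 h2]]].
  (* Same direction: by [around_irred] the derivation [m :: s] stays around the occurrence of
     [mu m], to which its own first move is applied. *)
  have dk : deriv P (msrc m) k (msrc n) by have := around_deriv h1; rewrite /msrc e1.
  have hk := htpy_sym (htpy_cancelL dr ds dk h2).
  have : around P (mu m) (m :: s) (ml m) (mr m) (ml n) (mr n).
    by apply: around_irred un h1 _ hms; move: hk; rewrite /msrc e1.
  have um : 0 < size (mu m) by case: (mu m) un.
  by move=> /around_head[]; lia.
(* Opposite direction: [s] stays around the occurrence of [mv m], so [m] can be pushed through [s].
   It arrives as [minv n] and cancels with [n]. *)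
have {}e1 : mv n = mu m := e1.
have {}e2 : mu n = mv m := e2.
have dn : deriv P (msrc n) [:: n] (mtgt n) by case: hn.
have dk : deriv P (msrc m) k (mtgt n) by have := around_deriv h1; rewrite /mtgt /msrc e1.
have dsn : deriv P (msrc m) ((m :: s) ++ [:: n]) (mtgt n) by apply/deriv_cat; exists (msrc n).
rewrite -catA in h2; have hk := htpy_cancelL dr dsn dk h2.
have [k' h3 h4] := around_pull (mv m) h1.
have En : Move (ml (minv n)) (mu m) (mv m) (mr (minv n)) = minv n.
  by rewrite -e1 -e2; case: (n).
rewrite move_eta En in h4.
have dn' : deriv P (mtgt n) [:: minv n] (msrc n) by split=> //; case: hn => /step_sym.
have hk2 : htpy P (msrc m) (msrc n) (m :: s) (m :: k').
  apply: htpy_trans (_ : htpy P (msrc m) (msrc n) _ (k ++ [:: minv n])) _; last first.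
    apply: comm_htpy (comm_sym h4); apply/deriv_cat; by exists (mtgt n).
  apply: htpy_trans (htpy_cat2 hk (htpy_refl dn')).
  have d2 := htpy_derivL (htpy_cat2 hk (htpy_refl dn')); rewrite -catA in d2 *.
  apply: htpy_step (htpy_refl ds) (Or33 _ _ _) d2.
  by have := Cancel (m :: s) n [::]; rewrite !cats0.
have dm : deriv P (msrc m) [:: m] (mtgt m) by [].
have [_ _ dk'] := htpy_derivR hk2.
have hk3 := htpy_cancelL (s := [:: m]) dm ds' dk' hk2.
have hs : irred s by have := @irred_infix _ [:: m] s [::]; rewrite cats0; apply.
have : around P (mv m) s (ml m) (mr m) (ml n) (mr n).
  apply: around_irred vn h3 _ hs; apply: htpy_sym.
  by move: hk3; rewrite /msrc /mtgt /= e2.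
move=> /(around_push (mu m))[s' _]; rewrite move_eta -[ml n]/(ml (minv n)) -[mr n]/(mr (minv n)) En.
move=> h5; apply: (hi s' (minv n) t); rewrite minvK.
by have := comm_cat [::] (n :: t) h5; rewrite -!catA.
Qed.

End Parallel.

(** * Parity of hyperplane crossings *)

Section Parity.
Variables (Sigma : Type) (P : presentation Sigma) (w : seq Sigma).
Variables (p0 : seq (move Sigma)) (m0 : move Sigma).
Hypothesis h0 : edge_at P w p0 m0.
Implicit Types (q s t : seq (move Sigma)) (m n o : move Sigma).

(* The parity of the number of crossings of the hyperplane of [(p0, m0)] by the
   path [s] starting at the end of [q]. *)
Fixpoint chi q s : bool :=
  if s is n :: s' then `[< par P w p0 m0 q n >] (+) chi (q ++ [:: n]) s' else false.

Lemma chi_cat q s t : chi q (s ++ t) = chi q s (+) chi (q ++ s) t.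
Proof.
elim: s q => [|n s IH] q /=; first by rewrite cats0.
by rewrite IH addbA -catA.
Qed.

Lemma par_eq q n r o : edge_at P w q n -> edge_at P w r o -> par P w q n r o ->
  `[< par P w p0 m0 q n >] = `[< par P w p0 m0 r o >].
Proof.
move=> hq hr h; apply/asboolP/asboolP => h'; first exact: par_trans h0 hq hr h' h.
exact: par_trans h0 hr hq h' (par_sym hq hr h).
Qed.

Lemma chi_htpyL x y q q' s : htpy P w x q q' -> deriv P x s y -> chi q s = chi q' s.
Proof.
elim: s x q q' => [|n s IH] x q q' //= h [sn ex ds]; rewrite -ex in h.
have hn : edge_at P w q n by split=> //; apply: htpy_derivL h.
have hn' : edge_at P w q' n by split=> //; apply: htpy_derivR h.
rewrite (par_eq hn hn' (par_htpy hn h)); congr (_ (+) _); apply: IH ds.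
by apply: htpy_cat2 h _; apply: htpy_refl.
Qed.

Lemma chi_square x y q s t : square s t -> deriv P w q x -> deriv P x s y ->
  chi q s = chi q t.
Proof.
case=> a u v b u' v' c hq /= [hu hx [hu' _ _]].
have [[h1 h2 h3 h4] [k1 k2]] := square_par (q := q) (a := a) (b := b) (c := c) hu hu' (eq_ind_r _ hq hx).
rewrite (par_eq h1 h4 k1) (par_eq h2 h3 k2).
by rewrite !addbF addbC.
Qed.

(** Opposite sides of a square are parallel, and a backtrack crosses the same hyperplane twice. *)
Lemma chi_hstep y s t : hstep s t -> deriv P w s y -> deriv P w t y ->
  chi [::] s = chi [::] t.
Proof.
have can a m b : deriv P w (a ++ [:: m; minv m] ++ b) y ->
    chi [::] (a ++ [:: m; minv m] ++ b) = chi [::] (a ++ b).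
  move=> /deriv_cat[x ha /= [hm hx [hm' _ hb]]]; rewrite !chi_cat /=.
  have he : edge_at P w a m by split; rewrite ?hx.
  rewrite (par_eq he (edge_flip he) (par_flip he)) [X in _ (+) X]addbA addbb addFb -catA /=.
  congr (_ (+) _); have := edge_flip2 he; rewrite -catA => /htpy_sym h.
  by apply: chi_htpyL h hb.
case=> [|h hs ht|h hs ht]; last 2 first.
- by case: h hs ht => a m b hs ht; apply: can.
- by case: h hs ht => a m b hs ht; apply/esym/can.
case=> a b {}s {}t h hs _; have [x ha /deriv_cat[z hs' hb]] := (deriv_cat _ _ _ _ _).1 hs.
rewrite !chi_cat; have -> : chi ([::] ++ a) s = chi ([::] ++ a) t.
  case: h => h; first exact: chi_square h ha hs'.
  by apply/esym; apply: chi_square h ha (square_deriv (or_intror h) hs').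
congr (_ (+) _); congr (_ (+) _); apply: chi_htpyL hb.
apply: htpy_cat2 (htpy_refl ha) _; apply: comm_htpy hs' _.
have := Swap [::] [::] h; rewrite /= !cats0; apply: comm_step; exact: comm_refl.
Qed.

Lemma chi_htpy y s t : htpy P w y s t -> chi [::] s = chi [::] t.
Proof.
by elim=> // s' t' r h -> hs hr; apply: chi_hstep hs (htpy_derivR h) hr.
Qed.

End Parity.

(** * Colors of moves *)

Section Rank.
Variables (Sigma : Type) (P : presentation Sigma) (w : seq Sigma) (d : nat).
Hypothesis hdim : squier_dim P w d.
Local Notation word := (seq Sigma).
Implicit Types (k p q s t : seq (move Sigma)) (m o : move Sigma) (a b c u v x y : word).

Lemma joinable_deriv x y : joinable (squier_edge P) x y <-> exists s, deriv P x s y.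
Proof.
split=> [[n [p [hp <- _]]]|[s hs]].
  elim: p x hp => [|z p IH] x /= => [_|[[a [u [v [b [huv -> ->]]]]] /IH[s hs]]].
    by exists [::].
  by exists (Move a u v b :: s).
exists (size s); elim: s x hs => [|m s IH] x /= => [->|[hm <- /IH[p [h1 h2 h3]]]].
  by exists [::].
exists (mtgt m :: p); split=> //=; last by rewrite h3.
split=> //; exists (ml m), (mu m), (mv m), (mr m); by [].
Qed.

Lemma deriv_context l r x s y : deriv P x s y ->
  exists s', deriv P (l ++ x ++ r) s' (l ++ y ++ r).
Proof.
elim: s x => [|m s IH] x /= => [->|[hm <- /IH[s' hs']]]; first by exists [::].
exists (Move (l ++ ml m) (mu m) (mv m) (mr m ++ r) :: s') => /=; split=> //.
  by rewrite /msrc /= -!catA.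
by move: hs'; rewrite /mtgt /= -!catA.
Qed.

Lemma cube_deriv x s y n : deriv P x s y -> squier_cube P x n -> squier_cube P y n.
Proof.
move=> hs [c [a [h1 h2 h3]]]; exists c, a; split=> // l.
have [t ht] := (joinable_deriv _ _).1 (h3 l); apply/joinable_deriv.
by exists (sinv s ++ t); apply/deriv_cat; exists x => //; apply: deriv_sinv.
Qed.

Lemma cube_vertex_rcons (c : seq (word * word * word)) a u v b l :
  exists e : bool, cube_vertex (rcons c (a, u, v)) b l =
    cube_vertex c a l ++ (if e then v else u) ++ b.
Proof.
elim: c l => [|[[x s] t] c IH] l /=; first by exists (head false l).
by have [e ->] := IH (behead l); exists e; rewrite -!catA.
Qed.

(** A cube in the component of [a] does not involve the occurrence of [u] to its right, so [u -> v]
    is one more independent direction. *)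
Lemma cube_snoc a u v b n : step P u v -> squier_cube P a n ->
  squier_cube P (a ++ u ++ b) n.+1.
Proof.
move=> huv [c [x [h1 h2 h3]]]; exists (rcons c (x, u, v)), b; split.
- by rewrite -cats1; apply/List.Forall_app; split=> //; apply: List.Forall_cons.
- by rewrite size_rcons h2.
move=> l; have [e ->] := cube_vertex_rcons c x u v b l.
have [s hs] := (joinable_deriv _ _).1 (h3 l).
have [s' hs'] := deriv_context [::] (u ++ b) hs; apply/joinable_deriv.
case: e; last by exists s'.
exists (s' ++ [:: Move (cube_vertex c x l) u v b]); apply/deriv_cat.
by exists (cube_vertex c x l ++ u ++ b).
Qed.

Lemma cube_bound a u v b p n : deriv P w p (a ++ u ++ b) -> step P u v ->
  squier_cube P a n -> n < d.
Proof.
move=> hp huv hn; have [_] := hdim; apply.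
by apply: cube_deriv (deriv_sinv hp) _; apply: cube_snoc huv hn.
Qed.

(** This is dim S(P, a) when [a] stands to the left of a move reachable from [w]: by [cube_bound]
    all cubes there have dimension less than [d], so the bounded maximum misses none. *)
Definition rank a : nat := \max_(n < d | `[< squier_cube P a n >]) n.

Lemma cube_rank a u v b p n : deriv P w p (a ++ u ++ b) -> step P u v ->
  squier_cube P a n -> n <= rank a.
Proof.
move=> hp huv hn; have hd := cube_bound hp huv hn.
exact: (@leq_bigmax_cond _ (fun n : 'I_d => `[< squier_cube P a n >]) (@nat_of_ord d)
  (Ordinal hd) (asboolT hn)).
Qed.

Lemma rank_cube a u v b p : deriv P w p (a ++ u ++ b) -> step P u v ->
  squier_cube P a (rank a) /\ rank a < d.
Proof.
move=> hp huv.
have h0 : squier_cube P a 0.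
  exists [::], a; split=> // l; apply/joinable_deriv; by exists [::].
have d0 := cube_bound hp huv h0.
have [|i hi E] := @eq_bigmax_cond _ (fun n : 'I_d => `[< squier_cube P a n >]) (@nat_of_ord d).
  by apply/card_gt0P; exists (Ordinal d0); apply/asboolP.
have -> : rank a = i := E.
by split; [apply/asboolP | apply: ltn_ord].
Qed.

Lemma rank_eq a s a' : deriv P a s a' -> rank a = rank a'.
Proof.
move=> hs; apply: eq_bigl => n; apply/asboolP/asboolP; apply: cube_deriv hs || exact: cube_deriv (deriv_sinv hs).
Qed.

Lemma rank_lt a u v b u' v' c p : deriv P w p (a ++ u ++ b ++ u' ++ c) ->
  step P u v -> step P u' v' -> rank a < rank (a ++ u ++ b).
Proof.
move=> hp huv huv'; have [h _] := rank_cube hp huv.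
by apply: cube_rank huv' (cube_snoc b huv h); rewrite -!catA; apply: hp.
Qed.

Definition color m := rank (ml m).

Lemma color_lt p m : edge_at P w p m -> color m < d.
Proof. by case=> hm hp; have [] := rank_cube hp hm. Qed.

Lemma around_derivL u k a b a' b' : around P u k a b a' b' -> exists s, deriv P a s a'.
Proof.
elim=> [? ?|x s t y b0 k0 ? ? hs _ [r hr]|//]; first by exists [::].
by exists (Move x s t y :: r).
Qed.

(** A move to the left of [u] has smaller rank than [a], since its own cell enlarges the prefix; a
    move to the right has larger rank, since [u -> v] enlarges its prefix. The rank of the prefix
    itself is constant along [k]. *)
Lemma around_color u v k a b a' b' p : around P u k a b a' b' ->
  deriv P w p (a ++ u ++ b) -> step P u v -> all (fun m => color m != rank a) k.
Proof.
move=> h; elim: h p => // {k a b a' b'}.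
  move=> x s t y b k a' b' hs _ IH p hp huv /=.
  have lt : rank x < rank (x ++ s ++ y).
    by apply: (@rank_lt x s t y u v b p) => //; move: hp; rewrite -!catA.
  have eq : rank (x ++ s ++ y) = rank (x ++ t ++ y).
    by apply: (@rank_eq _ [:: Move x s t y]).
  rewrite /color /= neq_ltn lt /=; rewrite eq; apply: (IH (p ++ [:: Move x s t (y ++ u ++ b)])) => //.
  by apply/deriv_cat; exists (x ++ s ++ y ++ u ++ b); rewrite /= ?catA -?catA //; move: hp; rewrite -!catA.
move=> a x s t y k a' b' hs _ IH p hp huv /=.
have lt : rank a < rank (a ++ u ++ x).
  by apply: (@rank_lt a u v x s t y p).
rewrite /color /= neq_ltn lt orbT; apply: (IH (p ++ [:: Move (a ++ u ++ x) s t y])) => //.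
by apply/deriv_cat; exists (a ++ u ++ x ++ s ++ y); rewrite /= /msrc /mtgt /= -?catA.
Qed.

End Rank.

(** * The trees *)

Section Walks.
Variables (T : Type) (adj : T -> T -> Prop).

Lemma walk_cat x p q : walk adj x (p ++ q) <-> walk adj x p /\ walk adj (last x p) q.
Proof.
elim: p x => [|y p IH] x /=; first by split=> [|[]].
by split=> [[h /IH[]]|[[h h1] h2]] //; split=> //; apply/IH.
Qed.

Lemma joinable_refl x : joinable adj x x.
Proof. by exists 0, [::]. Qed.

Lemma joinable_trans y x z : joinable adj x y -> joinable adj y z -> joinable adj x z.
Proof.
case=> n [p [h1 h2 _]] [m [q [h3 h4 _]]]; exists (size (p ++ q)), (p ++ q); split=> //.
  by apply/walk_cat; rewrite h2.
by rewrite last_cat h2.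
Qed.

Lemma joinable_step x y : adj x y -> joinable adj x y.
Proof. by exists 1, [:: y]. Qed.

Lemma joinable_sym : (forall x y, adj x y -> adj y x) ->
  forall x y, joinable adj x y -> joinable adj y x.
Proof.
move=> hs x y [n [p [h1 <- _]]]; elim: p x h1 => [|z p IH] x /=.
  by move=> _; apply: joinable_refl.
by case=> /hs h /IH h'; apply: joinable_trans h' (joinable_step h).
Qed.

Lemma graph_distP x y : joinable adj x y ->
  joined adj (graph_dist adj x y) x y /\ forall m, joined adj m x y -> graph_dist adj x y <= m.
Proof.
case=> n hn; have [k [hk hmin]] : exists k, joined adj k x y /\ forall m, joined adj m x y -> k <= m.
  have [k] := ubnP n; elim: k n hn => // k IH n hn hk.
  have [h|h] := pselect (exists2 m, joined adj m x y & m < n).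
    by case: h => m hm lt; apply: (IH m hm); apply: leq_trans lt _.
  exists n; split=> // m hm; rewrite leqNgt; apply/negP => lt; apply: h; by exists m.
exact: (@xgetPex nat 0 [set k | joined adj k x y /\ forall m, joined adj m x y -> k <= m]%classic
  (ex_intro _ k (conj hk hmin))).
Qed.

End Walks.

Lemma last_In (T : Type) (x : T) p : List.In (last x p) (x :: p).
Proof. by elim: p x => [|y p IH] x /=; [left | right; apply: IH]. Qed.

Lemma count_pairwise (T : Type) (r : rel T) (a : pred T) s :
  pairwise r s -> (forall x y, a x -> a y -> r x y -> False) -> count a s <= 1.
Proof.
move=> + h; elim: s => //= x s IH /andP[hx /IH hs].
case ax: (a x) => //=; suff -> : count a s = 0 by [].
elim: s hx {IH hs} => //= y s IH /andP[hy /IH ->]; rewrite addn0.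
by case ay: (a y) => //; case: (h x y).
Qed.

(** * The tree of one color *)

Section HyperplaneTree.
Variables (Sigma : Type) (P : presentation Sigma) (w : seq Sigma) (d : nat).
Hypothesis hdim : squier_dim P w d.
Variable i : nat.
Local Notation color := (color P d).
Implicit Types (k p q r s t : seq (move Sigma)) (m n o : move Sigma).

Definition valid s := exists y, deriv P w s y.

Definition other_colors k := all (fun m => color m != i) k.

(* Two vertices of the universal cover are equivalent if they are joined by a
   path that crosses no hyperplane of color [i]. *)
Definition eqv s t := exists y k, htpy P w y t (s ++ k) /\ other_colors k.

Lemma other_colors_sinv k : other_colors k -> other_colors (sinv k).
Proof. by rewrite /other_colors /sinv all_rev all_map; apply: sub_all => m. Qed.

Lemma eqv_valid s t : eqv s t -> valid s /\ valid t.
Proof.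
case=> y [k [h _]]; split; last by exists y; apply: htpy_derivL h.
by have /deriv_cat[x hx _] := htpy_derivR h; exists x.
Qed.

Lemma eqv_htpy y s t : htpy P w y s t -> eqv s t.
Proof. by move=> h; exists y, [::]; rewrite cats0; split=> //; apply: htpy_sym. Qed.

Lemma eqv_refl s : valid s -> eqv s s.
Proof. by case=> y h; apply: eqv_htpy (htpy_refl h). Qed.

Lemma eqv_sym s t : eqv s t -> eqv t s.
Proof.
case=> y [k [h hk]]; have /deriv_cat[x hx hk'] := htpy_derivR h.
exists x, (sinv k); split; last exact: other_colors_sinv.
apply: htpy_sym; apply: htpy_trans (htpy_cat2 h (htpy_refl (deriv_sinv hk'))) _.
by rewrite -catA; have := htpy_cat2 (htpy_refl hx) (htpy_sinvR hk'); rewrite cats0.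
Qed.

Lemma eqv_trans s t r : eqv s t -> eqv t r -> eqv s r.
Proof.
case=> y [k [h hk]] [z [l [h' hl]]]; exists z, (k ++ l); split; last first.
  by rewrite /other_colors all_cat; apply/andP.
have /deriv_cat[x hx hl'] := htpy_derivR h'; have ex := deriv_fun (htpy_derivL h) hx; subst x.
by apply: htpy_trans h' _; rewrite catA; apply: htpy_cat2 h (htpy_refl hl').
Qed.

Lemma par_or_eqv p m q n : edge_at P w p m -> color m = i -> par_or P w p m q n ->
  eqv p q /\ color n = i.
Proof.
move=> [hm hp] hc [e1 e2 [k h1 h2]]; split.
  exists (msrc n), k; split=> //; rewrite /other_colors -hc.
  exact (around_color hdim h1 hp hm).
by have [s hs] := around_derivL h1; rewrite -hc; apply: esym (rank_eq d hs).
Qed.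

(** Paths along a hyperplane of color [i] have no move of color [i] by [around_color]. So all the
    edges dual to it collapse to a single edge of the quotient. *)
Lemma par_ends p m q n : edge_at P w p m -> edge_at P w q n -> color m = i ->
  par P w p m q n -> color n = i /\
  ((eqv p q /\ eqv (p ++ [:: m]) (q ++ [:: n])) \/
   (eqv p (q ++ [:: n]) /\ eqv (p ++ [:: m]) q)).
Proof.
move=> hp hq hc [h|h].
  have [h1 h2] := par_or_eqv hp hc h; split=> //; left; split=> //.
  by have [] := par_or_eqv (edge_flip hp) hc (par_or_flip hp h).
have [h1 h2] := par_or_eqv hp hc h; split=> //; right; split=> //.
have [h3 _] := par_or_eqv (edge_flip hp) hc (par_or_flip hp h).
by apply: eqv_trans h3 _; apply: eqv_sym; apply: eqv_htpy (edge_flip2 hq).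
Qed.

Lemma chi_other p0 m0 q k y : edge_at P w p0 m0 -> color m0 = i -> valid q ->
  deriv P w (q ++ k) y -> other_colors k -> chi P w p0 m0 q k = false.
Proof.
move=> h0 hc; elim: k q => //= n k IH q hq hd /andP[hn hk].
have [x hx [sn ex _]] := (deriv_cat P w q (n :: k) y).1 hd.
have he : edge_at P w q n by split; rewrite ?ex.
rewrite (IH (q ++ [:: n])) //; last by rewrite -catA.
  rewrite addbF; apply/asboolP => h; have [hc' _] := par_ends h0 he hc h.
  by move: hn; rewrite hc' eqxx.
by exists (mtgt n); apply: edge_deriv.
Qed.

Lemma chi_eqv p0 m0 s t : edge_at P w p0 m0 -> color m0 = i -> eqv s t ->
  chi P w p0 m0 [::] s = chi P w p0 m0 [::] t.
Proof.
move=> h0 hc hst; have [hs _] := eqv_valid hst; case: hst => y [k [h hk]].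
rewrite (chi_htpy h0 h) chi_cat /=.
by rewrite (chi_other h0 hc hs (htpy_derivR h) hk) addbF.
Qed.

Lemma eqv_eq s t : valid s -> valid t -> eqv s = eqv t <-> eqv s t.
Proof.
move=> hs ht; split=> [->|h]; first exact: eqv_refl.
by apply/funext => r; apply/propext; split; apply: eqv_trans => //; apply: eqv_sym.
Qed.

Definition vertex := {A : seq (move Sigma) -> Prop | exists2 s, valid s & A = eqv s}.

Definition vertex_of s (h : valid s) : vertex := exist _ (eqv s) (ex_intro2 _ _ s h erefl).

Definition repr (A : vertex) : seq (move Sigma) := s2val (cid2 (svalP A)).

Lemma vertex_ext (A B : vertex) : sval A = sval B -> A = B.
Proof. by case: A B => [A hA] [B hB] /= E; subst B; rewrite (Prop_irrelevance hA hB). Qed.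

Lemma valid_repr A : valid (repr A).
Proof. by rewrite /repr; case: cid2. Qed.

Lemma sval_repr A : sval A = eqv (repr A).
Proof. by rewrite /repr; case: cid2. Qed.

Lemma repr_eqv A s : valid s -> sval A = eqv s -> eqv s (repr A).
Proof. by move=> hs E; apply/eqv_eq => //; [apply: valid_repr | rewrite -E sval_repr]. Qed.

Definition hadj (A B : vertex) := exists s m,
  [/\ edge_at P w s m, color m = i, sval A = eqv s & sval B = eqv (s ++ [:: m])].

Lemma edge_valid s m : edge_at P w s m -> valid s /\ valid (s ++ [:: m]).
Proof. by move=> h; split; [exists (msrc m); case: h | exists (mtgt m); apply: edge_deriv]. Qed.

Lemma hadj_sym A B : hadj A B -> hadj B A.
Proof.
case=> s [m [h hc hA hB]]; exists (s ++ [:: m]), (minv m); split=> //; first exact: edge_flip.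
rewrite hA; apply/eqv_eq; [by case: (edge_valid h) | |exact: eqv_htpy (edge_flip2 h)].
by case: (edge_valid (edge_flip h)).
Qed.

(** By [chi_eqv] the parity does not depend on the representative when the hyperplane has color
    [i]. *)
Definition side p0 m0 (A : vertex) := chi P w p0 m0 [::] (repr A).

Lemma sideE p0 m0 A s : edge_at P w p0 m0 -> color m0 = i -> valid s -> sval A = eqv s ->
  side p0 m0 A = chi P w p0 m0 [::] s.
Proof. by move=> h0 hc hs hA; apply/esym/(chi_eqv h0 hc)/repr_eqv. Qed.

Lemma side_step p0 m0 s m A B : edge_at P w p0 m0 -> color m0 = i -> edge_at P w s m ->
  sval A = eqv s -> sval B = eqv (s ++ [:: m]) ->
  side p0 m0 B = `[< par P w p0 m0 s m >] (+) side p0 m0 A.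
Proof.
move=> h0 hc h hA hB; have [v1 v2] := edge_valid h.
by rewrite (sideE h0 hc v1 hA) (sideE h0 hc v2 hB) chi_cat /= addbF addbC.
Qed.

Lemma side_edge p0 m0 A B : edge_at P w p0 m0 -> color m0 = i -> 
  sval A = eqv p0 -> sval B = eqv (p0 ++ [:: m0]) -> side p0 m0 A <> side p0 m0 B.
Proof.
move=> h0 hc hA hB; rewrite (side_step h0 hc h0 hA hB) asboolT; last exact: par_refl.
by case: side.
Qed.

Lemma hadj_irr A : ~ hadj A A.
Proof. by case=> s [m [h hc h1 h2]]; case: (side_edge h hc h1 h2). Qed.

(** The parity changes only at an edge parallel to [(p0, m0)], and by [par_ends] this has the same
    ends in the quotient. So every edge of the quotient is a bridge. *)
Lemma side_ends p0 m0 A0 B0 A B : edge_at P w p0 m0 -> color m0 = i ->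
  sval A0 = eqv p0 -> sval B0 = eqv (p0 ++ [:: m0]) ->
  hadj A B -> side p0 m0 A <> side p0 m0 B -> (A = A0 /\ B = B0) \/ (A = B0 /\ B = A0).
Proof.
move=> h0 hc hA0 hB0 [s [m [h _ hA hB]]]; rewrite (side_step h0 hc h hA hB).
case: asboolP => // hp _; have [_ hends] := par_ends h0 h hc hp.
have [v1 v2] := edge_valid h; have [v3 v4] := edge_valid h0.
case: hends => -[e1 e2]; [left | right]; split; apply: vertex_ext;
  rewrite ?hA ?hB ?hA0 ?hB0; apply/esym/eqv_eq => //.
Qed.

Lemma vertex_connected A B : joinable hadj A B.
Proof.
have base : valid [::] by exists w.
suff h C : joinable hadj (vertex_of base) C.
  by apply: joinable_trans (h B); apply: joinable_sym (h A); apply: hadj_sym.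
have [s hs hC] := svalP C; have {hC} -> : C = vertex_of hs by apply: vertex_ext.
elim/last_ind: s hs {C} => [|s m IH] hs.
  by rewrite (_ : hs = base); [apply: joinable_refl | apply: Prop_irrelevance].
have h : edge_at P w s m.
  by case: hs => y; rewrite -cats1 => /deriv_cat[x hx [h1 h2 _]]; split; rewrite ?h2.
have [hs' _] := edge_valid h; apply: joinable_trans (IH hs') _.
have [hc|/eqP hc] := eqVneq (color m) i.
  by apply: joinable_step; exists s, m; split=> //=; rewrite cats1.
rewrite (_ : vertex_of hs = vertex_of hs'); first exact: joinable_refl.
apply: vertex_ext; apply/esym/eqv_eq => //; exists (mtgt m), [:: m]; rewrite cats1.
split; last by rewrite /other_colors /= andbT; apply/eqP.
by rewrite -cats1; apply: htpy_refl; apply: edge_deriv.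
Qed.

(** After its first edge a cycle stays away from [A0] until it closes, so it remains on one side of
    the hyperplane of that edge. The closing edge changes sides, hence would be the first edge
    again. *)
Lemma vertex_acyclic : acyclic hadj.
Proof.
move=> A0 [|B0 p] //= [h01 hw] /List.NoDup_cons_iff[n0 /List.NoDup_cons_iff[n1 _]] sz hl.
have [p0 [m0 [h0 hc hA hB]]] := h01.
have hne := side_edge h0 hc hA hB.
have same (q : seq vertex) A1 : walk hadj A1 q -> ~ List.In A0 (A1 :: q) ->
    side p0 m0 (last A1 q) = side p0 m0 A1.
  elim: q A1 => //= A2 q IH A1 [h12 hq] n2.
  rewrite IH //; last by move=> h; apply: n2; right.
  apply: contrapT => h; apply: n2.
  by have [[-> _]|[_ ->]] := side_ends h0 hc hA hB h12 (nesym h); [left | right; left].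
have hd : side p0 m0 (last B0 p) <> side p0 m0 A0 by rewrite same //; apply: nesym.
case: (side_ends h0 hc hA hB hl hd) => [[E _]|[E _]].
  by apply: n0; rewrite -E; apply: last_In.
case: p {n0 hw hl hd same} n1 sz E => // A2 p n1 _ E.
by apply: n1; rewrite -E; apply: last_In.
Qed.

Definition hyperplane_tree : tree :=
  Tree hadj_sym hadj_irr vertex_connected vertex_acyclic.

Lemma path_walk s k (hs : valid s) (hk : valid (s ++ k)) :
  joined hadj (count (fun m => color m == i) k) (vertex_of hs) (vertex_of hk).
Proof.
elim: k s hs hk => [|m k IH] s hs hk /=.
  exists [::]; split=> //=; apply: vertex_ext => /=; by rewrite cats0.
have h : edge_at P w s m.
  case: hk => y /deriv_cat[x hx [h1 h2 _]]; split=> //; by rewrite h2.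
have [_ hsm] := edge_valid h.
have hk' : valid ((s ++ [:: m]) ++ k) by rewrite -catA.
have [p [h1 h2 h3]] := IH _ hsm hk'.
have eA : vertex_of hk' = vertex_of hk by apply: vertex_ext; rewrite /= -catA.
have [hc|hc] := eqVneq (color m) i.
  exists (vertex_of hsm :: p); split=> //=; [split=> //; by exists s, m | by rewrite h2 eA | by rewrite h3].
exists p; have -> : vertex_of hs = vertex_of hsm.
  apply: vertex_ext; apply/eqv_eq => //; exists (mtgt m), [:: m]; split.
    exact: htpy_refl (edge_deriv h).
  by rewrite /other_colors /= andbT.
by rewrite h2 eA.
Qed.

(** A step of the walk changes the side for at most one of the pairwise nonparallel edges in [Js];
    the others are left to the rest of the walk. *)
Lemma walk_separated (Js : seq (seq (move Sigma) * move Sigma)) A (p : seq vertex) :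
  pairwise (fun J K => ~~ `[< par P w J.1 J.2 K.1 K.2 >]) Js ->
  List.Forall (fun J => edge_at P w J.1 J.2 /\ color J.2 = i) Js ->
  walk hadj A p -> all (fun J => side J.1 J.2 A != side J.1 J.2 (last A p)) Js ->
  size Js <= size p.
Proof.
elim: p A Js => [|B p IH] A Js hpw hJ /=.
  by case: Js hpw hJ => //= J Js _ _ _; rewrite eqxx.
case=> hAB hw hall.
pose f (J : seq (move Sigma) * move Sigma) := side J.1 J.2 A != side J.1 J.2 B.
have hf : count f Js <= 1.
  have [s [m [hsm hc hA hB]]] := hAB.
  have -> : count f Js = count (fun J => `[< par P w J.1 J.2 s m /\ edge_at P w J.1 J.2 >]) Js.
    elim: Js hJ {hpw hall} => //= J Js IHJ /List.Forall_cons_iff[[h1 h2] /IHJ ->].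
    congr (nat_of_bool _ + _); rewrite /f (side_step h1 h2 hsm hA hB).
    apply/idP/asboolP => [|[h _]]; last by rewrite asboolT //; case: side.
    by case: asboolP => //=; rewrite eqxx.
  apply: count_pairwise hpw _ => J K /asboolP[h1 e1] /asboolP[h2 e2] /asboolP; apply.
  exact: par_trans e1 hsm e2 h1 (par_sym e2 hsm h2).
have := count_predC f Js; suff : count (predC f) Js <= size p by lia.
rewrite -size_filter; apply: (IH B) => //.
- by rewrite pairwise_filter.
- elim: Js hJ {hpw hall hf} => //= J Js IHJ /List.Forall_cons_iff[h /IHJ h'].
  by case: ifP => // _; apply: List.Forall_cons.
elim: Js hall {hpw hJ hf} => //= J Js IHJ /andP[h /IHJ h'].
case: ifP => //= ; rewrite h' andbT /f negbK => /eqP <-.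
by [].
Qed.

Fixpoint colored_edges s k : seq (seq (move Sigma) * move Sigma) :=
  if k is m :: k' then
    let es := colored_edges (s ++ [:: m]) k' in
    if color m == i then (s, m) :: es else es
  else [::].

Lemma size_colored_edges s k : size (colored_edges s k) = count (fun m => color m == i) k.
Proof. by elim: k s => //= m k IH s; case: ifP => _ /=; rewrite IH. Qed.

Lemma colored_edges_split s k : List.Forall (fun J => exists a b,
  [/\ k = a ++ J.2 :: b, J.1 = s ++ a & color J.2 = i]) (colored_edges s k).
Proof.
elim: k s => [|m k IH] s /=; first exact: List.Forall_nil.
have h : List.Forall (fun J => exists a b,
    [/\ m :: k = a ++ J.2 :: b, J.1 = s ++ a & color J.2 = i]) (colored_edges (s ++ [:: m]) k).
  apply: List.Forall_impl (IH (s ++ [:: m])) => J [a [b [-> -> hc]]].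
  by exists (m :: a), b; rewrite -catA.
case: eqP => // hc; apply: List.Forall_cons h.
by exists [::], k; rewrite cats0.
Qed.

Lemma Forall_all (T : Type) (Q : T -> Prop) (b : pred T) l :
  (forall x, Q x -> b x) -> List.Forall Q l -> all b l.
Proof. by move=> h; elim=> //= x l' /h -> _ ->. Qed.

Lemma cat_edge s a m b : valid (s ++ a ++ m :: b) -> edge_at P w (s ++ a) m.
Proof.
by case=> y; rewrite catA => /deriv_cat[x hx [h1 h2 _]]; split; rewrite ?h2.
Qed.

Lemma not_parallel s a m b n c : irred (a ++ m :: b ++ n :: c) ->
  valid (s ++ a ++ m :: b ++ n :: c) -> ~ par P w (s ++ a) m (s ++ a ++ m :: b) n.
Proof.
move=> hi hv hp; have := @irred_infix _ a (m :: b ++ n :: c) [::]; rewrite cats0 => /(_ hi).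
rewrite -cat_cons => hi'; apply: (crossing (w := w) (P := P) (r := s ++ a) hi').
- exact: cat_edge hv.
- by rewrite -catA; apply: (@cat_edge s (a ++ m :: b) n c); rewrite -catA.
- by rewrite -catA.
Qed.

Lemma chi_false p0 m0 q k : (forall a n b, k = a ++ n :: b -> ~ par P w p0 m0 (q ++ a) n) ->
  chi P w p0 m0 q k = false.
Proof.
elim: k q => //= n k IH q h; rewrite IH => [|a m b E].
  by rewrite addbF; apply/asboolP; have := h [::] n k erefl; rewrite cats0.
by rewrite -catA; apply: (h (n :: a) m b); rewrite E.
Qed.

(** By [not_parallel] no other move of an irreducible derivation crosses the hyperplane of [m], so
    the number of crossings is exactly one. *)
Lemma chi_irred s a m b : irred (a ++ m :: b) -> valid (s ++ a ++ m :: b) ->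
  chi P w (s ++ a) m s (a ++ m :: b).
Proof.
move=> hi hv; have he := cat_edge hv.
rewrite chi_cat /= asboolT; last exact: par_refl.
rewrite !chi_false ?addbF //.
  move=> c n e E; subst b; have := not_parallel hi hv; rewrite -!catA; exact.
move=> c n e E h; subst a; have hi' := hi; have hv' := hv.
rewrite -!catA /= in hi' hv'; apply: (not_parallel hi' hv').
by apply: par_sym h => //; apply: cat_edge hv'.
Qed.

(** The upper bound is [path_walk]. For the lower one, the moves of color [i] in [k] give pairwise
    nonparallel edges whose hyperplanes, each crossed once, separate the two vertices;
    [walk_separated] counts them. *)
Lemma tree_distance s k (hs : valid s) (hk : valid (s ++ k)) : irred k ->
  graph_dist hadj (vertex_of hs) (vertex_of hk) = count (fun m => color m == i) k.
Proof.
move=> hi; have [h1 h2] := graph_distP (vertex_connected (vertex_of hs) (vertex_of hk)).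
apply/eqP; rewrite eqn_leq h2 /=; last exact: path_walk.
case: h1 => p [hp hl hsz]; rewrite -hsz -(size_colored_edges s).
have hsplit := colored_edges_split s k.
apply: (walk_separated _ _ hp).
- elim: k s hs hk hi {hp hl hsz h2 hsplit p} => //= m k IH s hs hk hi.
  have he := @cat_edge s [::] m k hk; rewrite cats0 in he.
  have hk' : valid ((s ++ [:: m]) ++ k) by rewrite -catA.
  have [_ hs'] := edge_valid he.
  have hi' : irred k by have := @irred_infix _ [:: m] k [::]; rewrite cats0; apply.
  have {IH} := IH _ hs' hk' hi'; case: ifP => //= _ ->; rewrite andbT.
  apply: (Forall_all _ (colored_edges_split (s ++ [:: m]) k)) => J [a [b [E EJ _]]].
  apply/asboolP => /= h; rewrite EJ -catA /= in h; rewrite E in hi hk.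
  have := @not_parallel s [::] m a J.2 b hi hk; rewrite cats0; apply.
  exact: h.
- apply: List.Forall_impl hsplit => J [a [b [E EJ hc]]]; split=> //.
  by rewrite EJ; apply: (@cat_edge s a J.2 b); rewrite -E.
apply: Forall_all hsplit => J [a [b [E EJ hc]]].
have he : edge_at P w J.1 J.2 by rewrite EJ; apply: (@cat_edge s a J.2 b); rewrite -E.
rewrite hl (sideE (A := vertex_of hs) he hc hs erefl) (sideE (A := vertex_of hk) he hc hk erefl).
rewrite chi_cat /= EJ.
have -> : chi P w (s ++ a) J.2 s k = true by rewrite E; apply: chi_irred; rewrite -E.
by case: chi.
Qed.

End HyperplaneTree.

Lemma sum_colors (Sigma : Type) (P : presentation Sigma) w d k s :
  squier_dim P w d -> valid P w (s ++ k) ->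
  \sum_(i < d) count (fun m => color P d m == i) k = size k.
Proof.
move=> hdim; elim: k s => [|m k IH] s hv /=; first by rewrite big1.
have he := @cat_edge _ P w s [::] m k hv; rewrite cats0 in he.
rewrite big_split /= (IH (s ++ [:: m])); last by rewrite -catA.
have hc := color_lt hdim he; rewrite (bigD1 (Ordinal hc)) //= eqxx big1 ?addn0 //.
by move=> j hj; case: eqP => // E; case/eqP: hj; apply: val_inj.
Qed.

(** * The diagram group *)

Section Group.
Variables (Sigma : Type) (P : presentation Sigma) (w : seq Sigma).
Hypothesis wn : w <> [::].
Local Notation G := (diagram_group P w).
Implicit Types (g h k x y : G) (D : diagram P).

Lemma iso_dlabel D D' : diag_iso D D' ->
  dlabel (dtop D') = dlabel (dtop D) /\ dlabel (dbot D') = dlabel (dbot D).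
Proof.
case=> fv [fe [fc [_ m _ _ [_ _ -> ->]]]].
by rewrite /dlabel -!map_comp; split; apply: eq_map => e; have [] := m e isT.
Qed.

Lemma representative_ww g : reduced_ww w (representative g).
Proof. by rewrite /representative; case: cid2. Qed.

Lemma sval_representative g : sval g = [set D' | diag_iso (representative g) D']%classic.
Proof. by rewrite /representative; case: cid2. Qed.

Lemma label_nonempty D : dlabel (dtop D) = w -> dtop D <> [::].
Proof. by move=> h E; apply: wn; rewrite -h E. Qed.

Lemma representative_realizes g : exists s, realizes (representative g) s.
Proof. by have [h _ _] := representative_ww g; apply: realizes_ex (label_nonempty h). Qed.

Definition derivation_of g := sval (cid (representative_realizes g)).
Local Notation dv := derivation_of.

Lemma dv_realizes g : realizes (representative g) (dv g).
Proof. by rewrite /derivation_of; case: cid. Qed.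

Lemma dv_deriv g : deriv P w (dv g) w.
Proof. by have [h1 h2 _] := representative_ww g; have := realizes_deriv (dv_realizes g); rewrite h1 h2. Qed.

Lemma dv_irred g : irred (dv g).
Proof.
have [h1 _ h3] := representative_ww g.
exact: reduced_irred (label_nonempty h1) h3 (dv_realizes g).
Qed.

Lemma dv_size g : size (dv g) = number_of_cells g.
Proof.
have [h1 _ _] := representative_ww g.
exact: realizes_size (label_nonempty h1) (dv_realizes g).
Qed.

Lemma mem_group g D : sval g D -> 
  [/\ dlabel (dtop D) = w, dlabel (dbot D) = w & realizes D (dv g)].
Proof.
rewrite sval_representative => h; have [h1 h2 _] := representative_ww g.
have [-> ->] := iso_dlabel h; split=> //; exact: iso_realizes h (dv_realizes g).
Qed.

Lemma iso_refl D : dtop D <> [::] -> diag_iso D D.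
Proof. by move=> n; have [s hs] := realizes_ex n; exact: (realizes_iso n erefl hs hs). Qed.

Lemma representative_mem g : sval g (representative g).
Proof.
rewrite sval_representative /=; apply: iso_refl.
by have [h _ _] := representative_ww g; apply: label_nonempty.
Qed.

(** Homotopic irreducible derivations agree up to commutation, and diagrams with a common
    realization are isotopic. *)
Lemma dv_inj g h : htpy P w w (dv g) (dv h) -> g = h.
Proof.
move=> hgh; have hc := htpy_irred_comm wn hgh (@dv_irred g) (@dv_irred h).
suff E : sval g = sval h.
  by case: g h E {hgh hc} => [A hA] [B hB] /= E; subst B; rewrite (Prop_irrelevance hA hB).
have sub x y D : comm (dv x) (dv y) -> sval x D -> sval y D.
  move=> hxy /mem_group[h1 h2 h3]; rewrite sval_representative /=.
  have [h4 _ _] := representative_ww y.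
  apply: realizes_iso (label_nonempty h4) _ (dv_realizes y) (comm_realizes hxy h3).
  by rewrite h4 h1.
by apply/funext => D; apply/propext; split; apply: sub => //; apply: comm_sym.
Qed.

Definition class_of D (h : reduced_ww w D) : G :=
  exist _ [set D' | diag_iso D D']%classic (ex_intro2 _ _ D h erefl).

Lemma class_of_mem D (h : reduced_ww w D) : sval (class_of h) D.
Proof. by have [h1 _ _] := h; apply: iso_refl (label_nonempty h1). Qed.

Lemma reduced_class D s : dlabel (dtop D) = w -> dlabel (dbot D) = w -> realizes D s ->
  exists g D', [/\ reduces D D', sval g D' & htpy P w w (dv g) s].
Proof.
move=> h1 h2 hs; have n := label_nonempty h1.
have [D' [hred hr]] := reduced_exists n.
have [n' l1 l2 h] := reduces_htpy n hred hs.
have hww : reduced_ww w D' by split; rewrite ?l1 ?l2.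
exists (class_of hww), D'; split=> //; first exact: class_of_mem.
have [_ _ hr'] := mem_group (class_of_mem hww).
by apply: htpy_sym; have := h _ hr'; rewrite h1 h2.
Qed.

Lemma dv_surj s : deriv P w s w -> exists g, htpy P w w (dv g) s.
Proof.
move=> hs; have [D [n h1 h2 hr]] := diagram_of wn hs.
by have [g [D' [_ _ h]]] := reduced_class h1 h2 hr; exists g.
Qed.

Lemma product_htpy g h k : is_product g h k -> htpy P w w (dv k) (dv g ++ dv h).
Proof.
case=> D1 [D2 [D [D' [/mem_group[h1 _ r1] /mem_group[_ _ r2] hc hred /mem_group[h3 h3' r3]]]]].
have hr := concat_realizes hc r1 r2.
have n : dtop D <> [::].
  case: hc => v1 [f1 [c1 [v2 [f2 [c2 [_ _ _ _ [-> _]]]]]]].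
  by have := label_nonempty h1; case: (dtop D1).
have [_ l1 l2 /(_ _ r3)] := reduces_htpy n hred hr.
by rewrite -l1 -l2 h3 h3' => /htpy_sym.
Qed.

Lemma dv_cat g h : deriv P w (dv g ++ dv h) w.
Proof. by apply/deriv_cat; exists w; apply: dv_deriv. Qed.

Lemma product_exists g h : exists k, is_product g h k.
Proof.
have [D [n h1 h2 hr]] := diagram_of wn (dv_cat g h).
have [k [D' [hred hk _]]] := reduced_class h1 h2 hr; exists k.
have [a1 a2 _] := representative_ww g; have [b1 b2 _] := representative_ww h.
exists (representative g), (representative h), D, D'; split=> //; try exact: representative_mem.
apply: (concat_exists (label_nonempty a1) (label_nonempty b1) n _ _
  (dv_realizes g) (dv_realizes h) hr); first by rewrite a1 h1.
by rewrite a2 b1.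
Qed.

(** The product supplied by [product_exists] has a derivation homotopic to that of [k], so it is [k]
    by [dv_inj]. *)
Lemma htpy_product g h k : htpy P w w (dv k) (dv g ++ dv h) -> is_product g h k.
Proof.
move=> hk; have [k' hk'] := product_exists g h; suff -> : k = k' by [].
exact: dv_inj (htpy_trans hk (htpy_sym (product_htpy hk'))).
Qed.

(** * Left invariance of the word metric *)

Section Metric.
Variable S : set G.

(** Left multiplication by [x]. Generators act on the right in [cayley], so it preserves
    adjacency. *)
Definition translate x y := sval (cid (product_exists x y)).

Lemma translate_htpy x g : htpy P w w (dv (translate x g)) (dv x ++ dv g).
Proof. by rewrite /translate; case: cid => k h; apply: product_htpy h. Qed.

Lemma translate_cayley x g h : cayley S g h -> cayley S (translate x g) (translate x h).
Proof.
have aux u v s : is_product u s v -> is_product (translate x u) s (translate x v).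
  move=> /product_htpy huv; apply: htpy_product.
  apply: htpy_trans (translate_htpy x v) _.
  apply: htpy_trans (htpy_cat2 (htpy_refl (dv_deriv x)) huv) _.
  rewrite catA; apply: htpy_cat2 (htpy_sym (translate_htpy x u)) (htpy_refl (dv_deriv s)).
by case=> s hs [] hp; exists s => //; [left | right]; apply: aux.
Qed.

Lemma translate_joined n x g h : joined (cayley S) n g h ->
  joined (cayley S) n (translate x g) (translate x h).
Proof.
case=> p [h1 <- <-]; exists (map (translate x) p); split; rewrite ?last_map ?size_map //.
by elim: p g h1 => //= h' p IH g [h2 /IH h3]; split=> //; apply: translate_cayley.
Qed.

Lemma translateK x x' : htpy P w w (dv x') (sinv (dv x)) ->
  forall g, translate x' (translate x g) = g.
Proof.
move=> hx g; apply: dv_inj; apply: htpy_trans (translate_htpy _ _) _.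
apply: htpy_trans (htpy_cat2 hx (translate_htpy x g)) _.
by rewrite catA; apply: htpy_cat2 (htpy_sinvL (dv_deriv x)) (htpy_refl (dv_deriv g)).
Qed.

Lemma word_metric_translate x g h :
  word_metric S (translate x g) (translate x h) = word_metric S g h.
Proof.
have [x' hx'] := dv_surj (deriv_sinv (dv_deriv x)).
(* The distance depends only on the set of lengths of joining walks, and these sets are equal for
   the two pairs. *)
pose mindist (Q : nat -> Prop) := xget 0 [set n | Q n /\ forall m, Q m -> n <= m]%classic.
rewrite -[LHS]/(mindist (fun n => joined (cayley S) n _ _)).
rewrite -[RHS]/(mindist (fun n => joined (cayley S) n g h)); congr mindist.
apply/funext => n; apply/propext; split; last exact: translate_joined.
by move/(translate_joined x'); rewrite !(translateK hx').
Qed.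

(** [k] is the inverse of [x] times [y]. It turns distances between arbitrary elements into
    distances from the identity, to which Property B applies. *)
Lemma quotient_exists x y : exists k, htpy P w w (dv y) (dv x ++ dv k) /\
  forall e, is_identity e -> word_metric S x y = word_metric S e k.
Proof.
have hx := dv_deriv x; have hx' := deriv_sinv hx; have hy := dv_deriv y.
have hxy : deriv P w (sinv (dv x) ++ dv y) w by apply/deriv_cat; exists w.
have [k hk] := dv_surj hxy; exists k.
have h : htpy P w w (dv y) (dv x ++ dv k).
  apply: htpy_sym; apply: htpy_trans (htpy_cat2 (htpy_refl hx) hk) _; rewrite catA.
  exact: htpy_cat2 (htpy_sinvR hx) (htpy_refl hy).
split=> // e he; have e0 : dv e = [::] by apply/size0nil; rewrite dv_size.
have xe : translate x e = x.
  by apply: dv_inj; have := translate_htpy x e; rewrite e0 cats0.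
have xk : translate x k = y.
  by apply: dv_inj; apply: htpy_trans (translate_htpy x k) (htpy_sym h).
by rewrite -[in LHS]xe -[in LHS]xk word_metric_translate.
Qed.

End Metric.

Variable d : nat.
Hypothesis hdim : squier_dim P w d.

Lemma dv_valid g : valid P w (dv g).
Proof. by exists w; apply: dv_deriv. Qed.

(** The elements of the group are the vertices of the universal cover above [w]; each goes to its
    class in the tree of color [i]. *)
Definition tree_map g (i : 'I_d) : hyperplane_tree hdim i := vertex_of d i (dv_valid g).

(** The colors partition the moves of the irreducible derivation [dv k], and the tree of color [i]
    counts those of color [i]. So the distance in the product is an exact number of cells. *)
Lemma tree_map_distance x y k : htpy P w w (dv y) (dv x ++ dv k) ->
  @trees_dist d (fun i => hyperplane_tree hdim i) (tree_map x) (tree_map y) = number_of_cells k.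
Proof.
move=> h; have hv : valid P w (dv x ++ dv k) by exists w; apply: htpy_derivR h.
rewrite -dv_size -(sum_colors hdim hv); apply: eq_bigr => i _.
have -> : tree_map y i = vertex_of d i hv.
  by apply: vertex_ext; apply/eqv_eq => //; [apply: dv_valid | apply: eqv_htpy h].
exact (tree_distance hdim i (dv_valid x) hv (@dv_irred k)).
Qed.

End Group.

Import Order.TTheory GRing.Theory Num.Theory.

Theorem theorem1p6 (R : realType) (Sigma : Type) (P : presentation Sigma)
  (w : seq Sigma) (d : nat) (S : set (diagram_group P w)) :
  w <> [::] ->
  squier_dim P w d ->
  finite_set S ->
  generates S ->
  property_B R S ->
  exists (T : 'I_d -> tree) (f : diagram_group P w -> forall i : 'I_d, T i),
    qi_embedding R (word_metric S) (@trees_dist d T) f.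
Proof.
move=> wn hdim _ _ [e he [C1 [C2 [C1_gt0 C2_gt0 hC]]]].
exists (fun i => hyperplane_tree hdim i), (tree_map wn hdim).
have C1V : (0 < C1^-1)%R by rewrite invr_gt0.
(* The term [1] yields [1 <= A], [C2] serves the lower estimate and [C1^-1] the upper one. The
   additive constant is 0 because distances in the trees equal numbers of cells exactly. *)
pose A := (1 + C2 + C1^-1)%R.
have A1 : (1 <= A)%R by rewrite /A -addrA lerDl addr_ge0 // ltW.
have A_gt0 : (0 < A)%R := lt_le_trans ltr01 A1.
exists A, 0%R; split=> // x y; have [k [h /(_ e he) hxy]] := quotient_exists wn S x y.
rewrite (tree_map_distance hdim h) hxy subr0 addr0.
have /andP[h1 h2] := hC k; apply/andP; split.
  rewrite ler_pdivrMl //; apply: le_trans h2 _; rewrite ler_wpM2r //.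
  by rewrite /A addrAC lerDr addr_ge0 // ltW.
rewrite -(ler_pM2l C1_gt0); apply: le_trans h1 _; rewrite mulrA ler_peMl //.
by rewrite /A mulrDr divff ?gt_eqF // lerDr mulr_ge0 ?addr_ge0 // ltW.
Qed.
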